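(* Let $q$ be a prime power, let $f(x)=\sum_{j=1}^{d+2}u_j\prod_{i=1}^dx_i^{m_{ij}}$ with $u_j\in\mathbb{F}_q^\times$ be a Laurent polynomial with distinct exponent vectors, $d$-dimensional Newton polytope $\Delta$, and Gale dual $\gamma\in\mathbb{Z}^{d+2}$ having no zero component, the monomials being ordered so that $\gamma_1,\dots,\gamma_r<0$ and $\gamma_{r+1},\dots,\gamma_{r+s}>0$ with $r+s=d+2$. Let $Z\subset\mathbb{G}_m^d$ be the hypersurface $f=0$ over $\mathbb{F}_q$, and let $W$ be the closure of $Z$ in the toric variety $\mathbb{P}'=\mathbb{P}_{\Sigma'}$. If $q$ is coprime to $\gamma_1\cdots\gamma_{d+2}$, then $$\#W(\mathbb{F}_q)=\sum_{k=0}^{\min(r,s)-1}\binom{r-1}{k}\binom{s-1}{k}\frac{q^{d-k}-q^k}{q-1}-\sum_{\lambda\in\Lambda(q)}\chi^{-\lambda}(\sigma)\,q^{s_{\delta(\lambda)}(0)-1}\,g(\delta(\lambda))\,F_q\!\left(\gamma,\delta(\lambda),q^\times\,\Big|\,\frac{t}{\gamma^\gamma}\right).$$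
   Context: Characters. Put $q^\times=q-1$. Fix a non-trivial additive character $\psi:\mathbb{F}_q\to\mathbb{C}^\times$ and a multiplicative character $\chi:\mathbb{F}_q^\times\to\mathbb{C}^\times$ of order $q^\times$; $\chi^m(x)=\chi(x)^m$, $\zeta_k=e^{2\pi i/k}$. The Gauss sum is $g(m)=\sum_{u\in\mathbb{F}_q^\times}\psi(u)\chi^m(u)$ (it depends only on $m$ mod $q^\times$), and $g(v)=\prod_ig(v_i)$ for a vector $v$. Data attached to $f$. Let $m_i=(m_{i1},\dots,m_{i,d+2})\in\mathbb{Z}^{d+2}$ for $i=1,\dots,d$ and $\mathbf{1}=(1,\dots,1)\in\mathbb{Z}^{d+2}$. The Gale dual $\gamma\in\mathbb{Z}^{d+2}$ is the vector, unique up to sign, with $\sum_j\gamma_j=0$, $\sum_jm_{ij}\gamma_j=0$ for all $i$, and $\gcd(\gamma_1,\dots,\gamma_{d+2})=1$ (fix a choice of sign). Let $K=\{x\in\mathbb{Z}^{d+2}:\sum_j\gamma_jx_j=0\}$ and choose a $\mathbb{Z}$-basis $f_0=\mathbf{1},f_1,\dots,f_d$ of $K$; write $m_i=\sum_{l=1}^dc_{il}f_l+r_i\mathbf{1}$. Let $H=A\,(c_{il})$ with $A\in GL_d(\mathbb{Z})$ be the (upper triangular) Hermite normal form of $(c_{il})$ and put $\mathcal{N}=H^{T}$. Choose $\rho_1,\dots,\rho_d\in\mathbb{Z}^{d+2}$ with $\sum_j\rho_{kj}=0$ and $\sum_j\rho_{kj}f_{ij}=1$ if $i=k$, $=0$ if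 $i\ne k$ ($1\le i,k\le d$). (Then $Z$ is isomorphic to the variety in $\mathbb{P}^{d+1}\times\mathbb{G}_m^d$ given by $\sum_jw_j=0$, $\prod_jw_j\ne0$, $\prod_jw_j^{\gamma_j}=t$, $\prod_jw_j^{\rho_{kj}}=\sigma_k\prod_iz_i^{\mathcal{N}_{ki}}$.) Set $t=\prod_ju_j^{\gamma_j}$, $\sigma_k=\prod_ju_j^{\rho_{kj}}\in\mathbb{F}_q^\times$, $$\Lambda(q)=\Big\{\lambda\in(\mathbb{Z}/q^\times\mathbb{Z})^d:\ \sum_{k=1}^d\lambda_k\mathcal{N}_{ki}=0\text{ for }i=1,\dots,d\Big\},$$ and for $\lambda\in\Lambda(q)$ set $\delta(j,\lambda)=\sum_{k=1}^d\lambda_k\rho_{kj}\in\mathbb{Z}/q^\times\mathbb{Z}$, $\delta(\lambda)=(\delta(1,\lambda),\dots,\delta(d+2,\lambda))$, and $\chi^{-\lambda}(\sigma)=\prod_{k=1}^d\chi(\sigma_k)^{-\lambda_k}$. Finite hypergeometric sums. For $\delta\in(\mathbb{Z}/q^\times\mathbb{Z})^{d+2}$ let $D_\delta(T)$ be the greatest common divisor in $\mathbb{C}[T]$ of $\prod_{\gamma_j<0}(T^{-\gamma_j}-\zeta_{q^\times}^{\delta_j})$ and $\prod_{\gamma_j>0}(T^{\gamma_j}-\zeta_{q^\times}^{-\delta_j})$, and let $s_\delta(m)$ be the multiplicity of $e^{2\pi im/q^\times}$ as a zero of $D_\delta(T)$. For $q$ coprime to $\gamma_1\cdots\gamma_{d+2}$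 and $y\in\mathbb{F}_q^\times$, $$F_q(\gamma,\delta,q^\times\mid y)=\frac{1}{1-q}\sum_{m=0}^{q-2}\frac{g(-\gamma m+\delta)}{g(\delta)}\,q^{s_\delta(-m)-s_\delta(0)}\,\chi^m(\gamma^\gamma y),\qquad\gamma^\gamma=\prod_j\gamma_j^{\gamma_j}.$$ The toric variety $\mathbb{P}'$. Let $M$ be the $(d+1)\times(d+2)$ matrix with rows $\mathbf{1},m_1,\dots,m_d$. For $1\le i\le r<j\le r+s$ let $x^{(i,j)}=-\gamma_ie_j+\gamma_je_i\in\mathbb{R}^{d+2}$ ($e_k$ the standard basis), and let $(\alpha_0^{(i,j)},\alpha^{(i,j)})\in\mathbb{R}\times\mathbb{R}^d$ be the unique solution of $(\alpha_0^{(i,j)},\alpha^{(i,j)})M=x^{(i,j)}$; denote also by $(i,j)$ the ray $\mathbb{R}_{\ge0}\alpha^{(i,j)}$ (the inward normal ray to the facet $\operatorname{conv}\{(m_{1k},\dots,m_{dk}):k\ne i,j\}$ of $\Delta$). Consider all (possibly empty) sequences $C=((i_1,j_1),\dots,(i_l,j_l))$ of distinct pairs with $1\le i_1\le\dots\le i_l\le r$ and $r+1\le j_1\le\dots\le j_l\le r+s$; its support is $S_C=\{i_1,\dots,i_l,j_1,\dots,j_l\}$, and $\sigma_C$ is the convex cone generated by the rays $(i_1,j_1),\dots,(i_l,j_l)$ (the zero cone if $C$ is empty). $\Sigma'$ is the collection of the cones $\sigma_C$ with $S_C\ne\{1,\dots,d+2\}$; it is a simplicial fan refining the normal fan of $\Delta$,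 and $\mathbb{P}'=\mathbb{P}_{\Sigma'}$ is the associated toric variety over $\mathbb{F}_q$ (with lattice $\mathbb{Z}^d$), which contains $\mathbb{G}_m^d=\operatorname{Spec}\mathbb{F}_q[x_1^{\pm1},\dots,x_d^{\pm1}]$ as its dense torus. *)

(* Defs.v *)
From HB Require Import structures.
From mathcomp Require Import all_boot all_order all_algebra finmap.
From mathcomp Require Import all_classical all_reals all_analysis.
From mathcomp Require Import complex.

Set Implicit Arguments.
Unset Strict Implicit.
Unset Printing Implicit Defensive.

Import Order.TTheory GRing.Theory Num.Theory.

Local Open Scope classical_set_scope.
Local Open Scope ring_scope.

(* The group Z/(q-1)Z for q = #|F| >= 2. Only the additive structure is used,
   so q = 2 (where 'Z_1 would denote Z/2Z) is represented correctly. *)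
Notation Zq F := 'I_(#|F|.-2).+1.

Section Characters.
Variables (R : realType) (F : finFieldType).
Implicit Types (psi chi : F -> R[i]) (m : Zq F).

Definition is_nontrivial_additive_character psi : Prop :=
  [/\ psi 0 = 1, (forall x y, psi (x + y) = psi x * psi y)
    & (exists x, psi x != 1)].

(* The value of chi at 0 is irrelevant and never used. *)
Definition is_multiplicative_character chi : Prop :=
  chi 1 = 1 /\
  (forall x y, x != 0 -> y != 0 -> chi (x * y) = chi x * chi y).

Definition has_character_order chi (n : nat) : Prop :=
  [/\ (0 < n)%N, (forall x, x != 0 -> chi x ^+ n = 1)
    & forall k, (0 < k < n)%N -> exists2 x, x != 0 & chi x ^+ k != 1].

Definition gauss psi chi m : R[i] := \sum_(x : F | x != 0) psi x * chi x ^+ m.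

Definition gauss_vec psi chi n (v : 'I_n -> Zq F) : R[i] :=
  \prod_(j < n) gauss psi chi (v j).

(* exp (2 i pi / k) *)
Definition zeta (k : nat) : R[i] :=
  Complex (cos (2 * pi / k%:R)) (sin (2 * pi / k%:R)).

End Characters.

Section FiniteHypergeometricSums.
Variables (R : realType) (F : finFieldType) (n : nat).
Variables (gamma : 'I_n -> int).
Implicit Types (delta : 'I_n -> Zq F) (m : Zq F).

Definition hyp_gcd delta : {poly R[i]} :=
  gcdp
    (\prod_(j < n | gamma j < 0)
       ('X^(`|gamma j|%N) - (zeta R #|F|.-1 ^+ delta j)%:P))
    (\prod_(j < n | 0 < gamma j)
       ('X^(`|gamma j|%N) - (zeta R #|F|.-1 ^- delta j)%:P)).

Definition hyp_mult delta m : nat := mup (zeta R #|F|.-1 ^+ m) (hyp_gcd delta).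

Definition gamma_gamma : F := \prod_(j < n) ((gamma j)%:~R : F) ^ gamma j.

Definition hyp_sum (psi chi : F -> R[i]) delta (y : F) : R[i] :=
  (1 - #|F|%:R)^-1 *
  \sum_(m : Zq F)
    gauss_vec psi chi (fun j => delta j - m *~ gamma j) /
      gauss_vec psi chi delta
    * (#|F|%:R : R[i]) ^ ((hyp_mult delta (- m))%:Z - (hyp_mult delta 0)%:Z)
    * chi (gamma_gamma * y) ^+ m.

End FiniteHypergeometricSums.

(* F[x_1^+-1, ..., x_d^+-1], as finitely supported functions on exponents *)
Definition laurent (F : finFieldType) (d : nat) :=
  {fsfun 'rV[int]_d -> F with 0}.

Section LaurentPolynomials.
Variables (F : finFieldType) (d : nat).

Definition laurent_mul (f g : laurent F d) : laurent F d :=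
  [fsfun b in [fset (a + a')%R | a in finsupp f, a' in finsupp g]%fset =>
     \sum_(a <- finsupp f) f a * g (b - a)].

Definition exponent n (m : 'M[int]_(d, n)) (j : 'I_n) : 'rV[int]_d :=
  \row_(i < d) m i j.

Definition laurent_of n (m : 'M[int]_(d, n)) (u : 'I_n -> F) : laurent F d :=
  [fsfun a in [fset exponent m j | j in 'I_n]%fset =>
     \sum_(j < n | exponent m j == a) u j].

Definition newton_polytope (R : realType) (f : laurent F d) : set 'rV[R]_d :=
  [set x | exists c : 'rV[int]_d -> R,
     [/\ (forall a, 0 <= c a), \sum_(a <- finsupp f) c a = 1
       & x = \sum_(a <- finsupp f) c a *: map_mx intr a]].

End LaurentPolynomials.

Arguments newton_polytope {F d} R f.

(* The dimension of a nonempty set: that of the direction of its affine hull,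
   the smallest subspace V containing all differences of points. *)
Definition has_affine_dim (R : realType) d (S : set 'rV[R]_d) (k : nat) : Prop :=
  S !=set0 /\
  exists V : {vspace 'rV[R]_d},
    [/\ (forall x y, S x -> S y -> x - y \in V),
        (forall V' : {vspace 'rV[R]_d},
           (forall x y, S x -> S y -> x - y \in V') -> (V <= V')%VS)
      & \dim V = k].

(* F-points of the toric variety of a fan Sigma in R^d (with lattice Z^d),
   obtained by gluing the F-points of the affine charts
   U_sigma = Spec F[sigma^vee /\ Z^d]. *)
Section ToricVarieties.
Variables (R : realType) (F : finFieldType) (d : nat).
Implicit Types (sigma tau : set 'rV[R]_d) (x y : 'rV[int]_d -> F).

(* the monoid sigma^vee /\ Z^d *)
Definition dual_monoid sigma : set 'rV[int]_d :=
  [set a | forall v, sigma v -> 0 <= \sum_(i < d) (a 0 i)%:~R * v 0 i].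

(* U_sigma(F): homomorphisms from sigma^vee /\ Z^d to the multiplicative
   monoid of F, extended by 0 outside sigma^vee /\ Z^d so that they are determined by their
   values on this monoid. *)
Definition chart sigma : set ('rV[int]_d -> F) :=
  [set x | [/\ x 0 = 1,
     (forall a b, dual_monoid sigma a -> dual_monoid sigma b ->
        x (a + b) = x a * x b)
   & (forall a, ~ dual_monoid sigma a -> x a = 0)]].

Definition chart_eval x (g : laurent F d) : F :=
  \sum_(a <- finsupp g) g a * x a.

(* Points of U_sigma and U_tau are identified when they come from the same
   point of the common open subset U_(sigma /\ tau); in a fan, sigma /\ tau is
   a face of both cones. *)
Definition glued (p p' : set 'rV[R]_d * ('rV[int]_d -> F)) : Prop :=
  exists2 y, chart (p.1 `&` p'.1) y &
    (forall a, dual_monoid p.1 a -> y a = p.2 a) /\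
    (forall a, dual_monoid p'.1 a -> y a = p'.2 a).

Variable Sigma : set (set 'rV[R]_d).

Definition chart_points : set (set 'rV[R]_d * ('rV[int]_d -> F)) :=
  [set p | Sigma p.1 /\ chart p.1 p.2].

Definition toric_point (p : set 'rV[R]_d * ('rV[int]_d -> F)) :
    set (set 'rV[R]_d * ('rV[int]_d -> F)) :=
  [set p' | chart_points p' /\ glued p p'].

Definition toric_points : set (set (set 'rV[R]_d * ('rV[int]_d -> F))) :=
  [set toric_point p | p in chart_points].

(* The closure in U_sigma of the hypersurface f = 0 of the torus is defined by
   the ideal (f) /\ F[sigma^vee /\ Z^d], where (f) is the ideal generated by f
   in the ring of Laurent polynomials; its elements are the products f g. *)
Definition chart_closure (f : laurent F d) sigma : set ('rV[int]_d -> F) :=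
  [set x | chart sigma x /\
     forall g : laurent F d,
       (forall a, a \in finsupp (laurent_mul f g) -> dual_monoid sigma a) ->
       chart_eval x (laurent_mul f g) = 0].

Definition closure_points (f : laurent F d) :
    set (set (set 'rV[R]_d * ('rV[int]_d -> F))) :=
  [set toric_point p | p in [set p | Sigma p.1 /\ chart_closure f p.1 p.2]].

End ToricVarieties.

Section DataAttachedToF.
Variables (d : nat).
Implicit Types (m fb rho : 'M[int]_(d, d.+2)) (gamma : 'I_d.+2 -> int).

Definition is_gale_dual m gamma : Prop :=
  [/\ \sum_j gamma j = 0, (forall i, \sum_j m i j * gamma j = 0)
    & \big[gcdz/0]_j gamma j = 1].

Definition with_ones (S : pzRingType) (m : 'M[S]_(d, d.+2)) :
  'M[S]_(1 + d, d.+2) := col_mx (const_mx 1) m.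

(* (1, f_1, ..., f_d) is a Z-basis of K = {x | sum_j gamma_j x_j = 0}. *)
Definition is_kernel_basis gamma fb : Prop :=
  (forall a : 'rV[int]_(1 + d),
     \sum_j gamma j * (a *m with_ones fb) 0 j = 0) /\
  (forall x : 'rV[int]_d.+2, \sum_j gamma j * x 0 j = 0 ->
     exists! a : 'rV[int]_(1 + d), x = a *m with_ones fb).

(* Hermite normal form of a nonsingular square integer matrix for row
   operations: upper triangular with positive diagonal, the entries above a
   pivot being reduced modulo this pivot. *)
Definition is_hermite (H : 'M[int]_d) : Prop :=
  [/\ (forall i j : 'I_d, (j < i)%N -> H i j = 0),
      (forall i : 'I_d, 0 < H i i)
    & (forall i j : 'I_d, (i < j)%N -> 0 <= H i j < H j j)].

Definition is_dual_family fb rho : Prop :=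
  (forall k, \sum_j rho k j = 0) /\
  (forall i k, \sum_j rho k j * fb i j = (i == k)%:R).

Definition Lambda (F : finFieldType) (N : 'M[int]_d) :
    {set {ffun 'I_d -> Zq F}} :=
  [set lambda : {ffun 'I_d -> Zq F} |
     [forall i, \sum_k lambda k *~ N k i == 0]]%SET.

Definition delta_of (F : finFieldType) rho (lambda : {ffun 'I_d -> Zq F}) :
    'I_d.+2 -> Zq F :=
  fun j => \sum_k lambda k *~ rho k j.

End DataAttachedToF.

(* The fan Sigma'. Indices start at 0: gamma j < 0 for j < r and gamma j > 0
   for r <= j. *)
Section RefinedFan.
Variables (R : realType) (d r : nat).
Implicit Types (C : seq ('I_d.+2 * 'I_d.+2)).

Definition are_inward_normals (m : 'M[int]_(d, d.+2)) (gamma : 'I_d.+2 -> int)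
    (alpha0 : 'I_d.+2 -> 'I_d.+2 -> R) (alpha : 'I_d.+2 -> 'I_d.+2 -> 'rV[R]_d) :
    Prop :=
  forall i j : 'I_d.+2, (i < r)%N -> (r <= j)%N ->
    row_mx (alpha0 i j)%:M (alpha i j) *m with_ones (map_mx intr m)
    = - ((gamma i)%:~R *: delta_mx 0 j) + (gamma j)%:~R *: delta_mx 0 i.

Definition is_chain C : bool :=
  [&& uniq C, all [pred p : 'I_d.+2 * 'I_d.+2 | (p.1 < r)%N && (r <= p.2)%N] C
    & sorted [rel p p' : 'I_d.+2 * 'I_d.+2 |
                (p.1 <= p'.1)%N && (p.2 <= p'.2)%N] C].

Definition chain_support C : {set 'I_d.+2} :=
  [set k : 'I_d.+2 | has [pred p : 'I_d.+2 * 'I_d.+2 | (k == p.1) || (k == p.2)] C]%SET.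

Definition chain_cone (alpha : 'I_d.+2 -> 'I_d.+2 -> 'rV[R]_d) C :
    set 'rV[R]_d :=
  [set v | exists2 a : 'I_d.+2 * 'I_d.+2 -> R, (forall p, 0 <= a p)
         & v = \sum_(p <- C) a p *: alpha p.1 p.2].

Definition refined_fan (alpha : 'I_d.+2 -> 'I_d.+2 -> 'rV[R]_d) :
    set (set 'rV[R]_d) :=
  [set chain_cone alpha C | C in
     [set C | is_chain C /\ chain_support C != [set: 'I_d.+2]%SET]].

End RefinedFan.

(* Main.v *)
Require Import Defs.
From mathcomp Require Import all_boot all_order all_algebra finmap.
From mathcomp Require Import all_classical all_reals all_analysis.
From mathcomp Require Import complex.
From mathcomp Require Import ring lra zify.
From mathcomp Require Import fingroup cyclic.
From mathcomp Require Import fintype finset.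

Set Implicit Arguments.
Unset Strict Implicit.
Unset Printing Implicit Defensive.

Import Order.TTheory GRing.Theory Num.Theory.

Local Open Scope classical_set_scope.
Local Open Scope ring_scope.

(** Put [x = q - 1]. The orbits of the torus on the toric variety correspond to the
    chains [C] whose support [S_C] is not the whole index set, and the orbit of [C]
    has [x ^ (d - |C|)] points. In the chart of a cone the ideal of the closure is
    generated by [f] divided by one of its monomials, so that the closure meets the
    orbit of [C] in the zeros of the face polynomial, the sum of the terms
    [u_k x^(m_k)] with [k] outside [S_C] ([chart_closure_orbit],
    [card_toric_points], [card_normal_forms]).

    Fourier expansion of [psi] in multiplicative characters counts these zeros
    ([hypersurface_count]). Up to elementary terms the result is a sum over the
    relations [v] (the [v] in (Z/x)^(d+2) with [sum_j v_j = 0] and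
    [sum_j v_j m_ij = 0]) that vanish on [S_C], of [g(v)] times
    [prod_j chi(u_j)^(- v_j)]. When the sum over the orbits is exchanged with the
    sum over [v], this product gets the coefficient [1 / (q x)] times the sum of
    [(- x)^|S_C| x^(- |C|)] over the chains [C] with support in the zero set of [v].
    If this zero set has [a] indices with [gamma_j < 0] and [b] indices with
    [gamma_j > 0], the sum over chains satisfies a recursion in [a] and [b]
    ([chain_sum_step]) which at these weights collapses to
    [T(a, b) = q T(a-1, b-1)]; so the sum is [q^min(a,b)] ([signed_chain_sum]).

    On the hypergeometric side, [min(a, b)] is the multiplicity [s_delta(- m)] for
    [v = delta(lambda) - m gamma] ([hyp_multE]), and [(lambda, m) |-> v] is a
    bijection onto the relations ([sum_relations]). This identifies the sum over
    [v] with the sum over [lambda] in the theorem ([hypergeometric_side]).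

    What remains does not involve characters: the sum of [x^(d - |C|) / q] over all
    orbits, and a correction at [v = 0], where the chains of full support occur in
    the recursion but not in the fan. The chains form the staircase triangulation of
    a product of simplices of dimensions [r - 1] and [s - 1]; its h-polynomial has
    the coefficients ['C(r.-1, k) * 'C(s.-1, k)], and both sums are values of it
    ([plain_chain_sum], [full_chain_sum], [plain_minus_full]).

    The fan property comes from the north-west corner rule: a nonnegative array
    supported on a chain is determined by its row and column sums
    ([northwest_corner_uniq]). It implies that the cones of two chains meet in the
    cone of their intersection and that they are simplicial. A point of a chart is
    then brought into a normal form [(D, z)], where [D] is the orbit it lies on and
    [z] its coordinates there ([normal_form]); points are glued precisely when they
    have the same normal form ([glued_orbit_points]). *)

(** * Chains in a product of two ordered sets *)

Section Chains.
Variable n : nat.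
Implicit Types (A B : {set 'I_n}) (p : 'I_n * 'I_n) (C D : {set 'I_n * 'I_n}).

Definition le_pair : rel ('I_n * 'I_n) :=
  [rel p p' : 'I_n * 'I_n | (p.1 <= p'.1)%N && (p.2 <= p'.2)%N].

Definition chain_set C :=
  [forall p in C, forall p' in C, le_pair p p' || le_pair p' p].

Definition chains A B : {set {set 'I_n * 'I_n}} :=
  [set C : {set 'I_n * 'I_n} | (C \subset finset.setX A B) && chain_set C]%SET.

Lemma chain_setP C :
  reflect {in C &, forall p p', le_pair p p' || le_pair p' p} (chain_set C).
Proof.
apply: (iffP forall_inP) => [h p p' pC p'C|h p pC].
  by move/forall_inP: (h p pC); apply.
by apply/forall_inP => p'; exact: h.
Qed.

Lemma chain_setS C D : C \subset D -> chain_set D -> chain_set C.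
Proof.
move=> /subsetP CD /chain_setP h; apply/chain_setP => p p' pC p'C.
by apply: h; exact: CD.
Qed.

Section Weight.
Variables (K : comNzRingType) (y z : K).

(** The exponent of [y] is the size of the support of the chain as soon as the
    rows and the columns are indexed by disjoint sets. *)
Definition chain_weight C : K :=
  y ^+ (#|(fst @: C)%SET| + #|(snd @: C)%SET|) * z ^+ #|C|.

Definition chain_sum A B : K := \sum_(C in chains A B) chain_weight C.

Lemma chain_sum0 A B : (A == finset.set0) || (B == finset.set0) -> chain_sum A B = 1.
Proof.
move=> AB0; rewrite /chain_sum (big_pred1 finset.set0); last first.
  move=> C; rewrite inE /=.
  have -> : finset.setX A B = finset.set0.
    apply/setP => p; rewrite !inE.
    by case/orP: AB0 => /eqP ->; rewrite inE ?andbF.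
  rewrite finset.subset0; case: eqP => // ->; apply/chain_setP => p.
  by rewrite inE.
by rewrite /chain_weight !imset0 !cards0 addn0 !expr0 mulr1.
Qed.

Section Step.
Variables (A B : {set 'I_n}) (a b : 'I_n).
Hypothesis (aA : forall i, i \in A -> (a < i)%N).
Hypothesis (bB : forall j, j \in B -> (b < j)%N).

Let aNA : a \notin A. Proof. by apply/negP => /aA; rewrite ltnn. Qed.
Let bNB : b \notin B. Proof. by apply/negP => /bB; rewrite ltnn. Qed.

Lemma chains_add_bottom D :
  D \in chains (a |: A)%SET (b |: B)%SET -> ((a, b) |: D)%SET \in chains (a |: A)%SET (b |: B)%SET.
Proof.
rewrite !inE => /andP[sD cD]; rewrite finset.subUset sD finset.sub1set !inE !eqxx /=.
apply/chain_setP => p p'; rewrite !inE.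
have bot q : q \in D -> le_pair (a, b) q.
  move=> /(subsetP sD); case: q => i j; rewrite !inE /le_pair /= => /andP[].
  by case/predU1P => [->|/aA/ltnW ->]; case/predU1P => [->|/bB/ltnW ->]; rewrite ?leqnn.
case/predU1P => [->|pD]; case/predU1P => [->|p'D].
- by rewrite /le_pair /= !leqnn.
- by rewrite bot.
- by rewrite (bot p) ?orbT.
- by move/chain_setP: cD; apply.
Qed.

Lemma chains_no_bottom D :
  (D \in chains (a |: A)%SET (b |: B)%SET) && ((a, b) \notin D) =
  (D \in chains A (b |: B)%SET) || (D \in chains (a |: A)%SET B).
Proof.
rewrite !inE -andb_orl andbAC; have [cD|] := boolP (chain_set D); last by rewrite !andbF.
rewrite !andbT; apply/andP/orP => [[sD abD]|].
  have [/existsP[[i j] /andP[ijD /eqP/= ia]]|/existsPn hD] := boolP [exists p in D, p.1 == a].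
    right; apply/subsetP => -[i' j'] pD.
    have := subsetP sD _ pD; rewrite !inE /= => /andP[-> /=].
    case/predU1P => // j'b; subst i j'.
    have := subsetP sD _ ijD; rewrite !inE /= eqxx /= => /predU1P[jb|jB].
      by rewrite jb (negbTE abD) in ijD.
    have := subsetP sD _ pD; rewrite !inE /= eqxx /= andbT => /predU1P[i'a|i'A].
      by rewrite i'a (negbTE abD) in pD.
    move/chain_setP: cD => /(_ _ _ ijD pD); rewrite /le_pair /=.
    by rewrite [(j <= b)%N]leqNgt bB // [(i' <= a)%N]leqNgt aA // andbF.
  left; apply/subsetP => -[i j] pD.
  have := subsetP sD _ pD; have := hD (i, j); rewrite pD !inE /=.
  by case: eqP.
have sub1 : (A \subset a |: A)%SET by apply: finset.subsetUr.
have sub2 : (B \subset b |: B)%SET by apply: finset.subsetUr.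
by case=> sD; split;
  [apply: fintype.subset_trans sD (finset.setXS _ _) => //
  |apply/negP => /(subsetP sD); rewrite !inE /= ?(negbTE aNA) ?(negbTE bNB) ?andbF
  |apply: fintype.subset_trans sD (finset.setXS _ _) => //
  |apply/negP => /(subsetP sD); rewrite !inE /= ?(negbTE aNA) ?(negbTE bNB) ?andbF].
Qed.

Lemma chainsI D :
  (D \in chains A (b |: B)%SET) && (D \in chains (a |: A)%SET B) = (D \in chains A B).
Proof.
rewrite !inE andbACA andbb; congr (_ && _); apply/andP/idP => [[s1 s2]|sD].
  apply/subsetP => p pD; move/subsetP: s1 => /(_ _ pD); move/subsetP: s2 => /(_ _ pD).
  by rewrite !inE => /andP[_ ->] /andP[->].
by split; apply: fintype.subset_trans sD (finset.setXS _ _); rewrite ?finset.subsetUr.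
Qed.

Lemma big_chains_no_bottom (h : {set 'I_n * 'I_n} -> K) :
  \sum_(D in chains (a |: A)%SET (b |: B)%SET | (a, b) \notin D) h D =
  \sum_(D in chains A B) h D
  + \sum_(D in chains A (b |: B)%SET | D \notin chains A B) h D
  + \sum_(D in chains (a |: A)%SET B | D \notin chains A B) h D.
Proof.
rewrite (bigID (mem (chains A B))) /= -addrA; congr (_ + _).
  apply: eq_bigl => D; rewrite chains_no_bottom -chainsI.
  by case: (D \in _); case: (D \in _).
rewrite (bigID (mem (chains A (b |: B)%SET))) /=; congr (_ + _); apply: eq_bigl => D;
  rewrite chains_no_bottom -chainsI;
  by case: (D \in _); case: (D \in _).
Qed.

Lemma big_chainsD1 (h : {set 'I_n * 'I_n} -> K) :
  \sum_(D in chains A (b |: B)%SET | D \notin chains A B) h D =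
  \sum_(D in chains A (b |: B)%SET) h D - \sum_(D in chains A B) h D.
Proof.
rewrite [in RHS](bigID (mem (chains A B))) /= addrAC; set s := (X in X - _).
suff -> : s = \sum_(D in chains A B) h D by rewrite subrr add0r.
by apply: eq_bigl => D; rewrite -chainsI; case: (D \in _); case: (D \in _).
Qed.

Lemma big_chainsD2 (h : {set 'I_n * 'I_n} -> K) :
  \sum_(D in chains (a |: A)%SET B | D \notin chains A B) h D =
  \sum_(D in chains (a |: A)%SET B) h D - \sum_(D in chains A B) h D.
Proof.
rewrite [in RHS](bigID (mem (chains A B))) /= addrAC; set s := (X in X - _).
suff -> : s = \sum_(D in chains A B) h D by rewrite subrr add0r.
by apply: eq_bigl => D; rewrite -chainsI; case: (D \in _); case: (D \in _).
Qed.

Lemma chain_weight_add_bottom D : (a, b) \notin D ->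
  chain_weight ((a, b) |: D)%SET =
  y ^+ ((a \notin (fst @: D)%SET) + (b \notin (snd @: D)%SET)) * z * chain_weight D.
Proof.
move=> abD; rewrite /chain_weight !imsetU1 /= !cardsU1 abD /=.
by rewrite !exprD expr1; ring.
Qed.

(** The pair [(a, b)] lies below all the others, so it can be added to every
    chain. A chain without it cannot use both the row [a] and the column [b], whose
    other elements are incomparable: it lives over [A] and [b |: B], or over
    [a |: A] and [B]. Adding [(a, b)] brings in two new indices if the chain lives
    over [A] and [B], and one otherwise. *)
Lemma chain_sum_step :
  chain_sum (a |: A)%SET (b |: B)%SET =
  (1 + y * z) * (chain_sum A (b |: B)%SET + chain_sum (a |: A)%SET B)
  + (y ^+ 2 * z - y * z *+ 2 - 1) * chain_sum A B.
Proof.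
rewrite /chain_sum (bigID (fun D : {set 'I_n * 'I_n} => (a, b) \notin D)) /=.
rewrite [X in _ + X](_ : _ = \sum_(D in chains (a |: A)%SET (b |: B)%SET | (a, b) \notin D)
    chain_weight ((a, b) |: D)%SET); last first.
  rewrite (reindex_onto (fun D => (a, b) |: D)%SET (fun D => D :\ (a, b))%SET) /=; last first.
    by move=> D /andP[_]; rewrite negbK => /finset.setD1K.
  apply: eq_bigl => D; rewrite finset.setU11 /=.
  apply/idP/idP; last first.
    by move=> /andP[h1 h2]; rewrite chains_add_bottom //= finset.setU1K ?eqxx.
  rewrite andbT => /andP[cD /eqP eD].
  have -> : (a, b) \notin D by rewrite -eD !inE eqxx.
  rewrite andbT; move: cD; rewrite !inE finset.subUset => /andP[/andP[_ ->]] /=.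
  by apply: chain_setS; apply: finset.subsetUr.
have fstN (D : {set 'I_n * 'I_n}) B' : D \in chains A B' -> a \notin (fst @: D)%SET.
  rewrite inE => /andP[/subsetP sD _]; apply/imsetP => -[[i j] /sD].
  by rewrite inE /= => /andP[iA _] ai; move: aNA; rewrite ai iA.
have sndN (D : {set 'I_n * 'I_n}) A' : D \in chains A' B -> b \notin (snd @: D)%SET.
  rewrite inE => /andP[/subsetP sD _]; apply/imsetP => -[[i j] /sD].
  by rewrite inE /= => /andP[_ jB] bj; move: bNB; rewrite bj jB.
have abN1 (D : {set 'I_n * 'I_n}) B' : D \in chains A B' -> (a, b) \notin D.
  by move=> /fstN; apply: contra => h; apply/imsetP; exists (a, b).
have abN2 (D : {set 'I_n * 'I_n}) A' : D \in chains A' B -> (a, b) \notin D.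
  by move=> /sndN; apply: contra => h; apply/imsetP; exists (a, b).
rewrite !big_chains_no_bottom.
rewrite [X in _ + (X + _ + _)](eq_bigr (fun D => y ^+ 2 * z * chain_weight D)); last first.
  by move=> D hD; rewrite chain_weight_add_bottom ?(abN1 _ _ hD) // (fstN _ _ hD) (sndN _ _ hD).
rewrite [X in _ + (_ + X + _)](eq_bigr (fun D => y * z * chain_weight D)); last first.
  move=> D /andP[hD hN]; rewrite chain_weight_add_bottom ?(abN1 _ _ hD) // (fstN _ _ hD).
  suff -> : b \in (snd @: D)%SET by [].
  apply: contraR hN => bN; move: hD; rewrite !inE => /andP[/subsetP sD ->]; rewrite andbT.
  apply/subsetP => -[i j] pD; have := sD _ pD; rewrite !inE /= => /andP[->] /predU1P[jb|//].
  by case/imsetP: bN; exists (i, j).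
rewrite [X in _ + (_ + _ + X)](eq_bigr (fun D => y * z * chain_weight D)); last first.
  move=> D /andP[hD hN]; rewrite chain_weight_add_bottom ?(abN2 _ _ hD) // (sndN _ _ hD).
  suff -> : a \in (fst @: D)%SET by [].
  apply: contraR hN => bN; move: hD; rewrite !inE => /andP[/subsetP sD ->]; rewrite andbT.
  apply/subsetP => -[i j] pD; have := sD _ pD; rewrite !inE /= => /andP[/predU1P[jb|-> //] _].
  by case/imsetP: bN; exists (i, j).
rewrite -!mulr_sumr !big_chainsD1 !big_chainsD2; ring.
Qed.

End Step.

Lemma set_min_split A : A != finset.set0 ->
  exists a A', [/\ A = (a |: A')%SET, (forall i, i \in A' -> (a < i)%N) & #|A| = #|A'|.+1].
Proof.
case/set0Pn => i0 i0A; case: (@arg_minnP _ i0 (mem A) (fun i => val i) i0A) => a aA amin.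
exists a, (A :\ a)%SET; split; first by rewrite finset.setD1K.
  move=> i; rewrite !inE => /andP[ia iA]; rewrite ltn_neqAle amin // andbT.
  by apply: contra ia => /eqP/val_inj ->.
by rewrite (cardsD1 a A) (aA : a \in A).
Qed.

(** The recursion of [chain_sum_step] sees the two index sets through their
    sizes only. *)
Lemma chain_sum_card (P : nat -> nat -> K) A B :
  (forall b, P 0 b = 1) -> (forall a, P a 0 = 1) ->
  (forall a b, P a.+1 b.+1 = (1 + y * z) * (P a b.+1 + P a.+1 b)
     + (y ^+ 2 * z - y * z *+ 2 - 1) * P a b) ->
  chain_sum A B = P #|A| #|B|.
Proof.
move=> P0 P1 PS; have [k] := ubnP (#|A| + #|B|)%N.
elim: k A B => // k IH A B; rewrite ltnS => le_k.
have [->|A0] := eqVneq A finset.set0; first by rewrite chain_sum0 ?eqxx // cards0 P0.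
have [->|B0] := eqVneq B finset.set0; first by rewrite chain_sum0 ?eqxx ?orbT // cards0 P1.
have [a [A' [eA aA cA]]] := set_min_split A0.
have [b [B' [eB bB cB]]] := set_min_split B0.
have cA' := cA; have cB' := cB.
rewrite eA in cA'; rewrite eB in cB'.
rewrite eA eB chain_sum_step // !IH ?cA' ?cB' ?PS //; lia.
Qed.

End Weight.
End Chains.

(** * Values of the weighted chain sums *)

Section ChainSumValues.
Variable K : fieldType.

(** The h-polynomial of the staircase triangulation of the product of two
    simplices of dimensions [a] and [b]. *)
Definition binom_sum (a b : nat) (s : K) : K :=
  \sum_(k < (minn a b).+1) ('C(a, k) * 'C(b, k))%:R * s ^+ k.

Lemma binom_sum_widen N a b s : (minn a b <= N)%N ->
  binom_sum a b s = \sum_(k < N.+1) ('C(a, k) * 'C(b, k))%:R * s ^+ k.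
Proof.
move=> le_N; rewrite /binom_sum (big_ord_widen_cond N.+1 xpredT
  (fun k => ('C(a, k) * 'C(b, k))%:R * s ^+ k)) //.
rewrite big_mkcond; apply: eq_bigr => i _; case: ltnP => //= hi.
suff -> : ('C(a, i) * 'C(b, i) = 0)%N by rewrite mul0r.
move: hi; rewrite gtn_min => /orP[] h; first by rewrite bin_small.
by rewrite (@bin_small b) // muln0.
Qed.

Lemma binom_sum0n b s : binom_sum 0 b s = 1.
Proof. by rewrite /binom_sum min0n big_ord1 !bin0 mulr1. Qed.

Lemma binom_sumn0 a s : binom_sum a 0 s = 1.
Proof. by rewrite /binom_sum minn0 big_ord1 !bin0 mulr1. Qed.

(** Pascal's rule in both factors: the product of
    ['C(a.+1, k) - 'C(a, k)] and ['C(b.+1, k) - 'C(b, k)] is the product of the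
    binomial coefficients at [k - 1]. *)
Lemma binom_sumSS a b s : binom_sum a.+1 b.+1 s =
  binom_sum a b.+1 s + binom_sum a.+1 b s + (s - 1) * binom_sum a b s.
Proof.
set N := minn a b.
have e1 : binom_sum a.+1 b.+1 s = \sum_(k < N.+2) ('C(a.+1, k) * 'C(b.+1, k))%:R * s ^+ k.
  by apply: binom_sum_widen; rewrite /N; lia.
have e2 : binom_sum a b.+1 s = \sum_(k < N.+2) ('C(a, k) * 'C(b.+1, k))%:R * s ^+ k.
  by apply: binom_sum_widen; rewrite /N; lia.
have e3 : binom_sum a.+1 b s = \sum_(k < N.+2) ('C(a.+1, k) * 'C(b, k))%:R * s ^+ k.
  by apply: binom_sum_widen; rewrite /N; lia.
have e4 : binom_sum a b s = \sum_(k < N.+2) ('C(a, k) * 'C(b, k))%:R * s ^+ k.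
  by apply: binom_sum_widen; rewrite /N; lia.
have e5 : s * binom_sum a b s = \sum_(k < N.+1) s * (('C(a, k) * 'C(b, k))%:R * s ^+ k).
  by rewrite -mulr_sumr.
rewrite mulrBl mul1r e5 e1 e2 e3 e4 !(big_ord_recl N.+1) !bin0 /=.
set S1 := \sum_(i < N.+1) _; set S2 := \sum_(i < N.+1) _.
set S3 := \sum_(i < N.+1) _; set S4 := \sum_(i < N.+1) _; set S5 := \sum_(i < N.+1) _.
suff -> : S1 = S2 + S3 + (S4 - S5) by ring.
rewrite /S1 /S2 /S3 /S4 /S5 -sumrB -!big_split /=; apply: eq_bigr => i _.
rewrite /bump /= !add1n !binS !natrM !natrD exprS; ring.
Qed.

Variable x : K.
Hypothesis (x0 : x != 0).
Let q := x + 1.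

(** With [y = - x] and [z = 1 / x] one has [y * z = - 1], so that the two middle
    terms of the recursion disappear and each step multiplies by [q]. *)
Lemma signed_chain_sum n (A B : {set 'I_n}) :
  chain_sum (- x) x^-1 A B = q ^+ minn #|A| #|B|.
Proof.
apply: (chain_sum_card (P := fun a b => q ^+ minn a b)) => [b|a|a b].
- by rewrite min0n.
- by rewrite minn0.
rewrite minnSS exprS /q; field; exact: x0.
Qed.

Definition plain_sum a b : K :=
  if (a, b) is (a'.+1, b'.+1) then (q / x) ^+ (a' + b').+1 * binom_sum a' b' q^-1
  else 1.

(** At [y = 1] the sum is the f-polynomial of the triangulation, which its
    h-polynomial expresses. *)
Lemma plain_chain_sum n (A B : {set 'I_n}) : q != 0 ->
  chain_sum 1 x^-1 A B = plain_sum #|A| #|B|.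
Proof.
move=> q0; apply: (chain_sum_card (P := plain_sum)) => [[]|[]|a b] //.
have e1 : 1 + 1 * x^-1 = q / x by rewrite /q; field; exact: x0.
have e2 : 1 ^+ 2 * x^-1 - 1 * x^-1 *+ 2 - 1 = - (q / x).
  by rewrite /q; field; exact: x0.
have e3 : q^-1 - 1 = - (q / x)^-1 by rewrite /q invf_div; field; rewrite -/q.
have qx0 : q / x != 0 by rewrite mulf_neq0 ?invr_eq0.
rewrite e1 e2 /plain_sum; case: a b => [|a] [|b] /=.
- by rewrite binom_sum0n; ring.
- by rewrite !binom_sum0n !add0n exprS; ring.
- by rewrite !binom_sumn0 !addn0 exprS; ring.
rewrite binom_sumSS e3 !addSn !addnS !exprS.
by move: (q / x) qx0 => w w0; field.
Qed.

Definition full_chains n (A B : {set 'I_n}) :=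
  [set C in chains A B | (fst @: C == A) && (snd @: C == B)].

(** The generating polynomial of the chains in the variable [y]. The bound [N]
    only serves to make the recursion on two arguments structural. *)
Fixpoint chain_poly_rec (N a b : nat) : {poly K} :=
  if N is N'.+1 then
    if (a, b) is (a'.+1, b'.+1) then
      (1 + 'X * x^-1%:P) * (chain_poly_rec N' a' b + chain_poly_rec N' a b')
      + ('X ^+ 2 * x^-1%:P - 'X * x^-1%:P *+ 2 - 1) * chain_poly_rec N' a' b'
    else 1
  else 1.

Definition chain_poly a b := chain_poly_rec (a + b) a b.
Arguments chain_poly : simpl never.

Lemma chain_poly_rec_stable N a b : (a + b <= N)%N ->
  chain_poly_rec N a b = chain_poly a b.
Proof.
rewrite /chain_poly; move: {2 4}(a + b)%N (leqnn (a + b)) => M.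
elim: N M a b => [|N IH] [|M] [|a] [|b] //= hM hN; try by [].
by rewrite (IH M) ?(IH M a.+1) ?(IH M a b) //; lia.
Qed.

Lemma chain_poly0n b : chain_poly 0 b = 1. Proof. by case: b. Qed.
Lemma chain_polyn0 a : chain_poly a 0 = 1.
Proof. by case: a. Qed.

Lemma chain_polySS a b : chain_poly a.+1 b.+1 =
  (1 + 'X * x^-1%:P) * (chain_poly a b.+1 + chain_poly a.+1 b)
      + ('X ^+ 2 * x^-1%:P - 'X * x^-1%:P *+ 2 - 1) * chain_poly a b.
Proof.
rewrite {1}/chain_poly addSn /= !chain_poly_rec_stable //; lia.
Qed.

Lemma size_chain_poly a b : (size (chain_poly a b) <= (a + b).+1)%N.
Proof.
have [N] := ubnP (a + b); elim: N a b => // N IH [|a] [|b] hN;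
  rewrite ?chain_poly0n ?chain_polyn0 ?size_poly1 //.
rewrite chain_polySS.
have s1 : (size (1 + 'X * x^-1%:P : {poly K})%R <= 2)%N.
  rewrite (leq_trans (size_polyD _ _)) // geq_max size_poly1 /=.
  by rewrite (leq_trans (size_polyMleq _ _)) // size_polyX size_polyC invr_eq0 x0.
have s2 : (size ('X ^+ 2 * x^-1%:P - 'X * x^-1%:P *+ 2 - 1 : {poly K})%R <= 3)%N.
  have l1 : (size ('X ^+ 2 * x^-1%:P : {poly K})%R <= 3)%N.
    by rewrite (leq_trans (size_polyMleq _ _)) // size_polyXn size_polyC invr_eq0 x0.
  have l2 : (size ('X * x^-1%:P : {poly K})%R <= 3)%N.
    by rewrite (leq_trans (size_polyMleq _ _)) // size_polyX size_polyC invr_eq0 x0.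
  rewrite !(leq_trans (size_polyD _ _)) // !geq_max size_polyN size_poly1 /=.
  rewrite andbT (leq_trans (size_polyD _ _)) // geq_max l1 size_polyN mulr2n /=.
  by rewrite (leq_trans (size_polyD _ _)) // geq_max l2.
have a1 := IH a b.+1; have a2 := IH a.+1 b; have a3 := IH a b.
rewrite (leq_trans (size_polyD _ _)) // geq_max; apply/andP; split.
  rewrite (leq_trans (size_polyMleq _ _)) //.
  have := size_polyD (chain_poly a b.+1) (chain_poly a.+1 b).
  move: s1 a1 a2; lia.
rewrite (leq_trans (size_polyMleq _ _)) //; move: s2 a3; lia.
Qed.

Lemma coef_chain_poly a b :
  (chain_poly a.+1 b.+1)`_(a.+1 + b.+1) = x^-1 ^+ (a + b).+1 * binom_sum a b q.
Proof.
have [N] := ubnP (a + b); elim: N a b => // N IH a b hN.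
have z (c e k : nat) : (c + e < k)%N -> (chain_poly c e)`_k = 0.
  by move=> h; rewrite nth_default // (leq_trans (size_chain_poly _ _)).
rewrite chain_polySS.
have -> : (1 + 'X * x^-1%:P) * (chain_poly a b.+1 + chain_poly a.+1 b)
      + ('X ^+ 2 * x^-1%:P - 'X * x^-1%:P *+ 2 - 1) * chain_poly a b
  = (chain_poly a b.+1 + chain_poly a.+1 b - chain_poly a b)
   + x^-1%:P * ((chain_poly a b.+1 + chain_poly a.+1 b) * 'X)
   + x^-1%:P * (chain_poly a b * 'X * 'X)
   - x^-1%:P * (chain_poly a b * 'X) *+ 2 by ring.
rewrite coefB coefMn !coefD coefN !coefCM !coefMX addSn /= coefD addnS /=.
rewrite (z a b.+1 (a + b).+2) ?(z a.+1 b (a + b).+2) ?(z a b (a + b).+2) ?(z a b (a + b).+1); try lia.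
have IHk c e k : (c + e < N)%N -> k = (c.+1 + e.+1)%N ->
    (chain_poly c.+1 e.+1)`_k = x^-1 ^+ (c + e).+1 * binom_sum c e q.
  by move=> h ->; exact: IH.
case: a b hN => [|a] [|b] hN.
- rewrite !chain_poly0n !chain_polyn0 !coef1 /= binom_sum0n; ring.
- rewrite !chain_poly0n !coef1 /= !add0n IHk //; try lia.
  rewrite !binom_sum0n !add0n /= !exprS; ring.
- rewrite !chain_polyn0 !coef1 /= !addn0 IHk //; try lia.
  rewrite !binom_sumn0 !addn0 /= !exprS; ring.
rewrite binom_sumSS !IHk; try lia.
rewrite /q !addSn !addnS !exprS; field; exact: x0.
Qed.

Lemma chain_imset n (A B : {set 'I_n}) C : C \in chains A B ->
  (fst @: C \subset A) && (snd @: C \subset B).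
Proof.
rewrite inE => /andP[/subsetP sC _]; apply/andP; split; apply/subsetP => i;
  by case/imsetP => p /sC; rewrite inE => /andP[h1 h2] ->.
Qed.

(** The chains meeting all rows and columns are those of top degree in [y], so
    they are counted by the top coefficient of the generating polynomial, in which
    only three terms of the recursion have the required degree. *)
Lemma full_chain_sum n (A B : {set 'I_n}) a b : #|A| = a.+1 -> #|B| = b.+1 ->
  \sum_(C in full_chains A B) x^-1 ^+ #|C| = x^-1 ^+ (a + b).+1 * binom_sum a b q.
Proof.
move=> cA cB; rewrite -coef_chain_poly -cA -cB.
rewrite -(chain_sum_card A B chain_poly0n chain_polyn0 chain_polySS).
rewrite /chain_sum coef_sum [RHS](bigID (fun C => C \in full_chains A B)) /=.
rewrite [X in _ + X]big1 ?addr0.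
  apply: eq_big => [C|C]; rewrite inE; first by case: (C \in chains A B).
  move=> /andP[_ /andP[/eqP eA /eqP eB]].
  by rewrite /chain_weight eA eB -rmorphXn /= coefMC coefXn eqxx mul1r.
move=> C /andP[cC]; rewrite inE cC /= => nf.
rewrite /chain_weight -rmorphXn /= coefMC coefXn; case: eqP => [e|]; last by rewrite mul0r.
case/negP: nf; have /andP[sA sB] := chain_imset cC.
have := subset_leq_card sA; have := subset_leq_card sB.
rewrite !eqEcard sA sB /=; move: e; move: #|_| #|_| #|_| #|_|. lia.
Qed.

End ChainSumValues.

(** * Roots of unity and multiplicities of roots *)

Section RootOfUnity.
Variable R : realType.

Lemma zetaX k n : zeta R n ^+ k =
  Complex (cos (k%:R * (2 * pi / n%:R))) (sin (k%:R * (2 * pi / n%:R))).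
Proof.
elim: k => [|k IH]; first by rewrite expr0 mul0r cos0 sin0.
rewrite exprS IH /zeta; set t := 2 * pi / _.
rewrite -[k.+1]addn1 natrD (mulrDl k%:R) mul1r cosD sinD.
by apply/eqP; rewrite eq_complex /=; apply/andP; split; apply/eqP; ring.
Qed.

(** If [zeta ^+ m = 1] with [0 < m < n] then [cos (2 pi m / n) = 1], hence
    [sin (pi m / n) = 0], although [pi m / n] lies strictly between [0] and [pi]. *)
Lemma zeta_prim n : (0 < n)%N -> n.-primitive_root (zeta R n).
Proof.
move=> n0; have n0' : (n%:R : R) != 0 by rewrite pnatr_eq0 -lt0n.
have zn : zeta R n ^+ n = 1.
  by rewrite zetaX mulrC divfK // mulr_natl cos2pi sin2pi.
have [m [hm dm]] := prim_order_exists n0 zn.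
suff e : n = m by rewrite {1}e.
apply/eqP; rewrite eqn_leq [(m <= n)%N]dvdn_leq // andbT leqNgt; apply/negP => lt_mn.
have m0 : (0 < m)%N := prim_order_gt0 hm.
have := prim_expr_order hm; rewrite zetaX => /eqP; rewrite eq_complex /= => /andP[/eqP + _].
pose th : R := m%:R * (pi / n%:R).
have -> : m%:R * (2 * pi / n%:R) = th *+ 2 by rewrite /th mulr2n; ring.
have th0 : 0 < th < pi.
  rewrite /th; apply/andP; split.
    by rewrite mulr_gt0 ?divr_gt0 ?pi_gt0 ?ltr0n.
  rewrite mulrCA -[ltRHS]mulr1 ltr_pM2l ?pi_gt0 // ltr_pdivrMr ?ltr0n // mul1r ltr_nat //.
have := sin_gt0_pi th0; rewrite cos_mulr2n cos2sin2 => s0 h.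
have : sin th ^+ 2 = 0 by lra.
by move/eqP; rewrite expf_eq0 /=; move: s0; rewrite lt_neqAle eq_sym => /andP[/negbTE ->].
Qed.

End RootOfUnity.

Section Multiplicity.
Variable K : fieldType.

Lemma mup_gcdp (p p' : {poly K}) x : p != 0 -> p' != 0 ->
  mup x (gcdp p p') = minn (mup x p) (mup x p').
Proof.
move=> p0 p'0; have g0 : gcdp p p' != 0 by rewrite gcdp_eq0 negb_and p0.
apply/eqP; rewrite eqn_leq; apply/andP; split.
  have h := leqnn (mup x (gcdp p p')); rewrite mup_geq // dvdp_gcd in h.
  by rewrite leq_min !mup_geq.
by rewrite mup_geq // dvdp_gcd -!mup_geq // geq_minl geq_minr.
Qed.

Lemma mup_prod (I : finType) (P : pred I) (f : I -> {poly K}) x :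
  (forall i, P i -> f i != 0) ->
  mup x (\prod_(i | P i) f i) = (\sum_(i | P i) mup x (f i))%N.
Proof.
move=> f0.
suff [] : \prod_(i | P i) f i != 0 /\
  mup x (\prod_(i | P i) f i) = (\sum_(i | P i) mup x (f i))%N by [].
apply: (big_ind2 (fun p n => p != 0 /\ mup x p = n)) => [|p n p' n' [p0 <-] [p'0 <-]|i /f0 h] //.
  by rewrite oner_neq0 mupNroot // root1.
by rewrite mulf_neq0 // mupM.
Qed.

(** A nonzero root is simple, the derivative being [n x ^ (n - 1)]. *)
Lemma mup_XnsubC n (c x : K) : (n%:R : K) != 0 -> c != 0 ->
  mup x ('X^n - c%:P) = (x ^+ n == c).
Proof.
move=> n0 c0.
have rE : root ('X^n - c%:P) x = (x ^+ n == c).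
  by rewrite rootE !hornerE subr_eq0.
have n0' : (0 < n)%N by rewrite lt0n; apply: contraNneq n0 => ->.
have p0 : 'X^n - c%:P != 0 :> {poly K} by rewrite monic_neq0 // monicXnsubC.
case: eqP rE => [e|_] rE; last by rewrite mupNroot // rE.
apply/eqP; rewrite eqn_leq mup_geq // expr1 dvdp_XsubCl rE andbT mup_leq //.
apply/negP => /dvdpP[g /(congr1 (fun p => p^`().[x]))].
have x0 : x != 0 by apply: contra_neq c0 => x0; rewrite -e x0 expr0n gtn_eqF.
rewrite derivB derivXn derivC subr0 derivM expr2 derivM derivXsubC.
rewrite !(hornerMn, hornerXn, hornerD, hornerM, hornerN, hornerX, hornerC) subrr.
rewrite !(mulr0, mul0r, addr0) => /eqP.
by rewrite -mulr_natr mulf_eq0 expf_eq0 (negbTE x0) andbF (negbTE n0).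
Qed.

End Multiplicity.

(** * The multiplicities in the hypergeometric sums *)

Section CyclicExponents.
Variables (K : fieldType) (n : nat) (z : K).
Hypothesis zn : z ^+ n.+1 = 1.
Implicit Types a b : 'I_n.+1.

Let z0 : z != 0.
Proof. by apply: contra_eq_neq zn => ->; rewrite expr0n eq_sym oner_eq0. Qed.

Lemma expr_ordD a b : z ^+ (a + b : 'I_n.+1)%R = z ^+ a * z ^+ b.
Proof. by rewrite -exprD -[RHS](expr_mod _ zn). Qed.

Lemma expr_ordN a : z ^+ (- a : 'I_n.+1)%R = (z ^+ a)^-1.
Proof.
have za0 : z ^+ a != 0 by rewrite expf_neq0.
by apply: (mulIf za0); rewrite -expr_ordD addNr mulVf.
Qed.

Lemma expr_ordB a b : z ^+ (a - b : 'I_n.+1)%R = z ^+ a / z ^+ b.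
Proof. by rewrite expr_ordD expr_ordN. Qed.

Lemma expr_ordMz a (k : int) : z ^+ (a *~ k : 'I_n.+1)%R = (z ^+ a) ^ k.
Proof.
have pos (i : nat) : z ^+ (a *+ i : 'I_n.+1)%R = (z ^+ a) ^+ i.
  by elim: i => // i IH; rewrite mulrS expr_ordD IH exprS.
case: k => i; first by rewrite -pmulrn pos.
by rewrite NegzE mulrNz expr_ordN -pmulrn pos exprnN.
Qed.

Lemma expr_ord_sum (I : finType) (f : I -> 'I_n.+1) :
  z ^+ (\sum_i f i : 'I_n.+1)%R = \prod_i z ^+ f i.
Proof.
apply: (big_ind2 (fun (x : 'I_n.+1) y => z ^+ x = y)) => // x1 x2 y1 y2 <- <-.
by rewrite expr_ordD.
Qed.

Lemma expr_ord_inj a b : n.+1.-primitive_root z -> (z ^+ a == z ^+ b) = (a == b).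
Proof.
move=> zp; rewrite (eq_prim_root_expr zp) -val_eqE /=.
by rewrite !modn_small // ltn_ord.
Qed.

End CyclicExponents.

Lemma card_pred_succ (F : finFieldType) : (#|F|.-2).+1 = #|F|.-1.
Proof. by have := card_finNzRing_gt1 F; case: #|F| => [|[]]. Qed.

Section HypMult.
Variables (R : realType) (F : finFieldType) (n : nat) (gamma : 'I_n -> int).
Hypothesis gamma0 : forall j, gamma j != 0.
Implicit Types (delta : 'I_n -> Zq F) (m : Zq F).

(** All factors are separable. The multiplicity of a root in each product
    therefore counts the factors vanishing there, and its multiplicity in the
    greatest common divisor is the smaller of these two numbers. *)
Lemma hyp_multE delta m :
  hyp_mult R gamma delta (- m) =
  minn #|[set j | (gamma j < 0) && (delta j - m *~ gamma j == 0)]%SET|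
       #|[set j | (0 < gamma j) && (delta j - m *~ gamma j == 0)]%SET|.
Proof.
have q0 : (0 < #|F|.-1)%N by rewrite -card_pred_succ.
have zp : (#|F|.-2).+1.-primitive_root (zeta R #|F|.-1).
  by rewrite card_pred_succ; exact: zeta_prim.
rewrite /hyp_mult /hyp_gcd; set z := zeta R #|F|.-1 in zp *.
have zn : z ^+ (#|F|.-2).+1 = 1 by rewrite (prim_expr_order zp).
have z0 : z != 0 by apply: contra_eq_neq zn => ->; rewrite expr0n eq_sym oner_eq0.
have p0 (j : 'I_n) c : ('X^(`|gamma j|%N) - c%:P) != 0 :> {poly R[i]}.
  by rewrite monic_neq0 // monicXnsubC // absz_gt0.
have g0 (j : 'I_n) : (`|gamma j|%N)%:R != 0 :> R[i].
  by rewrite pnatr_eq0 absz_eq0.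
have prod_n0 (P : pred 'I_n) (c : 'I_n -> R[i]) :
    \prod_(j < n | P j) ('X^(`|gamma j|%N) - (c j)%:P) != 0 :> {poly R[i]}.
  by apply/prodf_neq0 => j _; exact: p0.
rewrite mup_gcdp //; congr minn; rewrite mup_prod //.
  rewrite (eq_bigr (fun j => (delta j - m *~ gamma j == 0) : nat)).
    by rewrite -sum1dep_card big_mkcondr /=; apply: eq_bigr => j _; case: (_ == _).
  move=> j gj; rewrite mup_XnsubC ?expf_neq0 //; congr (nat_of_bool _).
  have -> : (z ^+ (- m : Zq F)) ^+ `|gamma j| = z ^+ (m *~ gamma j : Zq F)%R.
    rewrite expr_ordN // expr_ordMz // -[gamma j in RHS]opprK -[in RHS](ltz0_abs gj) -exprnN.
    by rewrite exprVn.
  by rewrite expr_ord_inj // subr_eq0 eq_sym.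
rewrite (eq_bigr (fun j => (delta j - m *~ gamma j == 0) : nat)).
  by rewrite -sum1dep_card big_mkcondr /=; apply: eq_bigr => j _; case: (_ == _).
move=> j gj; rewrite mup_XnsubC ?invr_neq0 ?expf_neq0 //; congr (nat_of_bool _).
have -> : (z ^+ (- m : Zq F)) ^+ `|gamma j| = z ^+ (- (m *~ gamma j) : Zq F)%R.
  by rewrite !expr_ordN // expr_ordMz // -[in RHS](gtz0_abs gj) exprVn.
by rewrite -expr_ordN // expr_ord_inj // eqr_opp subr_eq0 eq_sym.
Qed.

End HypMult.

(** * Additive and multiplicative characters *)

Section Characters.
Variables (R : realType) (F : finFieldType) (psi chi : F -> R[i]).
Hypothesis psi_char : is_nontrivial_additive_character psi.
Hypothesis chi_char : is_multiplicative_character chi.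
Hypothesis chi_order : has_character_order chi #|F|.-1.
Implicit Types (x y w : F) (a b : Zq F).

Local Notation q := (#|F|%:R : R[i]).
Local Notation q1 := (#|F|.-1%:R : R[i]).

Let chi1 : chi 1 = 1. Proof. by case: chi_char. Qed.
Let chiM x y : x != 0 -> y != 0 -> chi (x * y) = chi x * chi y.
Proof. by case: chi_char => _; apply. Qed.
Let psi0 : psi 0 = 1. Proof. by case: psi_char. Qed.
Let psiD x y : psi (x + y) = psi x * psi y. Proof. by case: psi_char. Qed.

Lemma chi_expr_card x : x != 0 -> chi x ^+ (#|F|.-2).+1 = 1.
Proof. by rewrite card_pred_succ; case: chi_order => _ h _; exact: h. Qed.

Lemma chi_neq0 x : x != 0 -> chi x != 0.
Proof.
move=> /chi_expr_card; apply: contra_eq_neq => ->.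
by rewrite expr0n eq_sym oner_eq0.
Qed.

Lemma chi_prod (I : finType) (P : pred I) (f : I -> F) : (forall i, P i -> f i != 0) ->
  chi (\prod_(i | P i) f i) = \prod_(i | P i) chi (f i).
Proof.
move=> f0; suff [] : \prod_(i | P i) f i != 0 /\
  chi (\prod_(i | P i) f i) = \prod_(i | P i) chi (f i) by [].
apply: (big_ind2 (fun x (z : R[i]) => x != 0 /\ chi x = z)) => [|x y x' y' [x0 <-] [x'0 <-]|i /f0 h] //.
  by rewrite oner_neq0.
by rewrite mulf_neq0 // chiM.
Qed.

Lemma chiX x k : x != 0 -> chi (x ^+ k) = chi x ^+ k.
Proof.
by move=> x0; elim: k => // k IH; rewrite !exprS chiM ?IH ?expf_neq0.
Qed.

Lemma chiV x : x != 0 -> chi x^-1 = (chi x)^-1.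
Proof.
move=> x0; apply: (mulfI (chi_neq0 x0)).
by rewrite -chiM ?invr_eq0 // !divff ?chi_neq0.
Qed.

Lemma chiZ x (k : int) : x != 0 -> chi (x ^ k) = chi x ^ k.
Proof.
move=> x0; case: k => k; first by rewrite -!exprnP chiX.
by rewrite NegzE -!exprnN chiV ?expf_neq0 // chiX.
Qed.

(** If [chi (g ^ k) = 1] for a generator [g] of the cyclic group of units, then
    [chi ^ k] is trivial. *)
Lemma chi_faithful x : x != 0 -> chi x = 1 -> x = 1.
Proof.
move=> x0 chix1; have ux : x \is a GRing.unit by rewrite unitfE.
have /cyclicP[g eg] := field_unit_group_cyclic [group of [set: {unit F}]].
have pow (v : {unit F}) : exists2 k, (k < #|F|.-1)%N & v = (g ^+ k)%g.
  have : v \in <[g]>%g by rewrite -eg inE.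
  move=> /cyclePmin[k hk ->]; exists k => //.
  by move: hk; rewrite orderE -eg card_finField_unit.
have [k hk ek] := pow (FinRing.unit F ux).
have {}ek : x = val g ^+ k by rewrite -[LHS]/(val (FinRing.unit F ux)) ek FinRing.val_unitX.
have g0 : val g != 0 by rewrite -unitfE (valP g).
case: (posnP k) => [k0|k0]; first by rewrite ek k0.
case: chi_order => _ _ /(_ k); rewrite k0 hk => /(_ isT)[y y0].
have uy : y \is a GRing.unit by rewrite unitfE.
have [l hl el] := pow (FinRing.unit F uy).
have -> : y = val g ^+ l by rewrite -[LHS]/(val (FinRing.unit F uy)) el FinRing.val_unitX.
by rewrite chiX // exprAC -chiX // -ek chix1 expr1n eqxx.
Qed.

Lemma sum_chi_exponents w : w != 0 ->
  \sum_(a : Zq F) chi w ^+ a = if w == 1 then q1 else 0.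
Proof.
move=> w0; case: eqP => [->|w1].
  rewrite chi1 (eq_bigr (fun=> 1)) => [|a _]; last by rewrite expr1n.
  by rewrite sumr_const card_ord card_pred_succ.
have c1 : chi w - 1 != 0 by rewrite subr_eq0; apply/eqP => /(chi_faithful w0).
by apply: (mulfI c1); rewrite mulr0 -subrX1 chi_expr_card // subrr.
Qed.

Lemma reindex_mulf (h : F -> R[i]) w : w != 0 ->
  \sum_(x | x != 0) h x = \sum_(x | x != 0) h (w * x).
Proof.
move=> w0; rewrite (reindex_onto (fun x => w * x) (fun x => w^-1 * x)) /=.
  by apply: eq_bigl => x; rewrite mulKf // eqxx andbT mulf_eq0 (negbTE w0).
by move=> x _; rewrite mulVKf.
Qed.

Lemma card_units : \sum_(x : F | x != 0) (1 : R[i]) = q1.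
Proof.
rewrite sumr_const; congr (_ *+ _).
by rewrite -(cardC1 (0 : F)); apply: eq_card => x; rewrite !inE.
Qed.

Lemma sum_chi_units a : \sum_(x | x != 0) chi x ^+ a = if a == 0 then q1 else 0.
Proof.
case: eqP => [->|/eqP a0]; first by rewrite -card_units; apply: eq_bigr.
have [w w0 cw] : exists2 w, w != 0 & chi w ^+ a != 1.
  case: chi_order => _ _; apply.
  have -> : (a < #|F|.-1)%N by apply: leq_trans (ltn_ord a) _; rewrite card_pred_succ.
  rewrite andbT lt0n.
  by apply: contra a0 => /eqP h; apply/eqP/val_inj.
have c1 : chi w ^+ a - 1 != 0 by rewrite subr_eq0.
apply: (mulfI c1); rewrite mulr0 mulrBl mul1r [in X in _ - X](reindex_mulf _ w0).
rewrite mulr_sumr -sumrB big1 // => x x0; by rewrite chiM // exprMn subrr.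
Qed.

Lemma sum_psi c : \sum_x psi (x * c) = if c == 0 then q else 0.
Proof.
case: eqP => [->|/eqP c0].
  rewrite (eq_bigr (fun=> 1)) => [|x _]; last by rewrite mulr0.
  by rewrite sumr_const.
have [_ _ [w pw]] := psi_char.
have p1 : psi w - 1 != 0 by rewrite subr_eq0.
apply: (mulfI p1); rewrite mulr0 mulrBl mul1r [in X in _ - X](reindex_inj (addrI (w / c))) /=.
by rewrite mulr_sumr -sumrB big1 // => x _; rewrite mulrDl divfK // psiD subrr.
Qed.

Lemma sum_psi_units c : \sum_(x | x != 0) psi (x * c) = (if c == 0 then q else 0) - 1.
Proof.
by rewrite -sum_psi [in RHS](bigD1 0) //= mul0r psi0 addrAC subrr add0r.
Qed.

Lemma gauss0 : gauss psi chi 0 = -1.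
Proof.
rewrite /gauss -[RHS]add0r; have := sum_psi_units 1; rewrite oner_eq0 => <-.
by apply: eq_bigr => x _; rewrite expr0 !mulr1.
Qed.

(** For [a <> 0] the product of the Gauss sums at [a] and [- a] is
    [q * chi (- 1) ^+ a]. *)
Lemma gauss_neq0 a : gauss psi chi a != 0.
Proof.
have [->|a0] := eqVneq a 0; first by rewrite gauss0 oppr_eq0 oner_eq0.
suff h : gauss psi chi a * gauss psi chi (- a) = q * chi (-1) ^+ a.
  apply/eqP => g0; move/eqP: h; rewrite g0 mul0r eq_sym mulf_eq0 pnatr_eq0 => /orP[|].
    by rewrite -leqn0 leqNgt (ltn_trans _ (card_finNzRing_gt1 F)).
  by apply/negP; rewrite expf_neq0 // chi_neq0 // oppr_eq0 oner_eq0.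
rewrite mulrC {1}/gauss mulr_suml.
transitivity (\sum_(x | x != 0) \sum_(y | y != 0) psi (x * (1 + y)) * chi y ^+ a).
  apply: eq_bigr => x x0; rewrite /gauss (reindex_mulf _ x0) mulr_sumr.
  apply: eq_bigr => y y0; rewrite mulrDr mulr1 psiD chiM // exprMn.
  have cx := chi_expr_card x0; rewrite expr_ordN //.
  have cx0 : chi x ^+ a != 0 by rewrite expf_neq0 // chi_neq0.
  by field.
rewrite exchange_big /=.
transitivity (\sum_(y | y != 0) ((if 1 + y == 0 then q else 0) - 1) * chi y ^+ a).
  by apply: eq_bigr => y _; rewrite -mulr_suml sum_psi_units.
under eq_bigr do rewrite mulrBl mul1r.
rewrite sumrB sum_chi_units (negbTE a0) subr0 (bigD1 (-1)) /= ?oppr_eq0 ?oner_eq0 //.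
rewrite subrr eqxx big1 ?addr0 // => y /andP[_ y1].
by rewrite addrC addr_eq0 (negbTE y1) mul0r.
Qed.

(** Fourier inversion on the group of units, where the Gauss sums are the
    Fourier coefficients of [psi]. *)
Lemma psi_expansion x : x != 0 ->
  psi x = q1^-1 * \sum_(a : Zq F) gauss psi chi a * (chi x ^+ a)^-1.
Proof.
move=> x0; have q10 : q1 != 0 by rewrite pnatr_eq0 -card_pred_succ.
apply: (mulfI q10); rewrite mulVKf //.
transitivity (\sum_(y | y != 0) psi y * \sum_(a : Zq F) chi (y / x) ^+ a).
  rewrite (bigD1 x) //= sum_chi_exponents ?divff ?oner_eq0 // eqxx mulrC big1 ?addr0 //.
  move=> y /andP[y0 yx]; rewrite sum_chi_exponents ?mulf_neq0 ?invr_eq0 //.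
  rewrite (can2_eq (divfK x0) (mulfK x0)) mul1r (negbTE yx) mulr0 //.
under eq_bigr do rewrite mulr_sumr.
rewrite exchange_big; apply: eq_bigr => a _; rewrite /gauss mulr_suml.
apply: eq_bigr => y y0; rewrite chiM ?invr_eq0 // chiV // exprMn exprVn mulrA //.
Qed.

End Characters.

(** * Zeros of a Laurent polynomial on the torus *)

Section TorusPoints.
Variables (F : finFieldType) (d : nat).

Implicit Types t : {ffun 'I_d -> F}.

Definition torus : {set {ffun 'I_d -> F}} := [set t : {ffun 'I_d -> F} | [forall i, t i != 0]]%SET.

Definition torus_monomial (t : {ffun 'I_d -> F}) (a : 'I_d -> int) : F :=
  \prod_i t i ^ a i.

Lemma torusP t : reflect (forall i, t i != 0) (t \in torus).
Proof. by rewrite inE; exact: forallP. Qed.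

Lemma torus_monomial_neq0 t a : t \in torus -> torus_monomial t a != 0.
Proof. by move=> /torusP t0; apply/prodf_neq0 => i _; rewrite expfz_neq0. Qed.

Lemma sum_torus (K : comNzRingType) (h : 'I_d -> F -> K) :
  \sum_(t in torus) \prod_i h i (t i) = \prod_i \sum_(x | x != 0) h i x.
Proof.
rewrite (bigA_distr_big (fun x : F => x != 0)) /=; apply: eq_bigl => t.
apply/torusP/ffun_onP => //.
Qed.

End TorusPoints.

Section HypersurfaceCount.
Variables (R : realType) (F : finFieldType) (psi chi : F -> R[i]).
Hypothesis psi_char : is_nontrivial_additive_character psi.
Hypothesis chi_char : is_multiplicative_character chi.
Hypothesis chi_order : has_character_order chi #|F|.-1.
Variables (d n : nat) (m : 'M[int]_(d, n)) (u : 'I_n -> F).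
Hypothesis u0 : forall j, u j != 0.

Local Notation q := (#|F|%:R : R[i]).
Local Notation q1 := (#|F|.-1%:R : R[i]).

(** The [v] for which [prod_j chi (u_j) ^ v_j] is invariant under the
    substitutions [u_j -> y t^(m_j) u_j]: only these survive an average over [y]
    and [t]. *)
Definition relations : {set {ffun 'I_n -> Zq F}} :=
  [set v : {ffun 'I_n -> Zq F} |
    (\sum_j v j == 0) && [forall i, \sum_j v j *~ m i j == 0]]%SET.

Definition twisted_gauss (v : {ffun 'I_n -> Zq F}) : R[i] :=
  (\prod_j chi (u j) ^- v j) * gauss_vec psi chi v.

Definition zeros_on (S : {set 'I_n}) : {set {ffun 'I_d -> F}} :=
  [set t in torus F d | \sum_(j in S) u j * torus_monomial t (m^~ j) == 0]%SET.

Let monom_chi (t : {ffun 'I_d -> F}) (v : {ffun 'I_n -> Zq F}) y : y != 0 -> t \in torus F d ->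
  \prod_j (chi (y * (u j * torus_monomial t (m^~ j))) ^+ v j)^-1 =
  (\prod_j chi (u j) ^- v j) * (chi y ^+ (- \sum_j v j : Zq F)%R
   * \prod_i chi (t i) ^+ (- \sum_j v j *~ m i j : Zq F)%R).
Proof.
move=> y0 tT; have t0 := torusP _ tT.
have chiM x z : x != 0 -> z != 0 -> chi (x * z) = chi x * chi z by case: chi_char => _; apply.
have E i : chi (t i) ^+ (- \sum_j v j *~ m i j : Zq F)%R =
    \prod_j ((chi (t i) ^ m i j) ^+ v j)^-1.
  rewrite expr_ordN ?(chi_expr_card chi_order) // expr_ord_sum ?(chi_expr_card chi_order) //.
  rewrite -prodfV; apply: eq_bigr => j _; congr (_^-1).
  by rewrite expr_ordMz ?(chi_expr_card chi_order) // !exprnP exprzAC.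
under [X in _ = _ * (_ * X)]eq_bigr do rewrite E.
rewrite expr_ordN ?(chi_expr_card chi_order) // expr_ord_sum ?(chi_expr_card chi_order) //.
rewrite -prodfV exchange_big /= -!big_split /=; apply: eq_bigr => j _.
rewrite !chiM ?mulf_neq0 ?torus_monomial_neq0 // !exprMn !invfM mulrCA; congr (_ * (_ * _)).
rewrite prodfV; congr (_^-1); rewrite prodrXl; congr (_ ^+ _).
rewrite /torus_monomial chi_prod // => [|i _]; last by rewrite expfz_neq0.
by apply: eq_bigr => i _; rewrite chiZ.
Qed.

(** The number of zeros of [f] on the torus is [1/q] times the sum of
    [psi (y f(t))] over all [t] and [y]. After an expansion of [psi] at each
    monomial, the sum over [t] and over [y <> 0] keeps the exponents [v] that are
    relations. An index outside [S] gets the exponent [0], at which the Gauss sum is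
    [- 1]; this accounts for the sign. *)
Lemma hypersurface_count (S : {set 'I_n}) :
  q * #|zeros_on S|%:R = q1 ^+ d +
    q1 ^+ d.+1 * q1^-1 ^+ #|S| * (-1) ^+ #|~: S| *
    \sum_(v in relations | [forall j in ~: S, v j == 0]) twisted_gauss v.
Proof.
have q10 : q1 != 0 by rewrite pnatr_eq0 -card_pred_succ.
pose f t := \sum_(j in S) u j * torus_monomial t (m^~ j).
have -> : q * #|zeros_on S|%:R = \sum_(t in torus F d) \sum_y psi (y * f t).
  under eq_bigr do rewrite (sum_psi psi_char).
  rewrite -big_mkcondr /= sumr_const -[RHS]mulr_natr; congr (_ * _%:R).
  by apply: eq_card => t; rewrite inE unfold_in.
have -> : \sum_(t in torus F d) \sum_y psi (y * f t) =
   \sum_(t in torus F d) (1 : R[i]) + \sum_(t in torus F d) \sum_(y | y != 0) psi (y * f t).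
  rewrite -big_split /=; apply: eq_bigr => t _; rewrite (bigD1 0) //= mul0r.
  by case: psi_char => ->.
congr (_ + _).
  have h := sum_torus (F := F) (fun (_ : 'I_d) (_ : F) => 1 : R[i]).
  transitivity (\prod_(i < d) \sum_(x : F | x != 0) (1 : R[i])).
    by rewrite -h; apply: eq_bigr => t _; rewrite big1_eq.
  by rewrite card_units prodr_const card_ord.
pose c (v : {ffun 'I_n -> Zq F}) : R[i] := 
  if [forall j in ~: S, v j == 0] then q1^-1 ^+ #|S| * (-1) ^+ #|~: S| * gauss_vec psi chi v else 0.
have E t y : t \in torus F d -> y != 0 -> psi (y * f t) =
  \sum_(v : {ffun 'I_n -> Zq F}) c v * ((\prod_j chi (u j) ^- v j) *
  (chi y ^+ (- \sum_j v j : Zq F)%R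
   * \prod_i chi (t i) ^+ (- \sum_j v j *~ m i j : Zq F)%R)).
  move=> tT y0; pose w j := y * (u j * torus_monomial t (m^~ j)).
  have w0 j : w j != 0 by rewrite !mulf_neq0 ?torus_monomial_neq0.
  (* Outside [S] the factor 1 is written as the sum over [a] of the indicator of 0. *)
  pose h j (a : Zq F) : R[i] := if j \in S then q1^-1 * (gauss psi chi a * (chi (w j) ^+ a)^-1)
    else if a == 0 then 1 else 0.
  transitivity (\prod_j \sum_a h j a).
    have -> : psi (y * f t) = \prod_(j in S) psi (w j).
      rewrite mulr_sumr; apply: (big_morph psi) => [x z|]; by case: psi_char.
    rewrite big_mkcond; apply: eq_bigr => j _; rewrite /h; case: ifP => _.
      by rewrite (psi_expansion psi chi_char chi_order) // mulr_sumr.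
    by rewrite -big_mkcond big_pred1_eq.
  rewrite bigA_distr_bigA /=; apply: eq_bigr => v _.
  rewrite -monom_chi // /c; case: ifPn => [/forall_inP v0|/forall_inPn[j jS vj]]; last first.
    by rewrite mul0r (bigD1 j) //= /h; move: jS; rewrite inE => /negbTE ->; rewrite (negbTE vj) mul0r.
  have -> : q1^-1 ^+ #|S| = \prod_j (if j \in S then q1^-1 else 1).
    by rewrite -big_mkcond prodr_const.
  have -> : (-1) ^+ #|~: S| = \prod_j (if j \in ~: S then -1 else 1) :> R[i].
    by rewrite -big_mkcond prodr_const.
  rewrite /gauss_vec -!big_split /=.
  apply: eq_bigr => j _; rewrite /h !inE; case: ifP => jS /=.
    by rewrite /w mulr1 !mulrA.
  have -> : v j = 0 by apply/eqP/v0; rewrite inE jS.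
  by rewrite eqxx (gauss0 chi psi_char) expr0 invr1; ring.
transitivity (\sum_(v : {ffun 'I_n -> Zq F}) c v * ((\prod_j chi (u j) ^- v j) *
  ((\sum_(y : F | y != 0) chi y ^+ (- \sum_j v j : Zq F)%R)
   * \prod_i \sum_(x : F | x != 0) chi x ^+ (- \sum_j v j *~ m i j : Zq F)%R))).
  under eq_bigr => t tT do under eq_bigr => y y0 do rewrite E //.
  under eq_bigr => t tT do rewrite exchange_big /=.
  rewrite exchange_big /=; apply: eq_bigr => v _.
  rewrite -sum_torus mulr_suml mulr_sumr mulr_sumr exchange_big /=.
  apply: eq_bigr => y _; rewrite -!mulr_sumr //.
rewrite mulr_sumr [RHS]big_mkcond; apply: eq_bigr => v _.
rewrite (sum_chi_units chi_char chi_order) oppr_eq0.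
under [X in _ * (_ * (_ * X))]eq_bigr do rewrite (sum_chi_units chi_char chi_order) oppr_eq0.
rewrite inE /c /twisted_gauss.
case: eqP => _ /=; last by rewrite mul0r !mulr0.
case: ifPn => h2; last by rewrite mul0r; case: ifP => //; rewrite andbF.
rewrite andbT; case: ifPn => [/forallP h|/forallPn[i hi]].
  under [X in _ * (_ * (_ * X))]eq_bigr => i _ do rewrite h.
  by rewrite prodr_const card_ord exprS; ring.
by rewrite (bigD1 i) //= (negbTE hi) mul0r !mulr0.
Qed.

End HypersurfaceCount.

(** * Relations among the exponents and the parameters (lambda, m) *)

Section Pairing.
Variables (V : zmodType) (n : nat).

Definition pairing (v : 'I_n -> V) (x : 'I_n -> int) : V := \sum_j v j *~ x j.

Lemma pairing_suml (I : finType) (v : I -> 'I_n -> V) x :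
  pairing (fun j => \sum_i v i j) x = \sum_i pairing (v i) x.
Proof.
by rewrite /pairing exchange_big; apply: eq_bigr => j _; rewrite mulrz_suml.
Qed.

Lemma pairing_sumr (I : finType) v (x : I -> 'I_n -> int) :
  pairing v (fun j => \sum_i x i j) = \sum_i pairing v (x i).
Proof.
by rewrite /pairing exchange_big; apply: eq_bigr => j _; rewrite mulrz_sumr.
Qed.

Lemma pairingBl v w x : pairing (fun j => v j - w j) x = pairing v x - pairing w x.
Proof. by rewrite /pairing -sumrB; apply: eq_bigr => j _; rewrite mulrzBl. Qed.

Lemma pairingZr v a x : pairing v (fun j => a * x j) = pairing v x *~ a.
Proof. by rewrite /pairing mulrz_suml; apply: eq_bigr => j _; rewrite mulrC mulrzA. Qed.

Lemma pairing_Mz (l : V) y x : pairing (fun j => l *~ y j) x = l *~ (\sum_j y j * x j).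
Proof. by rewrite /pairing mulrz_sumr; apply: eq_bigr => j _; rewrite mulrzA. Qed.

Lemma pairing1 v : pairing v (fun=> 1) = \sum_j v j.
Proof. by []. Qed.

Lemma pairing_delta v j : pairing v (fun k => (k == j)%:R) = v j.
Proof.
rewrite /pairing (bigD1 j) //= eqxx mulr1z big1 ?addr0 // => k /negbTE ->.
by rewrite mulr0z.
Qed.
End Pairing.

Lemma big_gcdz_bezout n (gamma : 'I_n -> int) :
  exists g : 'I_n -> int, \sum_j gamma j * g j = \big[gcdz/0]_j gamma j.
Proof.
apply: (big_ind (fun z => exists g : 'I_n -> int, \sum_j gamma j * g j = z)) => [|x y [g <-] [h <-]|j _].
- by exists (fun=> 0); rewrite big1 // => j _; rewrite mulr0.
- have [a [b <-]] := Bezoutz (\sum_j gamma j * g j) (\sum_j gamma j * h j).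
  exists (fun j => a * g j + b * h j); rewrite !mulr_sumr -big_split /=.
  by apply: eq_bigr => j _; rewrite mulrDr !(mulrCA (gamma j)).
- exists (fun k => (k == j)%:R); rewrite (bigD1 j) //= eqxx mulr1 big1 ?addr0 //.
  by move=> k /negbTE ->; rewrite mulr0.
Qed.

Section Reindex.
Variables (F : finFieldType) (d : nat) (m : 'M[int]_(d, d.+2)) (gamma : 'I_d.+2 -> int).
Hypothesis hgamma : is_gale_dual m gamma.
Variable fb : 'M[int]_(d, d.+2).
Hypothesis hfb : is_kernel_basis gamma fb.
Variables (c : 'M[int]_d) (b : 'cV[int]_d).
Hypothesis hc : m = c *m fb + b *m const_mx 1.
Variables (A H : 'M[int]_d).
Hypotheses (hA : A \in unitmx) (hHA : H = A *m c).
Variable rho : 'M[int]_(d, d.+2).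
Hypothesis hrho : is_dual_family fb rho.

Lemma with_onesE (S : pzRingType) (f : 'M[S]_(d, d.+2)) (a : 'rV[S]_(1 + d)) j :
  (a *m with_ones f) 0 j = a 0 (lshift d 0) + \sum_i a 0 (rshift 1 i) * f i j.
Proof.
rewrite mxE big_split_ord /= big_ord1 col_mxEu mxE mulr1; congr (_ + _).
by apply: eq_bigr => i _; rewrite col_mxEd.
Qed.

Lemma gale_dual_fb i : \sum_j gamma j * fb i j = 0.
Proof.
have [h _] := hfb; rewrite -[RHS](h (delta_mx 0 (rshift 1 i))).
by apply: eq_bigr => j _; rewrite -rowE rowKd mxE.
Qed.

Lemma exponent_coords i j : m i j = \sum_l c i l * fb l j + b i 0.
Proof. by rewrite hc !mxE big_ord1 mxE mulr1. Qed.

Lemma pairing_exponents (V : zmodType) (v : 'I_d.+2 -> V) i : \sum_j v j = 0 ->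
  pairing v (m i) = \sum_l pairing v (fb l) *~ c i l.
Proof.
move=> v0; rewrite /pairing.
under eq_bigr => j _ do rewrite exponent_coords mulrzDr.
rewrite big_split /= -mulrz_suml v0 mul0rz addr0.
rewrite [LHS](pairing_sumr v (fun l j => c i l * fb l j)).
by apply: eq_bigr => l _; rewrite pairingZr.
Qed.

(** The vectors [e_j - gamma_j g], with [gamma . g = 1], lie in the lattice
    spanned by [1] and the [f_i]. *)
Lemma annihilator_of_kernel (V : zmodType) (v : 'I_d.+2 -> V) (g : 'I_d.+2 -> int) :
  \sum_j gamma j * g j = 1 -> \sum_j v j = 0 -> (forall i, pairing v (fb i) = 0) ->
  forall j, v j = pairing v g *~ gamma j.
Proof.
move=> hg v0 vf j; apply/eqP; rewrite -subr_eq0 -pairingZr -{1}(pairing_delta v j).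
rewrite /pairing -sumrB; under eq_bigr do rewrite -mulrzBr.
(* This is [e_j - gamma_j g]. *)
have [_ hK] := hfb; pose x : 'rV[int]_d.+2 := \row_k ((k == j)%:R - gamma j * g k).
have [|a [ea _]] := hK x.
  under eq_bigr do rewrite mxE mulrBr; rewrite sumrB (bigD1 j) //= eqxx mulr1.
  rewrite big1 ?addr0; last by move=> k /negbTE ->; rewrite mulr0.
  by under eq_bigr do rewrite mulrCA; rewrite -mulr_sumr hg mulr1 subrr.
have E k : (k == j)%:R - gamma j * g k = a 0 (lshift d 0) + \sum_i a 0 (rshift 1 i) * fb i k.
  by rewrite -with_onesE -ea mxE.
under eq_bigr do rewrite E mulrzDr.
rewrite big_split /= -mulrz_suml v0 mul0rz add0r.
rewrite [X in X == _](pairing_sumr v (fun i k => a 0 (rshift 1 i) * fb i k)).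
by rewrite big1 // => i _; rewrite pairingZr vf mul0rz.
Qed.

Lemma Lambda_c (lambda : {ffun 'I_d -> Zq F}) :
  (lambda \in Lambda F H^T) = [forall i, \sum_k lambda k *~ c i k == 0].
Proof.
have ec : c = invmx A *m H by rewrite hHA mulKmx.
rewrite inE; apply/forallP/forallP => h i.
  rewrite (eq_bigr (fun k => \sum_l lambda k *~ H^T k l *~ invmx A i l)); last first.
    move=> k _; rewrite ec !mxE mulrz_sumr; apply: eq_bigr => l _.
    by rewrite mxE -mulrzA mulrC hHA.
  rewrite exchange_big big1 //= => l _; rewrite -mulrz_suml.
  by have /eqP -> := h l; rewrite mul0rz.
rewrite (eq_bigr (fun k => \sum_l lambda k *~ c l k *~ A i l)); last first.
  by move=> k _; rewrite !mxE hHA mxE mulrz_sumr; apply: eq_bigr => l _; rewrite mulrC mulrzA.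
rewrite exchange_big big1 //= => l _; rewrite -mulrz_suml.
by have /eqP -> := h l; rewrite mul0rz.
Qed.

(** The vector [delta(lambda) - m gamma] of the hypergeometric sums. *)
Definition relation_of (lm : {ffun 'I_d -> Zq F} * Zq F) : {ffun 'I_d.+2 -> Zq F} :=
  [ffun j => delta_of rho lm.1 j - lm.2 *~ gamma j].

Lemma pairing_delta_of (lambda : {ffun 'I_d -> Zq F}) x :
  pairing (delta_of rho lambda) x = \sum_k lambda k *~ (\sum_j rho k j * x j).
Proof.
rewrite [LHS](pairing_suml (fun k j => lambda k *~ rho k j)).
by apply: eq_bigr => k _; rewrite pairing_Mz.
Qed.

Lemma pairing_relation_of lm x : pairing (relation_of lm) x =
  \sum_k lm.1 k *~ (\sum_j rho k j * x j) - lm.2 *~ (\sum_j gamma j * x j).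
Proof.
rewrite -pairing_delta_of -pairing_Mz -pairingBl.
by apply: eq_bigr => j _; rewrite ffunE.
Qed.

Lemma sum_relation_of lm : \sum_j relation_of lm j = 0.
Proof.
rewrite -[LHS](pairing1 (relation_of lm)) pairing_relation_of.
have [h1 _] := hrho; have [h2 _ _] := hgamma.
rewrite big1 => [|k _].
  by under eq_bigr do rewrite mulr1; rewrite h2 mulr0z subrr.
by under eq_bigr do rewrite mulr1; rewrite h1 mulr0z.
Qed.

Lemma relation_of_fb lm i : pairing (relation_of lm) (fb i) = lm.1 i.
Proof.
rewrite pairing_relation_of gale_dual_fb mulr0z subr0.
have [_ h] := hrho; rewrite (bigD1 i) //= h eqxx mulr1z big1 ?addr0 // => k ki.
by rewrite h eq_sym (negbTE ki) mulr0z.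
Qed.

Lemma relation_ofP lm : (relation_of lm \in relations F m) = (lm.1 \in Lambda F H^T).
Proof.
rewrite Lambda_c inE sum_relation_of eqxx /=; apply: eq_forallb => i; congr (_ == _).
rewrite -/(pairing (relation_of lm) (m i)) pairing_exponents ?sum_relation_of //.
by apply: eq_bigr => l _; rewrite relation_of_fb.
Qed.

Lemma relation_of_inj : injective relation_of.
Proof.
move=> [l1 m1] [l2 m2] e.
have el : l1 = l2 by apply/ffunP => i; rewrite -(relation_of_fb (l1, m1)) e relation_of_fb.
congr (_, _) => //; have [g hg] := big_gcdz_bezout gamma.
have := congr1 (fun v : {ffun _} => pairing v g) e; rewrite /= !pairing_relation_of /= el.
by move=> /addrI/oppr_inj; rewrite hg; have [_ _ ->] := hgamma; rewrite !mulr1z.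
Qed.

Lemma relation_of_surj v : v \in relations F m -> exists lm, v = relation_of lm.
Proof.
rewrite inE => /andP[/eqP v0 _].
have [g hg] := big_gcdz_bezout gamma; have [_ _ hg1] := hgamma; rewrite hg1 in hg.
pose lambda : {ffun 'I_d -> Zq F} := [ffun i => pairing v (fb i)].
pose w := fun j => v j - relation_of (lambda, 0) j.
have := @annihilator_of_kernel _ w g hg.
have w0 : \sum_j w j = 0 by rewrite /w sumrB v0 sum_relation_of subrr.
have wf i : pairing w (fb i) = 0 by rewrite pairingBl relation_of_fb ffunE subrr.
move=> /(_ w0 wf) ew; exists (lambda, - pairing w g); apply/ffunP => j.
rewrite ffunE /= mulNrz opprK -ew /w ffunE /= mul0rz subr0 addrCA subrr addr0 //.
Qed.

(** Pairing a relation with [f_i] recovers [lambda_i], and pairing it with [g],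
    where [gamma . g = 1], recovers [m]. Conversely, what is left of a relation after
    subtraction of [delta(lambda)] is orthogonal to the kernel of [gamma], hence a
    multiple of [gamma]. *)
Lemma sum_relations (K : nmodType) (h : {ffun 'I_d.+2 -> Zq F} -> K) :
  \sum_(lambda in Lambda F H^T) \sum_(a : Zq F) h (relation_of (lambda, a)) =
  \sum_(v in relations F m) h v.
Proof.
rewrite pair_big_dep /=.
transitivity (\sum_(lm | relation_of lm \in relations F m) h (relation_of lm)).
  by apply: eq_big => [[l a]|[l a] _] //=; rewrite relation_ofP andbT.
rewrite -(big_imset h) /=; last by move=> x y _ _; exact: relation_of_inj.
apply: eq_bigl => v; apply/imsetP/idP => [[lm + ->]|vr]; first by [].
by have [lm e] := relation_of_surj vr; exists lm; rewrite // unfold_in -e.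
Qed.

End Reindex.

(** * The hypergeometric side *)

Lemma intr_neq0_coprime (F : finFieldType) (k : int) :
  coprime #|F| `|k|%N -> k%:~R != 0 :> F.
Proof.
move=> ck; have q0 : #|F|%:R = 0 :> F.
  have h : \sum_(x : F) x = \sum_(x : F) (x + 1) by exact: (reindex_inj (addIr 1)).
  move: h; rewrite big_split /= sumr_const => /eqP.
  by rewrite -{1}[X in X == _]addr0 => /eqP/addrI.
apply/eqP => k0; have k0' : `|k|%N%:R = 0 :> F.
  case: k k0 {ck} => k; first by [].
  by rewrite NegzE mulrNz => /eqP; rewrite oppr_eq0 => /eqP.
have q_gt0 : (0 < #|F|)%N by rewrite (ltn_trans _ (card_finNzRing_gt1 F)).
case: (egcdnP `|k|%N q_gt0) => km kn e _.
have := congr1 (fun x => x%:R : F) e; rewrite (eqP ck) natrM natrD natrM q0 k0' !mulr0 add0r.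
by move/eqP; rewrite eq_sym oner_eq0.
Qed.

Lemma cancel_gauss_factors (K : fieldType) (X Y Z Za g1 g2 Q : K) :
  Q != 0 -> Q - 1 != 0 -> Z != 0 -> g1 != 0 ->
  X * (Z * Q^-1) * g1 * ((1 - Q)^-1 * (g2 / g1 * (Za * Z^-1) * Y)) =
  - (Q * (Q - 1))^-1 * (X * Y * g2 * Za).
Proof.
move=> Q0 Q1 Z0 g0; have Q2 : 1 - Q != 0 by rewrite -opprB oppr_eq0.
by field; rewrite Q0 Q1 Q2 Z0 g0.
Qed.

Section HypergeometricSide.
Variables (R : realType) (F : finFieldType) (psi chi : F -> R[i]).
Hypothesis psi_char : is_nontrivial_additive_character psi.
Hypothesis chi_char : is_multiplicative_character chi.
Hypothesis chi_order : has_character_order chi #|F|.-1.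
Variables (d : nat) (m : 'M[int]_(d, d.+2)) (u : 'I_d.+2 -> F) (gamma : 'I_d.+2 -> int).
Hypothesis u0 : forall j, u j != 0.
Hypothesis hgamma : is_gale_dual m gamma.
Hypothesis gamma0 : forall j, gamma j != 0.
Variable fb : 'M[int]_(d, d.+2).
Hypothesis hfb : is_kernel_basis gamma fb.
Variables (c : 'M[int]_d) (b : 'cV[int]_d).
Hypothesis hc : m = c *m fb + b *m const_mx 1.
Variables (A H : 'M[int]_d).
Hypotheses (hA : A \in unitmx) (hHA : H = A *m c).
Variable rho : 'M[int]_(d, d.+2).
Hypothesis hrho : is_dual_family fb rho.
Hypothesis hq : coprime #|F| (absz (\prod_j gamma j)).

Local Notation q := (#|F|%:R : R[i]).
Local Notation relation_of := (relation_of gamma rho).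
Let t : F := \prod_j u j ^ gamma j.
Let sigma (k : 'I_d) : F := \prod_j u j ^ rho k j.

Definition zeros_neg (v : {ffun 'I_d.+2 -> Zq F}) := [set j | (gamma j < 0) && (v j == 0)]%SET.
Definition zeros_pos (v : {ffun 'I_d.+2 -> Zq F}) := [set j | (0 < gamma j) && (v j == 0)]%SET.

Lemma gamma_gamma_neq0 : gamma_gamma F gamma != 0.
Proof.
apply/prodf_neq0 => j _; rewrite expfz_neq0 // intr_neq0_coprime //.
move: hq; by rewrite (bigD1 j) //= abszM coprimeMr => /andP[].
Qed.

Lemma hyp_mult_relation (lambda : {ffun 'I_d -> Zq F}) (a : Zq F) :
  hyp_mult R gamma (delta_of rho lambda) (- a) =
  minn #|zeros_neg (relation_of (lambda, a))| #|zeros_pos (relation_of (lambda, a))|.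
Proof.
rewrite hyp_multE //; congr minn; apply: eq_card => j; by rewrite !inE ffunE.
Qed.

Lemma twisted_gauss_relation (lambda : {ffun 'I_d -> Zq F}) (a : Zq F) :
  twisted_gauss psi chi u (relation_of (lambda, a)) =
  (\prod_k chi (sigma k) ^- lambda k) * chi t ^+ a *
  gauss_vec psi chi (fun j => delta_of rho lambda j - a *~ gamma j).
Proof.
rewrite /twisted_gauss; congr (_ * _); last by apply: eq_bigr => j _; rewrite ffunE.
have cu j : chi (u j) != 0 by apply: chi_neq0.
rewrite (eq_bigr (fun j => (\prod_k (chi (u j) ^ rho k j) ^- lambda k) *
   (chi (u j) ^ gamma j) ^+ a)); last first.
  move=> j _; rewrite ffunE expr_ordB ?(chi_expr_card chi_order) // invfM invrK.
  congr (_ * _); last by rewrite expr_ordMz ?(chi_expr_card chi_order) // !exprnP exprzAC.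
  rewrite expr_ord_sum ?(chi_expr_card chi_order) // -prodfV; apply: eq_bigr => k _.
  by rewrite expr_ordMz ?(chi_expr_card chi_order) // !exprnP exprzAC.
rewrite big_split exchange_big /=; congr (_ * _).
  apply: eq_bigr => k _; rewrite prodfV prodrXl /sigma chi_prod // => [|j _].
    by congr (_ ^- _); apply: eq_bigr => j _; rewrite chiZ.
  by rewrite expfz_neq0.
rewrite prodrXl /t chi_prod // => [|j _]; last by rewrite expfz_neq0.
by congr (_ ^+ _); apply: eq_bigr => j _; rewrite chiZ.
Qed.

(** The factors [g(delta)] and [q ^ s_delta(0)] cancel; the remaining summand
    depends on [lambda] and [m] through the relation [delta(lambda) - m gamma] only. *)
Lemma hypergeometric_side :
  \sum_(lambda in Lambda F H^T)
          (\prod_k chi (sigma k) ^- lambda k)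
          * q ^ ((hyp_mult R gamma (delta_of rho lambda) 0)%:Z - 1)
          * gauss_vec psi chi (delta_of rho lambda)
          * hyp_sum gamma psi chi (delta_of rho lambda)
              (t / gamma_gamma F gamma) =
  - (q * (q - 1))^-1 * \sum_(v in relations F m) twisted_gauss psi chi u v *
     q ^+ minn #|zeros_neg v| #|zeros_pos v|.
Proof.
have q0 : q != 0 by rewrite pnatr_eq0 -lt0n (ltn_trans _ (card_finNzRing_gt1 F)).
have q10 : q - 1 != 0.
  by rewrite subr_eq0 -[1]/(1%:R) eqr_nat neq_ltn (card_finNzRing_gt1 F) orbT.
have q11 : 1 - q != 0 by rewrite -opprB oppr_eq0.
rewrite -(sum_relations hgamma hfb hc hA hHA hrho) mulr_sumr; apply: eq_bigr => lambda _.
rewrite /hyp_sum mulr_sumr !mulr_sumr; apply: eq_bigr => a _.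
rewrite twisted_gauss_relation -hyp_mult_relation.
rewrite [gamma_gamma F gamma * _]mulrC divfK ?gamma_gamma_neq0 //.
have g0 : gauss_vec psi chi (delta_of rho lambda) != 0.
  by apply/prodf_neq0 => j _; exact: gauss_neq0.
rewrite !expfzDr // -exprnN exprN1.
set z0 := hyp_mult R gamma (delta_of rho lambda) 0.
set za := hyp_mult R gamma (delta_of rho lambda) (- a).
set X := \prod_k _; set Y := chi t ^+ a.
have Qz : q ^+ z0 != 0 by rewrite expf_neq0.
exact: (@cancel_gauss_factors _ X Y (q ^+ z0) (q ^+ za)).
Qed.

End HypergeometricSide.

(** * Cones spanned by chains *)

Section NorthwestCorner.
Variables (R : realDomainType) (n : nat).
Implicit Types (w : 'I_n * 'I_n -> R) (p : 'I_n * 'I_n).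

Definition chain_supported w :=
  forall p p', w p != 0 -> w p' != 0 -> le_pair p p' || le_pair p' p.

(** An entry in the first [k] rows but not in the first [l] columns and an entry
    in the first [l] columns but not in the first [k] rows are incomparable. So the
    [k] by [l] corner carries the whole mass of these rows or of these columns. *)
Lemma partial_sum_min w (k l : nat) : (forall p, 0 <= w p) -> chain_supported w ->
  \sum_(p : 'I_n * 'I_n | (p.1 < k)%N && (p.2 < l)%N) w p =
  Num.min (\sum_(p : 'I_n * 'I_n | (p.1 < k)%N) w p) (\sum_(p : 'I_n * 'I_n | (p.2 < l)%N) w p).
Proof.
move=> w0 cw.
rewrite [X in Num.min X _](bigID (fun p : 'I_n * 'I_n => (p.2 < l)%N)) /=.
rewrite [X in Num.min _ X](bigID (fun p : 'I_n * 'I_n => (p.1 < k)%N)) /=.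
under [X in Num.min _ (X + _)]eq_bigl do rewrite andbC.
set s := \sum_(p : 'I_n * 'I_n | _) _; set s1 := \sum_(p : 'I_n * 'I_n | _) _; set s2 := \sum_(p : 'I_n * 'I_n | _) _.
have s10 : 0 <= s1 by apply: sumr_ge0.
have s20 : 0 <= s2 by apply: sumr_ge0.
suff [-> | ->] : s1 = 0 \/ s2 = 0.
- by rewrite addr0 min_l // lerDl.
- by rewrite addr0 min_r // lerDl.
have [/existsP[p /andP[hp wp]]|/existsPn h] := boolP
  [exists p : 'I_n * 'I_n, [&& (p.1 < k)%N, ~~ (p.2 < l)%N & w p != 0]].
  right; apply: big1 => p' /andP[h1 h2]; apply/eqP/negPn/negP => wp'.
  case/andP: wp => h3 wp; rewrite -leqNgt in h3; have := cw _ _ wp wp'; rewrite /le_pair /=; move: h1 h2 h3 hp; lia.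
left; apply: big1 => p /andP[h1 h2]; apply/eqP/negPn/negP => wp.
by have := h p; rewrite h1 h2 wp.
Qed.

Lemma entry_partial_sums w (i j : 'I_n) (W := fun k l => \sum_(p : 'I_n * 'I_n | (p.1 < k)%N && (p.2 < l)%N) w p) :
  w (i, j) = W i.+1 j.+1 - W i j.+1 - (W i.+1 j - W i j).
Proof.
have E l : W i.+1 l - W i l = \sum_(p : 'I_n * 'I_n | (p.1 == i) && (p.2 < l)%N) w p.
  rewrite /W (bigID (fun p : 'I_n * 'I_n => p.1 == i)) /= [X in _ + X - _](eq_bigl (fun p : 'I_n * 'I_n => (p.1 < i)%N && (p.2 < l)%N)).
    rewrite addrK; apply: eq_bigl => p; rewrite -val_eqE /=; lia.
  by move=> p; rewrite -val_eqE /=; lia.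
rewrite !E (bigD1 (i, j)) /=; last by rewrite eqxx /=.
rewrite -addrA [X in _ + (X - _)](eq_bigl (fun p : 'I_n * 'I_n => (p.1 == i) && (p.2 < j)%N)) ?subrr ?addr0 //.
move=> [a b]; rewrite xpair_eqE -!val_eqE /=; lia.
Qed.

(** The north-west corner rule: by [partial_sum_min] the row and column sums
    determine all corner sums, and the entries are their second differences. *)
Lemma northwest_corner_uniq w w' :
  (forall p, 0 <= w p) -> (forall p, 0 <= w' p) ->
  chain_supported w -> chain_supported w' ->
  (forall i, \sum_(p : 'I_n * 'I_n | p.1 == i) w p = \sum_(p : 'I_n * 'I_n | p.1 == i) w' p) ->
  (forall j, \sum_(p : 'I_n * 'I_n | p.2 == j) w p = \sum_(p : 'I_n * 'I_n | p.2 == j) w' p) ->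
  w =1 w'.
Proof.
move=> w0 w'0 cw cw' er ec.
have Er k : \sum_(p : 'I_n * 'I_n | (p.1 < k)%N) w p = \sum_(p : 'I_n * 'I_n | (p.1 < k)%N) w' p.
  rewrite !(partition_big fst (fun i : 'I_n => (i < k)%N)) //=.
  apply: eq_bigr => i hi; transitivity (\sum_(p : 'I_n * 'I_n | p.1 == i) w p).
    by apply: eq_bigl => p; case: eqP => [->|]; rewrite ?hi ?andbF.
  by rewrite er; apply: eq_bigl => p; case: eqP => [->|]; rewrite ?hi ?andbF.
have Ec k : \sum_(p : 'I_n * 'I_n | (p.2 < k)%N) w p = \sum_(p : 'I_n * 'I_n | (p.2 < k)%N) w' p.
  rewrite !(partition_big snd (fun i : 'I_n => (i < k)%N)) //=.
  apply: eq_bigr => i hi; transitivity (\sum_(p : 'I_n * 'I_n | p.2 == i) w p).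
    by apply: eq_bigl => p; case: eqP => [->|]; rewrite ?hi ?andbF.
  by rewrite ec; apply: eq_bigl => p; case: eqP => [->|]; rewrite ?hi ?andbF.
move=> [i j]; rewrite !entry_partial_sums.
by rewrite !partial_sum_min // !Er !Ec.
Qed.

End NorthwestCorner.

Section Cones.
Variables (R : realType) (d r : nat) (m : 'M[int]_(d, d.+2)) (gamma : 'I_d.+2 -> int).
Hypothesis hneg : forall j : 'I_d.+2, (j < r)%N -> gamma j < 0.
Hypothesis hpos : forall j : 'I_d.+2, (r <= j)%N -> 0 < gamma j.
Variables (alpha0 : 'I_d.+2 -> 'I_d.+2 -> R) (alpha : 'I_d.+2 -> 'I_d.+2 -> 'rV[R]_d).
Hypothesis halpha : are_inward_normals r m gamma alpha0 alpha.
Local Notation ray := ('I_d.+2 * 'I_d.+2)%type.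
Implicit Types (C D : {set ray}) (p : ray) (k : 'I_d.+2).

Definition neg_idx : {set 'I_d.+2} := [set k : 'I_d.+2 | (k < r)%N]%SET.
Definition pos_idx : {set 'I_d.+2} := [set k : 'I_d.+2 | (r <= k)%N]%SET.

Definition support C : {set 'I_d.+2} := (fst @: C :|: snd @: C)%SET.

Definition proper_chain C :=
  (C \in chains neg_idx pos_idx) && (support C != setT).

(** The coordinates of [x^(i,j) = gamma_j e_i - gamma_i e_j]. *)
Definition facet_coord p k : int :=
  gamma p.2 *+ (k == p.1) - gamma p.1 *+ (k == p.2).

Definition dot (a : 'rV[int]_d) (v : 'rV[R]_d) : R := \sum_i (a 0 i)%:~R * v 0 i.

Lemma proper_chain_ray C p : C \in chains neg_idx pos_idx -> p \in C -> (p.1 < r)%N && (r <= p.2)%N.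
Proof.
by rewrite inE => /andP[/subsetP sC _] /sC; rewrite !inE.
Qed.

Lemma facet_coord_ge0 p k : (p.1 < r)%N && (r <= p.2)%N -> 0 <= facet_coord p k.
Proof.
move=> /andP[/hneg h1 /hpos h2]; rewrite /facet_coord.
by case: (k == _); case: (k == _); rewrite /= ?mulr1n ?mulr0n; lia.
Qed.

Lemma facet_coord_eq0 p k : (p.1 < r)%N && (r <= p.2)%N ->
  (facet_coord p k == 0) = (k != p.1) && (k != p.2).
Proof.
move=> /andP[/hneg h1 /hpos h2]; rewrite /facet_coord.
by case: (k == _); case: (k == _); rewrite /= ?mulr1n ?mulr0n; lia.
Qed.

Lemma dot_alpha p k : (p.1 < r)%N && (r <= p.2)%N ->
  dot (exponent m k) (alpha p.1 p.2) = (facet_coord p k)%:~R - alpha0 p.1 p.2.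
Proof.
case: p => i j /= /andP[hi hj]; have := halpha hi hj.
move=> /matrixP /(_ 0 k); rewrite !mxE big_split_ord /= big_ord1.
rewrite row_mxEl col_mxEu !mxE eqxx mulr1n mulr1 => h.
have -> : dot (exponent m k) (alpha i j) =
   \sum_i0 row_mx (alpha0 i j)%:M (alpha i j) 0 (rshift 1 i0) *
     with_ones (map_mx intr m) (rshift 1 i0) k.
  apply: eq_bigr => l _; rewrite row_mxEr col_mxEd !mxE mulrC //.
move: h => /(canRL (addKr _)) ->; rewrite [LHS]addrC.
apply: (congr1 (fun z => z - alpha0 i j)).
by rewrite /facet_coord /= rmorphB /= !rmorphMn /= addrC !mulr_natr.
Qed.

Lemma dot_sum a C (c : ray -> R) :
  dot a (\sum_(p in C) c p *: alpha p.1 p.2) = \sum_(p in C) c p * dot a (alpha p.1 p.2).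
Proof.
rewrite /dot; under eq_bigr do rewrite summxE mulr_sumr.
rewrite exchange_big /=; apply: eq_bigr => p _; rewrite mulr_sumr; apply: eq_bigr => i _.
by rewrite mxE mulrCA.
Qed.

(** Up to a common additive constant, the values of a vector of the cone at the
    exponents [m_k] are the numbers [y_k = sum_p a_p x^p_k]. These are nonnegative,
    and one of them vanishes because the support of a proper chain is not
    everything; so the vector determines [y]. Multiplying [y_k] by the absolute
    value of [gamma_k] gives the row and column sums of the array [a], up to the
    factors [- gamma_i gamma_j]. *)
Lemma cone_coords_uniq C C' (a a' : ray -> R) : proper_chain C -> proper_chain C' ->
  (forall p, p \in C -> 0 <= a p) -> (forall p, p \in C' -> 0 <= a' p) ->
  \sum_(p in C) a p *: alpha p.1 p.2 = \sum_(p in C') a' p *: alpha p.1 p.2 ->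
  forall p, (if p \in C then a p else 0) = (if p \in C' then a' p else 0).
Proof.
move=> /andP[cC sC] /andP[cC' sC'] a0 a'0 e.
pose y (D : {set ray}) (c : ray -> R) k := \sum_(p in D) c p * (facet_coord p k)%:~R.
have y0 D c k : D \in chains neg_idx pos_idx -> (forall p, p \in D -> 0 <= c p) -> 0 <= y D c k.
  move=> cD c0; apply: sumr_ge0 => p pD; rewrite mulr_ge0 ?c0 // ler0z.
  by rewrite facet_coord_ge0 // (proper_chain_ray cD).
have yz D c : D \in chains neg_idx pos_idx -> support D != setT -> exists k, y D c k = 0.
  move=> cD; rewrite -subTset => /subsetPn[k _ kD]; exists k; apply: big1 => p pD.
  have -> : facet_coord p k = 0; last by rewrite mulr0.
  apply/eqP; rewrite facet_coord_eq0 ?(proper_chain_ray cD) //; apply/andP; split.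
    by apply: contra kD => /eqP ->; rewrite inE imset_f.
  by apply: contra kD => /eqP ->; rewrite inE orbC imset_f.
have yd D c k : D \in chains neg_idx pos_idx ->
    y D c k = dot (exponent m k) (\sum_(p in D) c p *: alpha p.1 p.2)
            + \sum_(p in D) c p * alpha0 p.1 p.2.
  move=> cD; rewrite dot_sum -big_split /=; apply: eq_bigr => p pD.
  by rewrite dot_alpha ?(proper_chain_ray cD) // -mulrDr subrK.
have ey k : y C a k = y C' a' k.
  have [k1 hk1] := yz C a cC sC; have [k2 hk2] := yz C' a' cC' sC'.
  have := y0 _ _ k2 cC a0; have := y0 _ _ k1 cC' a'0.
  move: hk1 hk2; rewrite !yd // e; lra.
pose w (D : {set ray}) (c : ray -> R) p : R :=
  if p \in D then c p * (gamma p.2 * - gamma p.1)%:~R else 0.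
have g0 D p : D \in chains neg_idx pos_idx -> p \in D -> 0 < gamma p.2 * - gamma p.1.
  move=> cD pD; have /andP[/hneg h1 /hpos h2] := proper_chain_ray cD pD.
  by rewrite mulr_gt0 // oppr_gt0.
have w0 D c p : D \in chains neg_idx pos_idx -> (forall p, p \in D -> 0 <= c p) -> 0 <= w D c p.
  move=> cD c0; rewrite /w; case: ifP => // pD; rewrite mulr_ge0 ?c0 // ler0z ltW //.
  exact: g0 cD pD.
have cw D c : D \in chains neg_idx pos_idx -> chain_supported (w D c).
  rewrite inE => /andP[_ /chain_setP h] p p'; rewrite /w.
  by case: ifP => [pD|]; rewrite ?eqxx //; case: ifP => [p'D|]; rewrite ?eqxx // => _ _; exact: h.
have er D c k : D \in chains neg_idx pos_idx ->
    \sum_(p | p.1 == k) w D c p = if (k < r)%N then (- gamma k)%:~R * y D c k else 0.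
  move=> cD; case: ifPn => hk; last first.
    apply: big1 => p /eqP ek; rewrite /w; case: ifP => // pD.
    by have := proper_chain_ray cD pD; rewrite ek (negbTE hk).
  rewrite /y mulr_sumr big_mkcond /= [RHS]big_mkcond /=; apply: eq_bigr => p _.
  rewrite /w; case: (boolP (p \in D)) => pD; last by rewrite if_same.
  have /andP[h1 h2] := proper_chain_ray cD pD.
  have k2 : (k == p.2) = false by apply/negP => /eqP kp; move: hk h2; rewrite kp ltnNge => /negbTE ->.
  rewrite /facet_coord k2 mulr0n subr0 eq_sym; case: eqP => [->|_]; last by rewrite mulr0n !mulr0.
  by rewrite mulr1n intrM !rmorphN /=; ring.
have ec D c k : D \in chains neg_idx pos_idx ->
    \sum_(p | p.2 == k) w D c p = if (k < r)%N then 0 else (gamma k)%:~R * y D c k.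
  move=> cD; case: ifPn => hk.
    apply: big1 => p /eqP ek; rewrite /w; case: ifP => // pD.
    by have := proper_chain_ray cD pD; rewrite ek [(r <= k)%N]leqNgt hk andbF.
  rewrite /y mulr_sumr big_mkcond /= [RHS]big_mkcond /=; apply: eq_bigr => p _.
  rewrite /w; case: (boolP (p \in D)) => pD; last by rewrite if_same.
  have /andP[h1 h2] := proper_chain_ray cD pD.
  have k2 : (k == p.1) = false by apply/negP => /eqP kp; move: hk; rewrite kp h1.
  rewrite /facet_coord k2 mulr0n sub0r eq_sym; case: eqP => [->|_]; last by rewrite mulr0n oppr0 !mulr0.
  by rewrite mulr1n intrM !rmorphN /=; ring.
have := northwest_corner_uniq (fun p => w0 C a p cC a0) (fun p => w0 C' a' p cC' a'0)
  (cw C a cC) (cw C' a' cC').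
move=> NW; have ew : w C a =1 w C' a' by apply: NW => k; rewrite ?er ?ec ?ey.
move=> p; have := ew p; rewrite /w; case: ifP => pC; case: ifP => pC' //.
- by move/mulIf; apply; rewrite intr_eq0 gt_eqF // (g0 C).
- by move/eqP; rewrite mulf_eq0 intr_eq0 (gt_eqF (g0 _ _ cC pC)) orbF => /eqP.
- by move/esym/eqP; rewrite mulf_eq0 intr_eq0 (gt_eqF (g0 _ _ cC' pC')) orbF => /eqP.
Qed.

End Cones.

(** * Smith normal form of independent vectors *)

(** Linearly independent integer vectors, the columns of [B], become nonzero
    multiples of part of a basis after a unimodular change of coordinates and a
    change of generators of their span; this is the Smith normal form. *)
Lemma smith_independent d n (B : 'M[int]_(d, n)) :
  (forall c : 'cV[int]_n, B *m c = 0 -> c = 0) ->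
  exists L : 'M[int]_d, [/\ L \in unitmx, (n <= d)%N,
    (forall a : 'rV[int]_d, a *m B = 0 <-> (forall i : 'I_d, (i < n)%N -> (a *m L) 0 i = 0))
  & exists2 N : int, 0 < N & forall k, exists a : 'rV[int]_d, a *m B = N *: delta_mx 0 k].
Proof.
move=> indep; have [L uL [Q uQ [e _ eB]]] := int_Smith_normal_form B.
set E := \matrix_(i, j) _ in eB.
have e0 (j : 'I_n) : (j < d)%N && (e`_j != 0).
  apply/negPn/negP => nz; have : B *m (invmx Q *m delta_mx j 0) = 0 :> 'cV_d.
    rewrite eB -!mulmxA (mulmxA Q) mulmxV // mul1mx.
    suff -> : E *m delta_mx j 0 = 0 :> 'cV_d by rewrite mulmx0.
    rewrite -colE; apply/matrixP => i l; rewrite !mxE.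
    case: eqP => [ij|]; last by rewrite mulr0n.
    rewrite mulr1n ij; move: nz; rewrite -{1}ij ltn_ord /= negbK => /eqP //.
  move/indep/(congr1 (mulmx Q)); rewrite mulmx0 mulmxA mulmxV // mul1mx.
  by move/matrixP/(_ j 0); rewrite !mxE !eqxx => /eqP; rewrite oner_eq0.
have nd : (n <= d)%N.
  by rewrite leqNgt; apply/negP => dn; have := e0 (Ordinal dn); rewrite /= ltnn.
have rowE (a : 'rV[int]_d) (j : 'I_n) : (a *m E) 0 j = a 0 (widen_ord nd j) * e`_j.
  rewrite mxE (bigD1 (widen_ord nd j)) //= big1 ?addr0; first by rewrite mxE eqxx mulr1n.
  move=> i ij; rewrite mxE; case: eqP => [eij|]; last by rewrite mulr0n mulr0.
  by case/eqP: ij; apply: val_inj.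
exists L; split => //.
- move=> a; split=> [aB i hi|h].
    have : a *m B *m invmx Q = 0 by rewrite aB mul0mx.
    rewrite eB -!mulmxA mulmxV // mulmx1 mulmxA => /matrixP/(_ 0 (Ordinal hi)).
    rewrite rowE [RHS]mxE => /eqP; rewrite mulf_eq0 => /orP[/eqP <-|].
      by congr (_ _ _); apply: val_inj.
    by have /andP[_ /negbTE ->] := e0 (Ordinal hi).
  rewrite eB !mulmxA; suff -> : a *m L *m E = 0 by rewrite mul0mx.
  by apply/matrixP => i j; rewrite ord1 rowE [RHS]mxE h ?mul0r //=.
(* Squares make [N] positive whatever the signs of the invariant factors. *)
pose N := \prod_(j < n) e`_j ^+ 2.
exists N.
  by apply: prodr_gt0 => j _; rewrite exprn_even_gt0 //=; have /andP[] := e0 j.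
move=> k; pose f (j : 'I_n) := e`_j * \prod_(i < n | i != j) e`_i ^+ 2.
have fe j : f j * e`_j = N.
  by rewrite /f /N [RHS](bigD1 j) //= mulrAC expr2.
pose b : 'rV[int]_d := \row_(i < d)
  if insub (val i) is Some j then f j * (invmx Q) k j else 0.
exists (b *m invmx L); rewrite eB !mulmxA mulmxKV //.
suff -> : b *m E = N *: row k (invmx Q).
  by rewrite -scalemxAl -row_mul mulVmx // row1.
apply/matrixP => i j; rewrite ord1 rowE !mxE.
have -> : insub (val (widen_ord nd j)) = Some j :> option 'I_n := valK j.
by rewrite mulrAC fe.
Qed.

(** * Points of a simplicial toric variety *)

(** A simplicial fan: its cones are spanned by the rays [alpha p] with [p] in a
    member of [Fam], and [beta p] is an integer vector on the ray [alpha p]. *)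
Section SimplicialFan.
Variables (R : realType) (F : finFieldType) (d : nat) (I : finType).
Variables (alpha : I -> 'rV[R]_d) (beta : I -> 'rV[int]_d) (N : int).
Variable Fam : {set {set I}}.
Implicit Types (C D : {set I}) (a b : 'rV[int]_d) (p : I) (z : {ffun 'I_d -> F}).

Definition cone_of C : set 'rV[R]_d :=
  [set v | exists2 c : I -> R, (forall p, 0 <= c p) & v = \sum_(p in C) c p *: alpha p].

Hypothesis N_gt0 : 0 < N.
Hypothesis Fam_sub : forall C D, D \subset C -> C \in Fam -> D \in Fam.
Hypothesis betaE : forall C p, C \in Fam -> p \in C ->
  N%:~R *: alpha p = map_mx intr (beta p).
Hypothesis coords_uniq : forall C C' (c c' : I -> R), C \in Fam -> C' \in Fam ->
  (forall p, p \in C -> 0 <= c p) -> (forall p, p \in C' -> 0 <= c' p) ->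
  \sum_(p in C) c p *: alpha p = \sum_(p in C') c' p *: alpha p ->
  forall p, (if p \in C then c p else 0) = (if p \in C' then c' p else 0).

Definition idot a b : int := \sum_i a 0 i * b 0 i.

Definition in_monoid C a := [forall p in C, 0 <= idot a (beta p)].
Definition on_face C a := [forall p in C, idot a (beta p) == 0].

Lemma idot0 b : idot 0 b = 0.
Proof. by apply: big1 => i _; rewrite mxE mul0r. Qed.
Lemma idotD a a' b : idot (a + a') b = idot a b + idot a' b.
Proof. by rewrite -big_split; apply: eq_bigr => i _; rewrite mxE mulrDl. Qed.
Lemma idotN a b : idot (- a) b = - idot a b.
Proof. by rewrite -sumrN; apply: eq_bigr => i _; rewrite mxE mulNr. Qed.
Lemma idotMn a b n : idot (a *+ n) b = idot a b *+ n.
Proof. by elim: n => [|n IH]; rewrite ?mulr0n ?idot0 // !mulrS idotD IH. Qed.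
Lemma idot_sum (J : finType) (P : pred J) (f : J -> 'rV[int]_d) b :
  idot (\sum_(j | P j) f j) b = \sum_(j | P j) idot (f j) b.
Proof.
apply: (big_ind2 (fun x y => idot x b = y)) => [|x1 x2 y1 y2 <- <-|j _] //; first exact: idot0.
exact: idotD.
Qed.

Lemma in_monoidP C a : reflect (forall p, p \in C -> 0 <= idot a (beta p)) (in_monoid C a).
Proof. exact: forall_inP. Qed.
Lemma on_faceP C a : reflect (forall p, p \in C -> idot a (beta p) = 0) (on_face C a).
Proof. by apply: (iffP forall_inP) => h p /h /eqP. Qed.

Lemma in_monoidD C a b : in_monoid C a -> in_monoid C b -> in_monoid C (a + b).
Proof.
move=> /in_monoidP ha /in_monoidP hb; apply/in_monoidP => p pC.
by rewrite idotD addr_ge0 ?ha ?hb.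
Qed.
Lemma in_monoid0 C : in_monoid C 0.
Proof. by apply/in_monoidP => p _; rewrite idot0. Qed.
Lemma in_monoidMn C a n : in_monoid C a -> in_monoid C (a *+ n).
Proof.
by move=> /in_monoidP ha; apply/in_monoidP => p pC; rewrite idotMn mulrn_wge0 ?ha.
Qed.
Lemma on_face0 C : on_face C 0.
Proof. by apply/on_faceP => p _; rewrite idot0. Qed.
Lemma on_faceD C a b : on_face C a -> on_face C b -> on_face C (a + b).
Proof.
move=> /on_faceP ha /on_faceP hb; apply/on_faceP => p pC.
by rewrite idotD ha ?hb.
Qed.
Lemma on_faceN C a : on_face C (- a) = on_face C a.
Proof. by apply: eq_forallb => p; rewrite idotN oppr_eq0. Qed.
Lemma on_faceMn C a n : on_face C a -> on_face C (a *+ n).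
Proof.
by move=> /on_faceP ha; apply/on_faceP => p pC; rewrite idotMn ha ?mul0rn.
Qed.
Lemma on_face_split C D a b : D \subset C -> in_monoid C a -> in_monoid C b ->
  on_face D (a + b) = on_face D a && on_face D b.
Proof.
move=> /subsetP DC /in_monoidP ha /in_monoidP hb; apply/idP/andP => [/on_faceP h|[]]; last first.
  exact: on_faceD.
split; apply/on_faceP => p pD; have := h p pD; rewrite idotD => /eqP;
  by rewrite paddr_eq0 ?ha ?hb ?DC // => /andP[/eqP h1 /eqP h2].
Qed.
Lemma in_monoidS C D a : D \subset C -> in_monoid C a -> in_monoid D a.
Proof. by move=> /subsetP DC /in_monoidP h; apply/in_monoidP => p /DC /h. Qed.

Lemma dot_beta C p a : C \in Fam -> p \in C ->
  N%:~R * (\sum_i (a 0 i)%:~R * alpha p 0 i) = (idot a (beta p))%:~R :> R.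
Proof.
move=> CF pC; rewrite mulr_sumr rmorph_sum /=; apply: eq_bigr => i _.
rewrite rmorphM /= mulrCA; congr (_ * _).
by have /matrixP/(_ 0 i) := betaE CF pC; rewrite !mxE.
Qed.

Lemma dual_monoid_cone C a : C \in Fam -> dual_monoid (cone_of C) a <-> in_monoid C a.
Proof.
move=> CF; have NR : 0 < N%:~R :> R by rewrite ltr0z.
have E p : p \in C -> (0 <= \sum_i (a 0 i)%:~R * alpha p 0 i) = (0 <= idot a (beta p)).
  by move=> pC; rewrite -(pmulr_rge0 _ NR) (dot_beta a CF pC) ler0z.
split=> [h|/in_monoidP h v [c c0 ->]].
  apply/in_monoidP => p pC; rewrite -E //; apply: h.
  exists (fun k => (k == p)%:R) => [k|]; first by case: (_ == _).
  rewrite (bigD1 p) //= eqxx scale1r big1 ?addr0 // => k /andP[_ /negbTE ->].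
  by rewrite scale0r.
under eq_bigr do rewrite summxE mulr_sumr.
rewrite exchange_big /=; apply: sumr_ge0 => p pC.
under eq_bigr do rewrite mxE mulrCA.
by rewrite -mulr_sumr mulr_ge0 // E // h.
Qed.

Lemma coneI C C' : C \in Fam -> C' \in Fam -> cone_of C `&` cone_of C' = cone_of (C :&: C')%SET.
Proof.
move=> CF C'F; apply/predeqP => v; split=> [[[c c0 ec] [c' c'0 ec']]|[c c0 ->]].
  exists c => //; rewrite ec [LHS]big_mkcond [RHS]big_mkcond /=; apply: eq_bigr => p _.
  have := coords_uniq CF C'F (fun p _ => c0 p) (fun p _ => c'0 p) (etrans (esym ec) ec') p.
  rewrite inE; case: (p \in C) => //=; case: (p \in C') => // ->.
  by rewrite scale0r.
split; [exists (fun p => if p \in C' then c p else 0)|exists (fun p => if p \in C then c p else 0)];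
  try by [move=> p; case: ifP];
  rewrite [LHS]big_mkcond [RHS]big_mkcond; apply: eq_bigr => p _; rewrite inE;
  by case: (p \in C); case: (p \in C'); rewrite //= scale0r.
Qed.

(** Separate the positive and the negative coefficients of a linear relation and
    compare the two nonnegative combinations. *)
Lemma cone_independent C (c : I -> R) : C \in Fam ->
  \sum_(p in C) c p *: alpha p = 0 -> forall p, p \in C -> c p = 0.
Proof.
move=> CF e0 p pC.
have e : \sum_(p in C) Num.max (c p) 0 *: alpha p = \sum_(p in C) Num.max (- c p) 0 *: alpha p.
  apply/eqP; rewrite -subr_eq0 -sumrB; apply/eqP; rewrite -[RHS]e0; apply: eq_bigr => k _.
  by rewrite -scalerBl; congr (_ *: _); rewrite !maxEle; case: ifP; case: ifP; lra.
have cp (k : I) : k \in C -> 0 <= Num.max (c k) 0 by rewrite le_max lexx orbT.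
have cn (k : I) : k \in C -> 0 <= Num.max (- c k) 0 by rewrite le_max lexx orbT.
have := coords_uniq CF CF cp cn e p; rewrite pC.
by rewrite !maxEle; case: ifP; case: ifP; lra.
Qed.

(** The columns of [L] are coordinates in which the lattice orthogonal to [C] is
    given by the vanishing of the first [#|C|] of them. The vectors [dl p] are dual
    to the rays of [C], up to the factor [M]. *)
Lemma face_basis C : C \in Fam -> exists L : 'M[int]_d, [/\ L \in unitmx, (#|C| <= d)%N,
    (forall a, on_face C a <-> (forall i : 'I_d, (i < #|C|)%N -> (a *m L) 0 i = 0))
  & exists M : nat, exists2 dl : I -> 'rV[int]_d, (0 < M)%N &
      {in C &, forall p p', idot (dl p) (beta p') = (M * (p == p'))%N}].
Proof.
move=> CF; pose B : 'M[int]_(d, #|C|) := \matrix_(i, k) beta (enum_val k) 0 i.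
have aB (a : 'rV[int]_d) (k : 'I_#|C|) : (a *m B) 0 k = idot a (beta (enum_val k)).
  by rewrite mxE; apply: eq_bigr => i _; rewrite mxE.
have indep (c : 'cV[int]_#|C|) : B *m c = 0 -> c = 0.
  move=> Bc; pose f p : R := \sum_(k < #|C|) (enum_val k == p)%:R * (c k 0)%:~R.
  have fE k : f (enum_val k) = (c k 0)%:~R.
    rewrite /f (bigD1 k) //= eqxx mul1r big1 ?addr0 // => k' k'k.
    by rewrite (inj_eq enum_val_inj) (negbTE k'k) mul0r.
  have f0 : \sum_(p in C) f p *: alpha p = 0.
    have NR : (N%:~R : R) != 0 by rewrite intr_eq0 gt_eqF.
    apply: (scalerI NR); rewrite scaler0 scaler_sumr big_enum_val /=.
    apply/matrixP => i0 i; rewrite ord1 summxE mxE.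
    have := congr1 (fun b : 'cV[int]_d => (b i 0)%:~R : R) Bc.
    rewrite [X in X%:~R]mxE rmorph_sum mxE mulr0z /= => h; rewrite -[RHS]h; apply: eq_bigr => k _.
    rewrite fE scalerA mulrC -scalerA (betaE CF) ?enum_valP // !mxE rmorphM mulrC //.
  apply/matrixP => k j; rewrite ord1 mxE; apply/eqP; rewrite -(intr_eq0 R) -fE.
  by rewrite (cone_independent CF f0) // enum_valP.
have [L [uL le_d face [M M0 dl]]] := smith_independent indep.
exists L; split=> //.
  move=> a; rewrite -face; split=> [/on_faceP h|h].
    by apply/matrixP => i k; rewrite ord1 aB h ?mxE // enum_valP.
  apply/on_faceP => p pC; rewrite -(enum_rankK_in pC pC) -aB h mxE //.
have /boolp.choice[g hg] : forall p, exists a, p \in C ->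
    forall p', p' \in C -> idot a (beta p') = (`|M| * (p == p'))%N.
  move=> p; have [pC|] := boolP (p \in C); last by exists 0.
  have [a ha] := dl (enum_rank_in pC p); exists a => _ p' p'C.
  rewrite -[in LHS](enum_rankK_in pC p'C) -aB ha !mxE eqxx /=.
  have -> : (enum_rank_in pC p' == enum_rank_in pC p) = (p == p').
    apply/eqP/eqP => [/(congr1 enum_val)|pp']; first by rewrite !enum_rankK_in.
    by congr enum_rank_in.
  by rewrite PoszM gtz0_abs //; case: (_ == _).
exists `|M|%N; exists g => [|p p' pC p'C]; last exact: hg.
by rewrite absz_gt0 gt_eqF.
Qed.

Variable L : {set I} -> 'M[int]_d.
Hypothesis L_unit : forall C, C \in Fam -> L C \in unitmx.
Hypothesis L_face : forall C a, C \in Fam ->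
  on_face C a <-> (forall i : 'I_d, (i < #|C|)%N -> (a *m L C) 0 i = 0).

(** The points of the orbit of [D] are the homomorphisms from the lattice
    orthogonal to [D] to the units of [F], here extended by [0] and given by
    coordinates [z]. *)
Definition orbit_coord D z a : F :=
  if on_face D a then torus_monomial z ((a *m L D) 0) else 0.

Definition orbit_point C D z a : F := if in_monoid C a then orbit_coord D z a else 0.

(** The first [#|D|] coordinates have no influence on the point; fixing them
    makes [z] unique. *)
Definition normalized D z :=
  (z \in torus F d) && [forall i : 'I_d, (i < #|D|)%N ==> (z i == 1)].

Lemma torus_monomialD z (f g : 'I_d -> int) : z \in torus F d ->
  torus_monomial z (fun i => f i + g i) = torus_monomial z f * torus_monomial z g.
Proof.
move=> /torusP z0; rewrite -big_split; apply: eq_bigr => i _.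
by rewrite expfzDr.
Qed.

Lemma torus_monomial_eq z (f g : 'I_d -> int) : f =1 g -> torus_monomial z f = torus_monomial z g.
Proof. by move=> e; apply: eq_bigr => i _; rewrite e. Qed.

Lemma orbit_coord_neq0 D z a : z \in torus F d -> (orbit_coord D z a != 0) = on_face D a.
Proof.
by move=> zT; rewrite /orbit_coord; case: ifP; rewrite ?eqxx // torus_monomial_neq0.
Qed.

Lemma orbit_coordD D z a b : z \in torus F d -> on_face D a -> on_face D b ->
  orbit_coord D z (a + b) = orbit_coord D z a * orbit_coord D z b.
Proof.
move=> zT ha hb; rewrite /orbit_coord on_faceD // ha hb -torus_monomialD //.
by apply: torus_monomial_eq => i; rewrite mulmxDl mxE.
Qed.

Lemma orbit_coord0 D z : orbit_coord D z 0 = 1.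
Proof.
rewrite /orbit_coord on_face0; apply: big1 => i _; rewrite mul0mx mxE expr0z //.
Qed.

Lemma orbit_point_chart C D z : C \in Fam -> D \subset C -> z \in torus F d ->
  chart (cone_of C) (orbit_point C D z).
Proof.
move=> CF DC zT; split.
- by rewrite /orbit_point in_monoid0 orbit_coord0.
- move=> a b /(dual_monoid_cone _ CF) ha /(dual_monoid_cone _ CF) hb.
  rewrite /orbit_point ha hb in_monoidD //.
  have Dab := on_face_split DC ha hb.
  have [/andP[Da Db]|nab] := boolP (on_face D a && on_face D b); first by rewrite orbit_coordD.
  rewrite /orbit_coord Dab (negbTE nab).
  by move: nab; case: (on_face D a); case: (on_face D b); rewrite ?mul0r ?mulr0.
move=> a /(dual_monoid_cone a CF) ha; rewrite /orbit_point ifN //; exact/negP.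
Qed.

Lemma face_vector D i : D \in Fam -> (#|D| <= val i)%N -> on_face D (row i (invmx (L D))).
Proof.
move=> DF hi; apply/(L_face _ DF) => j hj.
rewrite -row_mul mulVmx ?L_unit // !mxE.
by case: eqP => // e; move: hj; rewrite -e ltnNge hi.
Qed.

Lemma orbit_coord_face_vector D z i : D \in Fam -> (#|D| <= val i)%N ->
  orbit_coord D z (row i (invmx (L D))) = z i.
Proof.
move=> DF hi; rewrite /orbit_coord face_vector // -row_mul mulVmx ?L_unit //.
rewrite /torus_monomial (bigD1 i) //= !mxE eqxx expr1z big1 ?mulr1 // => j ji.
by rewrite !mxE eq_sym (negbTE ji) expr0z.
Qed.

(** A large multiple of a vector [s] that is positive on the rays of [C] outside
    [D] moves a given vector orthogonal to [D] into the monoid of [C]. *)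
Lemma face_shift C D (s : 'rV[int]_d) a : D \subset C ->
  (forall p, p \in C -> p \notin D -> 0 < idot s (beta p)) -> on_face D s -> on_face D a ->
  forall k, (\sum_(p in C) `|idot a (beta p)|%N <= k)%N -> in_monoid C (a + s *+ k).
Proof.
move=> DC s0 /on_faceP sD /on_faceP aD k hk; apply/in_monoidP => p pC.
rewrite idotD idotMn; have [pD|pD] := boolP (p \in D).
  by rewrite aD // sD // mul0rn.
have h : (`|idot a (beta p)| <= k)%N.
  by apply: leq_trans hk; rewrite (bigD1 p) //= leq_addr.
have := s0 p pC pD; move: (idot s _) (idot a _) h => x y h x0.
rewrite -mulr_natr; nia.
Qed.

Lemma face_complement C D : C \in Fam -> D \subset C -> exists s, [/\ on_face D s, in_monoid C s &
  forall p, p \in C -> p \notin D -> 0 < idot s (beta p)].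
Proof.
move=> CF DC; have [_ [_ _ _ [M [dl M0 hdl]]]] := face_basis CF.
have E p : p \in C -> idot (\sum_(k in C :\: D) dl k) (beta p) = (M * (p \notin D))%N.
  move=> pC; rewrite idot_sum.
  rewrite (eq_bigr (fun k => (M * (k == p))%N : int)); last first.
    by move=> k; rewrite inE => /andP[_ kC]; rewrite hdl.
  have [pD|pD] := boolP (p \in D).
    rewrite big1 ?muln0 // => k; rewrite inE; case: eqP => [->|]; first by rewrite pD.
    by rewrite muln0.
  rewrite (bigD1 p) /=; last by rewrite inE pD.
  by rewrite eqxx big1 ?addr0 // => k /andP[_ /negbTE ->]; rewrite muln0.
exists (\sum_(k in C :\: D) dl k); split.
- by apply/on_faceP => p pD; rewrite E ?(fintype.subsetP DC) // pD muln0.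
- by apply/in_monoidP => p pC; rewrite E.
- by move=> p pC pD; rewrite E // pD muln1.
Qed.

Lemma orbit_point_face C D z a : in_monoid C a -> z \in torus F d ->
  (orbit_point C D z a != 0) = on_face D a.
Proof. by move=> ha zT; rewrite /orbit_point ha orbit_coord_neq0. Qed.

(** The point is nonzero exactly on the face of the monoid orthogonal to [D],
    which determines [D]. By [face_shift], its values on this face determine
    those on the whole orthogonal lattice. *)
Lemma orbit_point_inj C D D' z z' : C \in Fam -> D \subset C -> D' \subset C ->
  normalized D z -> normalized D' z' ->
  orbit_point C D z =1 orbit_point C D' z' -> D = D' /\ z = z'.
Proof.
move=> CF DC D'C /andP[zT /forallP z1] /andP[zT' /forallP z1'] e.
have sub D1 D2 t1 t2 : D1 \subset C -> D2 \subset C -> t1 \in torus F d -> t2 \in torus F d ->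
    orbit_point C D1 t1 =1 orbit_point C D2 t2 -> D2 \subset D1.
  move=> s1 s2 t1T t2T e12; have [s [sD sM s0]] := face_complement CF s1.
  apply/fintype.subsetP => p pD2; apply/negPn/negP => pD1.
  have : on_face D2 s by rewrite -(orbit_point_face D2 sM t2T) -e12 orbit_point_face.
  move=> /on_faceP/(_ p pD2) sp0; have := s0 p (fintype.subsetP s2 _ pD2) pD1.
  by rewrite sp0.
have eD : D = D'.
  by apply/eqP; rewrite eqEsubset (sub D' D z' z) // (sub D D' z z').
split=> //; move: eD => eD; subst D'; apply/ffunP => i.
have [hi|hi] := ltnP (val i) #|D|.
  by have := z1 i; have := z1' i; rewrite hi /= => /eqP -> /eqP ->.
have DF := Fam_sub DC CF.
have [s [sD sM s0]] := face_complement CF DC.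
set v := row i (invmx (L D)); have vD : on_face D v := face_vector DF hi.
set k := (\sum_(p in C) `|idot v (beta p)|)%N.
have vk := face_shift DC s0 sD vD (leqnn k).
have := e (v + s *+ k); rewrite /orbit_point vk !orbit_coordD ?on_faceMn //.
rewrite !orbit_coord_face_vector //.
have := e (s *+ k); rewrite /orbit_point in_monoidMn // => ->.
by apply: mulIf; rewrite orbit_coord_neq0 // on_faceMn.
Qed.

Section NormalForm.
Variables (C : {set I}) (x : 'rV[int]_d -> F).
Hypotheses (CF : C \in Fam) (xC : chart (cone_of C) x).

Let x0 : x 0 = 1. Proof. by case: xC. Qed.
Let xD a b : in_monoid C a -> in_monoid C b -> x (a + b) = x a * x b.
Proof.
by case: xC => _ h _ /(dual_monoid_cone _ CF) ha /(dual_monoid_cone _ CF) hb; exact: h.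
Qed.
Let xMn a n : in_monoid C a -> x (a *+ n) = x a ^+ n.
Proof.
move=> ha; elim: n => [|n IH]; first by rewrite mulr0n x0.
by rewrite mulrS exprS xD ?IH // in_monoidMn.
Qed.

(** The rays [p] in [D] are those whose dual vector [dl p] is sent to [0]. A
    multiple of a vector that is positive on such a ray is the sum of [dl p] and of an
    element of the monoid, so [x] vanishes there. A vector orthogonal to [D] is a
    summand, in the monoid, of a multiple of the sum of the other dual vectors,
    where [x] does not vanish. *)
Lemma support_face : exists2 D : {set I}, D \subset C &
  forall a, in_monoid C a -> (x a != 0) = on_face D a.
Proof.
have [_ [_ _ _ [M [dl M0 hdl]]]] := face_basis CF.
have dlC p : p \in C -> in_monoid C (dl p).
  by move=> pC; apply/in_monoidP => k kC; rewrite hdl.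
pose D := [set p in C | x (dl p) == 0]%SET.
have DC : D \subset C by apply/fintype.subsetP => p; rewrite inE => /andP[].
exists D => // a aC; apply/idP/idP => [xa|aD].
  apply/on_faceP => p; rewrite inE => /andP[pC /eqP xp].
  have := in_monoidP _ _ aC p pC; case E: (idot a (beta p)) => [e|//] _.
  case: e E => // e E; case/negP: xa.
  have rC : in_monoid C (a *+ M - dl p *+ e.+1).
    apply/in_monoidP => k kC; rewrite idotD idotN !idotMn hdl //.
    have := in_monoidP _ _ aC k kC; case: eqP => [<-|_] h; last by rewrite muln0 mul0rn subr0 mulrn_wge0.
    by rewrite E muln1; lia.
  have := xMn M aC; rewrite -[a *+ M](subrK (dl p *+ e.+1)) xD ?in_monoidMn ?dlC //.
  rewrite xMn ?dlC // xp expr0n mulr0 => /esym/eqP.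
  by rewrite expf_eq0 => /andP[].
pose s := \sum_(p in C :\: D) dl p.
have [sC xs] : in_monoid C s /\ x s != 0.
  apply: (big_ind (fun v => in_monoid C v /\ x v != 0)) => [|v w [v1 v2] [w1 w2]|p].
  - by rewrite in_monoid0 x0 oner_eq0.
  - by rewrite in_monoidD // xD // mulf_neq0.
  rewrite !inE => /andP[+ pC]; rewrite pC /= => xp; by rewrite dlC.
have s0 p : p \in C -> p \notin D -> 0 < idot s (beta p).
  move=> pC pD; rewrite idot_sum (bigD1 p) /=; last by rewrite inE pD.
  rewrite hdl // eqxx muln1 ltr_pwDl //; apply: sumr_ge0 => k /andP[+ _].
  by rewrite inE => /andP[_ kC]; rewrite hdl.
have sD : on_face D s.
  apply/on_faceP => p pD; rewrite idot_sum big1 // => k; rewrite inE => /andP[kD kC].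
  have pC := fintype.subsetP DC p pD; rewrite hdl //.
  have [kp|_] := eqVneq k p; last by rewrite muln0.
  by rewrite kp pD in kD.
set k := (\sum_(p in C) `|idot (- a) (beta p)|)%N.
have h := face_shift DC s0 sD; have := h (- a); rewrite on_faceN aD => /(_ isT k (leqnn k)) h1.
have : x (s *+ k) != 0 by rewrite xMn // expf_neq0.
rewrite -(addrNK a (s *+ k)) xD // addrC //; apply: contra => /eqP ->.
by rewrite mulr0.
Qed.

(** With [s] as in [face_shift], the quotients [x (a + k s) / x (s) ^ k] extend [x]
    to a homomorphism on the lattice orthogonal to [D]; the coordinates [z] are its
    values on a basis. *)
Lemma normal_form : exists (D : {set I}) (z : {ffun 'I_d -> F}), [/\ D \subset C, normalized D z & x = orbit_point C D z].
Proof.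
have [D DC hD] := support_face; have DF := Fam_sub DC CF.
have [s [sD sM s0]] := face_complement CF DC.
have xs : x s != 0 by rewrite hD.
pose K a := (\sum_(p in C) `|idot a (beta p)|)%N.
pose g a := x (a + s *+ K a) / x s ^+ K a.
have shift a k : on_face D a -> (K a <= k)%N -> in_monoid C (a + s *+ k).
  by move=> aD hk; exact: (face_shift DC s0 sD aD hk).
have gk a k : on_face D a -> (K a <= k)%N -> x (a + s *+ k) = g a * x s ^+ k.
  move=> aD hk; rewrite -(subnKC hk) mulrnDr addrA xD ?shift ?in_monoidMn // xMn //.
  by rewrite exprD mulrA /g divfK // expf_neq0.
have gD a b : on_face D a -> on_face D b -> g (a + b) = g a * g b.
  move=> aD bD; set k := (K a + K b + K (a + b)%R)%N.
  have ka : (K a <= k)%N by rewrite /k -addnA leq_addr.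
  have kb : (K b <= k)%N by rewrite /k addnAC leq_addl.
  have kab : (K (a + b)%R <= k + k)%N by rewrite (leq_trans _ (leq_addr _ _)) // leq_addl.
  have xk : x s ^+ (k + k) != 0 by rewrite expf_neq0.
  apply: (mulIf xk); rewrite -gk ?on_faceD // mulrnDr addrACA xD ?shift // !gk // exprD.
  by rewrite mulrACA.
have g_mon a : on_face D a -> in_monoid C a -> g a = x a.
  move=> aD aC; have xk : x s ^+ (K a) != 0 by rewrite expf_neq0.
  by rewrite /g xD ?in_monoidMn // xMn // mulfK.
have g0 : g 0 = 1 by rewrite g_mon ?on_face0 ?in_monoid0.
have gn0 a : on_face D a -> g a != 0.
  move=> aD; apply/eqP => ga; have := gD a (- a) aD; rewrite on_faceN => /(_ aD).
  by rewrite subrr g0 ga mul0r => /eqP; rewrite oner_eq0.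
have gMn a n : on_face D a -> g (a *+ n) = g a ^+ n.
  move=> aD; elim: n => [|n IH]; first by rewrite mulr0n g0.
  by rewrite mulrS exprS gD ?IH // on_faceMn.
have gN a : on_face D a -> g (- a) = (g a)^-1.
  move=> aD; apply: (mulfI (gn0 _ aD)); rewrite -gD ?on_faceN // subrr g0 divff // gn0 //.
have gZ a (n : int) : on_face D a -> on_face D (n *: a) /\ g (n *: a) = g a ^ n.
  have sc k : Posz k *: a = a *+ k by rewrite -scaler_nat natz.
  move=> aD; case: n => n; first by rewrite sc on_faceMn // gMn.
  by rewrite NegzE scaleNr sc on_faceN on_faceMn // gN ?on_faceMn // gMn.
pose z : {ffun 'I_d -> F} := [ffun i : 'I_d => if (i < #|D|)%N then 1 else g (row i (invmx (L D)))].
have zT : z \in torus F d.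
  apply/torusP => i; rewrite ffunE; case: ltnP => hi; first exact: oner_neq0.
  by rewrite gn0 // face_vector.
exists D, z; split=> //.
  by rewrite /normalized zT; apply/forallP => i; apply/implyP => hi; rewrite ffunE hi.
apply/funext => a; rewrite /orbit_point; case: ifPn => aC; last first.
  by case: xC => _ _; apply => /(dual_monoid_cone a CF); exact/negP.
rewrite /orbit_coord; case: ifPn => aD; last by apply/eqP; move: aD; rewrite -hD // negbK.
rewrite -g_mon //.
have {1}-> : a = \sum_i (a *m L D) 0 i *: row i (invmx (L D)).
  by rewrite -mulmx_sum_row mulmxK // L_unit.
rewrite /torus_monomial.
have ind : on_face D (\sum_i (a *m L D) 0 i *: row i (invmx (L D))) /\
   g (\sum_i (a *m L D) 0 i *: row i (invmx (L D))) = \prod_i z i ^ (a *m L D) 0 i.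
  apply: (big_ind2 (fun v w => on_face D v /\ g v = w)) => [|v w v' w' [hv <-] [hv' <-]|i _].
  - by rewrite on_face0 g0.
  - by rewrite on_faceD // gD.
  rewrite ffunE; case: ltnP => hi.
    have -> : (a *m L D) 0 i = 0 by apply: (iffLR (L_face _ DF)) hi.
    by rewrite scale0r on_face0 g0 expr0z.
  by apply: gZ; apply: face_vector.
by case: ind.
Qed.

End NormalForm.

(** The cones of [C] and [C'] meet in the cone of their intersection, and the
    normal form of a point in the chart of this intersection is also that of its
    images in the two charts. *)
Lemma glued_orbit_points C C' D D' z z' : C \in Fam -> C' \in Fam ->
  D \subset C -> D' \subset C' -> normalized D z -> normalized D' z' ->
  glued (cone_of C, orbit_point C D z) (cone_of C', orbit_point C' D' z') <->
  D = D' /\ z = z'.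
Proof.
move=> CF C'F DC D'C' nz nz'; split=> [[y]|[eD ez]] /=.
  have IF : (C :&: C')%SET \in Fam by apply: Fam_sub CF; apply: subsetIl.
  rewrite coneI // => /(normal_form IF)[D'' [z'' [D''I nz'' ->]]] [y1 y2].
  have sub (C0 D0 : {set I}) z0 : C0 \in Fam -> (C :&: C')%SET \subset C0 -> D0 \subset C0 ->
      normalized D0 z0 ->
      (forall a, dual_monoid (cone_of C0) a -> orbit_point (C :&: C')%SET D'' z'' a = orbit_point C0 D0 z0 a) ->
      D0 = D'' /\ z0 = z''.
    move=> C0F I0 D00 nz0 e; apply: (orbit_point_inj C0F D00 _ nz0 nz'').
      exact: fintype.subset_trans D''I I0.
    move=> a; have [aC|aC] := boolP (in_monoid C0 a); last first.
      by rewrite /orbit_point !ifN.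
    rewrite -e; last exact/(dual_monoid_cone _ C0F).
    by rewrite /orbit_point aC (in_monoidS I0 aC).
  have [-> ->] := sub C D z CF (subsetIl _ _) DC nz y1.
  by have [-> ->] := sub C' D' z' C'F (subsetIr _ _) D'C' nz' y2.
subst D' z'; have IF : (C :&: C')%SET \in Fam by apply: Fam_sub CF; apply: subsetIl.
have /andP[zT _] := nz.
exists (orbit_point (C :&: C')%SET D z) => /=.
  by rewrite coneI //; apply: orbit_point_chart => //; rewrite subsetI DC.
split=> a.
  by move=> /(dual_monoid_cone _ CF) ha; rewrite /orbit_point ha (in_monoidS (subsetIl _ _) ha).
by move=> /(dual_monoid_cone _ C'F) ha; rewrite /orbit_point ha (in_monoidS (subsetIr _ _) ha).
Qed.

Definition fan_cones : set (set 'rV[R]_d) := [set cone_of C | C in [set C | C \in Fam]].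

Lemma toric_point_orbit C D z : C \in Fam -> D \subset C -> normalized D z ->
  toric_point fan_cones (cone_of C, orbit_point C D z) =
  toric_point fan_cones (cone_of D, orbit_point D D z).
Proof.
move=> CF DC nz; have DF := Fam_sub DC CF.
apply/predeqP => -[p1 p2]; split=> -[[/= [C' C'F <-] ch] gl];
  have [D' [z' [D'C' nz' ep]]] := normal_form C'F ch; split;
  try by split => //=; exists C'.
all: subst p2; move: gl => /glued_orbit_points h; apply/glued_orbit_points => //;
  exact: h.
Qed.

(** Classes of points under gluing correspond to normal forms. *)
Lemma card_toric_points (Q : set (set 'rV[R]_d * ('rV[int]_d -> F)))
    (E : {set I} -> {ffun 'I_d -> F} -> bool) :
  (forall pt, Q pt -> chart pt.1 pt.2) ->
  (forall C D z, C \in Fam -> D \subset C -> normalized D z ->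
     Q (cone_of C, orbit_point C D z) <-> E D z) ->
  ([set toric_point fan_cones pt | pt in [set pt | fan_cones pt.1 /\ Q pt]] #=
    `I_#|[set Dz : {set I} * {ffun 'I_d -> F} |
        [&& Dz.1 \in Fam, normalized Dz.1 Dz.2 & E Dz.1 Dz.2]]%SET|)%card.
Proof.
move=> Qchart QE; set S := [set Dz : {set I} * _ | _]%SET.
pose rep (Dz : {set I} * {ffun 'I_d -> F}) :=
  toric_point fan_cones (cone_of Dz.1, orbit_point Dz.1 Dz.1 Dz.2).
have inS Dz : (Dz \in [fset x | x in S]%fset) = (Dz \in S).
  by apply/imfsetP/idP => [[x xS ->]|h] //; exists Dz.
have -> : [set toric_point fan_cones pt | pt in [set pt | fan_cones pt.1 /\ Q pt]] =
    rep @` [set` [fset x | x in S]%fset].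
  apply/predeqP => X; split=> [[[p1 x] [/= [C CF <-] Qp] <-]|[[D z] /=]].
    have [D [z [DC nz ex]]] := normal_form CF (Qchart _ Qp).
    rewrite /= in ex; subst x.
    exists (D, z); last by rewrite /rep /= -(toric_point_orbit CF DC nz).
    rewrite /= inS inE /= nz (Fam_sub DC CF) /=.

    exact/(QE _ _ _ CF DC nz).
  rewrite inS inE /= => /and3P[DF nz ED] <-.
  exists (cone_of D, orbit_point D D z) => //=; split; first by exists D.
  exact/(QE _ _ _ DF (fintype.subxx _) nz).
apply: (card_eq_trans (inj_card_eq _)).
  move=> [D z] [D' z'] /set_mem /=; rewrite inS inE /= => /and3P[DF nz _].
  move=> /set_mem /=; rewrite inS inE /= => /and3P[D'F nz' _] e.
  have zT := proj1 (andP nz).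
  have [_] : rep (D', z') (cone_of D, orbit_point D D z).
    rewrite -e; split; last exact/glued_orbit_points.
    by split => /=; [exists D|exact: orbit_point_chart].
  by move=> /(glued_orbit_points _ _ _ _ nz' nz)[] // -> ->.
apply/card_eq_fsetP; rewrite card_imfset //= -cardE.
by apply: eq_card.
Qed.

End SimplicialFan.

(** * The closure of the hypersurface in a chart *)

Section LaurentProducts.
Variables (F : finFieldType) (d n : nat) (m : 'M[int]_(d, n)) (u : 'I_n -> F).
Hypothesis hm : injective (exponent m).
Hypothesis u0 : forall j, u j != 0.
Local Notation f := (laurent_of m u).
Implicit Types (g : laurent F d) (a c : 'rV[int]_d).

Lemma laurent_of_exponent k : f (exponent m k) = u k.
Proof.
rewrite fsfunE ifT; last by apply/imfsetP; exists k.
by rewrite (bigD1 k) //= big1 ?addr0 // => j /andP[/eqP/hm -> /eqP].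
Qed.

Lemma mem_finsupp_laurent_of a : (a \in finsupp f) = [exists k, a == exponent m k].
Proof.
apply/idP/existsP => [|[k /eqP ->]]; last by rewrite mem_finsupp laurent_of_exponent u0.
rewrite mem_finsupp fsfunE; case: ifP => [/imfsetP[k _ ->] _|_]; last by rewrite eqxx.
by exists k.
Qed.

Lemma sum_finsupp_laurent_of (V : nmodType) (G : 'rV[int]_d -> V) :
  \sum_(a <- finsupp f) G a = \sum_k G (exponent m k).
Proof.
rewrite (perm_big [seq exponent m k | k <- enum 'I_n]) /=.
  by rewrite big_map big_enum.
apply: uniq_perm; first exact: fset_uniq.
  by rewrite map_inj_uniq ?enum_uniq.
move=> a; rewrite mem_finsupp_laurent_of; apply/existsP/mapP => [[k /eqP ->]|[k _ ->]].
  by exists k; rewrite // mem_enum.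
by exists k.
Qed.

Lemma laurent_mulE g c : laurent_mul f g c = \sum_k u k * g (c - exponent m k).
Proof.
have E : \sum_(a <- finsupp f) f a * g (c - a) = \sum_k u k * g (c - exponent m k).
  by rewrite sum_finsupp_laurent_of; apply: eq_bigr => k _; rewrite laurent_of_exponent.
rewrite fsfunE; case: ifPn => [_|hc]; first exact: E.
rewrite big1 // => k _; apply/eqP; rewrite mulf_eq0 (negbTE (u0 k)) /=; apply/negPn/negP => gk.
case/negP: hc; apply/imfset2P; exists (exponent m k).
  by rewrite /= mem_finsupp_laurent_of; apply/existsP; exists k.
exists (c - exponent m k); first by rewrite /= mem_finsupp.
by rewrite addrC subrK.
Qed.

Lemma mem_finsupp_mul g c : c \in finsupp (laurent_mul f g) ->
  exists k, c - exponent m k \in finsupp g.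
Proof.
rewrite mem_finsupp laurent_mulE => h.
have /existsP[k hk] : [exists k, g (c - exponent m k) != 0].
  apply: contra_neqT h => /existsPn h; apply: big1 => k _.
  by have := h k; rewrite negbK => /eqP ->; rewrite mulr0.
by exists k; rewrite mem_finsupp.
Qed.

Local Notation sqn a := (idot a a).

(** Initial forms multiply. Among the pairs formed by an exponent of [f] and an
    exponent of [g] on which the linear form [beta] is minimal, choose one whose sum
    is farthest from the origin: no other pair has the same sum, so that this sum is
    an exponent of the product. *)
Lemma product_initial_exponent g (beta : 'rV[int]_d) :
  (forall c, c \in finsupp (laurent_mul f g) -> 0 <= idot c beta) ->
  forall k b, b \in finsupp g -> 0 <= idot (exponent m k + b) beta.
Proof.
move=> hpos k b bg; pose T := ('I_n * finsupp g)%type.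
pose s (x : T) := exponent m x.1 + val x.2.
pose v (x : T) := idot (s x) beta.
pose x0 : T := (k, [` bg]%fset).
have [x1 _ x1min] := @Order.TotalTheory.arg_minP _ _ T x0 xpredT v isT.
have [x2 /eqP x2v x2max] :=
  @Order.TotalTheory.arg_maxP _ _ T x1 (fun x => v x == v x1) (fun x => sqn (s x)) (eqxx _).
have x2min x : v x2 <= v x by rewrite x2v x1min.
apply: le_trans (x2min x0); apply: hpos.
rewrite mem_finsupp laurent_mulE (bigD1 x2.1) //= big1 ?addr0.
  by rewrite /s addrC addKr mulf_neq0 // -mem_finsupp; case: x2 {x2v x2max x2min} => ? [].
move=> j jx2; apply/eqP; rewrite mulf_eq0 (negbTE (u0 _)) /=; apply/negPn/negP => gj.
(* A second pair with the same sum would give, after an exchange of components,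
   two pairs with sums symmetric about that of [x2]. *)
have hb : s x2 - exponent m j \in finsupp g by rewrite mem_finsupp.
pose y1 : T := (x2.1, [` hb]%fset); pose y2 : T := (j, x2.2).
set e := exponent m x2.1 - exponent m j.
have sy1 : s y1 = s x2 + e.
  by rewrite /s /e /= addrCA.
have sy2 : s y2 = s x2 - e.
  by rewrite /s /e /= opprB [RHS]addrC addrA subrK.
have vy1 : v y1 = v x2 + idot e beta by rewrite /v sy1 idotD.
have vy2 : v y2 = v x2 - idot e beta by rewrite /v sy2 idotD idotN.
have e0 : idot e beta = 0.
  have h1 := x2min y1; have h2 := x2min y2.
  rewrite vy1 lerDl in h1; rewrite vy2 lerDl oppr_ge0 in h2.
  by apply/eqP; rewrite eq_le h1 h2.
have m1 := x2max y1; have m2 := x2max y2.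
rewrite vy1 e0 addr0 x2v eqxx in m1; rewrite vy2 e0 subr0 x2v eqxx in m2.
have idotC (a c : 'rV[int]_d) : idot a c = idot c a by apply: eq_bigr => i _; rewrite mulrC.
have idotDr (x y z : 'rV[int]_d) : idot x (y + z) = idot x y + idot x z.
  by rewrite idotC idotD !(idotC _ x).
have idotNr (x y : 'rV[int]_d) : idot x (- y) = - idot x y.
  by rewrite idotC idotN (idotC _ x).
have sqnD (x z : 'rV[int]_d) : sqn (x + z) = sqn x + idot x z *+ 2 + sqn z.
  by rewrite idotD !idotDr (idotC z x); ring.
have n1 : sqn (s y1) = sqn (s x2) + idot (s x2) e *+ 2 + sqn e by rewrite sy1 sqnD.
have n2 : sqn (s y2) = sqn (s x2) - idot (s x2) e *+ 2 + sqn e.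
  by rewrite sy2 sqnD idotN !idotNr opprK mulNrn.
have := m1 isT; have := m2 isT; rewrite n1 n2 => h1 h2.
have : sqn e = 0.
  have : 0 <= sqn e by apply: sumr_ge0 => i _; rewrite -expr2 sqr_ge0.
  lia.
move/eqP; rewrite psumr_eq0 => [/allP h|i _]; last by rewrite -expr2 sqr_ge0.
case/eqP: jx2; apply: hm; apply/matrixP => i0 i; rewrite ord1.
have := h i (mem_index_enum _); rewrite mulf_eq0 orbb /e !mxE subr_eq0 => /eqP //.
Qed.

(** Both [x^(- m_k0) f] and [x^(m_k0) g] are regular on the chart, where
    evaluation is multiplicative. *)
Lemma chart_eval_mul g (x : 'rV[int]_d -> F) (P : pred 'rV[int]_d) (k0 : 'I_n) :
  (forall a b, P a -> P b -> x (a + b) = x a * x b) ->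
  (forall k, P (exponent m k - exponent m k0)) ->
  (forall b, b \in finsupp g -> P (exponent m k0 + b)) ->
  chart_eval x (laurent_mul f g) =
  (\sum_k u k * x (exponent m k - exponent m k0)) *
  (\sum_(b <- finsupp g) g b * x (exponent m k0 + b)).
Proof.
move=> xD Pm Pg.
pose X := [fset (exponent m kb.1 + kb.2)%R | kb in
  [seq (k, b) | k <- enum 'I_n, b <- finsupp g]]%fset.
have XP k b : b \in finsupp g -> exponent m k + b \in X.
  move=> bg; apply/imfsetP; exists (k, b) => //=.
  by apply/allpairsP; exists (k, b); rewrite mem_enum.
have suppX : (finsupp (laurent_mul f g) `<=` X)%fset.
  apply/fsubsetP => c /mem_finsupp_mul[k hk].
  by rewrite -(subrK (exponent m k) c) addrC XP.
rewrite /chart_eval (big_fset_incl _ suppX); last first.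
  by move=> c _; rewrite memNfinsupp => /eqP ->; rewrite mul0r.
transitivity (\sum_k \sum_(c <- X) u k * g (c - exponent m k) * x c).
  rewrite exchange_big /=; apply: eq_bigr => c _.
  by rewrite laurent_mulE mulr_suml.
rewrite mulr_suml; apply: eq_bigr => k _.
pose Y := [fset (exponent m k + b)%R | b in finsupp g]%fset.
have YX : (Y `<=` X)%fset by apply/fsubsetP => c /imfsetP[b /= bg ->]; exact: XP.
rewrite -(big_fset_incl _ YX); last first.
  move=> c _ cY; have [-> |gc] := eqVneq (g (c - exponent m k)) 0; first by rewrite mulr0 mul0r.
  case/negP: cY; apply/imfsetP; exists (c - exponent m k); first by rewrite /= mem_finsupp.
  by rewrite addrC subrK.
rewrite big_imfset /=; last by move=> a b _ _ /addrI.
rewrite mulr_sumr big_seq [RHS]big_seq; apply: eq_bigr => b bg.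
have -> : x (exponent m k + b) = x (exponent m k - exponent m k0) * x (exponent m k0 + b).
  by rewrite -xD ?Pm ?Pg // addrA subrK.
have -> : exponent m k + b - exponent m k = b by rewrite addrC addKr.
by ring.
Qed.

End LaurentProducts.

Section ClosureInChart.
Variables (R : realType) (F : finFieldType) (d n : nat) (I : finType).
Variables (m : 'M[int]_(d, n)) (u : 'I_n -> F).
Hypothesis hm : injective (exponent m).
Hypothesis u0 : forall j, u j != 0.
Variables (alpha : I -> 'rV[R]_d) (beta : I -> 'rV[int]_d) (N : int).
Variable Fam : {set {set I}}.
Hypothesis N_gt0 : 0 < N.
Hypothesis Fam_sub : forall C D : {set I}, D \subset C -> C \in Fam -> D \in Fam.
Hypothesis betaE : forall (C : {set I}) p, C \in Fam -> p \in C ->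
  N%:~R *: alpha p = map_mx intr (beta p).
Variable L : {set I} -> 'M[int]_d.
Variable supp : {set I} -> {set 'I_n}.
Hypothesis supp_mono : forall C D : {set I}, D \subset C -> supp D \subset supp C.
Hypothesis supp_proper : forall C : {set I}, C \in Fam -> exists k, k \notin supp C.
Hypothesis supp_monoid : forall (C : {set I}) k k0, C \in Fam -> k0 \notin supp C ->
  in_monoid beta C (exponent m k - exponent m k0).
Hypothesis supp_face : forall (C : {set I}) k k0, C \in Fam -> k0 \notin supp C ->
  on_face beta C (exponent m k - exponent m k0) = (k \notin supp C).

Implicit Types (C D : {set I}) (z : {ffun 'I_d -> F}) (k : 'I_n).

Definition face_equation D z (k0 : 'I_n) : F :=
  \sum_(k in ~: supp D) u k * torus_monomial z ((((exponent m k - exponent m k0) *m L D) : 'rV[int]_d) 0).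

Lemma sum_orbit_point C D z k0 : C \in Fam -> D \subset C -> k0 \notin supp C ->
  \sum_k u k * orbit_point beta L C D z (exponent m k - exponent m k0) = face_equation D z k0.
Proof.
move=> CF DC k0C; rewrite /face_equation [RHS]big_mkcond; apply: eq_bigr => k _.
rewrite /orbit_point supp_monoid // /orbit_coord supp_face ?(Fam_sub DC) //.
  by rewrite inE; case: ifP; rewrite ?mulr0.
by apply: contra k0C; apply: (fintype.subsetP (supp_mono DC)).
Qed.

Lemma face_equation_shift D z k0 k1 : z \in torus F d -> 
  face_equation D z k1 =
  torus_monomial z ((((exponent m k0 - exponent m k1) *m L D) : 'rV[int]_d) 0) * face_equation D z k0.
Proof.
move=> zT; rewrite mulr_sumr; apply: eq_bigr => k _; rewrite mulrCA; congr (_ * _).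
rewrite -torus_monomialD //; apply: torus_monomial_eq => i.
have -> : exponent m k - exponent m k1 =
    (exponent m k0 - exponent m k1) + (exponent m k - exponent m k0).
  by rewrite [RHS]addrC addrA subrK.
by rewrite mulmxDl mxE.
Qed.

(** By [face_equation_shift] the equation for one [k0] implies it for all. *)
Definition face_zero D z := [forall k0, (k0 \notin supp D) ==> (face_equation D z k0 == 0)].

Lemma face_zeroE D z k0 : z \in torus F d -> k0 \notin supp D ->
  face_zero D z = (face_equation D z k0 == 0).
Proof.
move=> zT k0D; apply/forallP/eqP => [/(_ k0)|h k1]; first by rewrite k0D => /eqP.
by apply/implyP => k1D; rewrite (face_equation_shift _ k0) // h mulr0.
Qed.

(** By [product_initial_exponent], if [f g] is regular on the chart of [C] then so
    is [x^(m_k0) g], for [k0] outside the support of [C]: the ideal of the closure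
    is generated by [x^(- m_k0) f]. On the orbit of [D] only the monomials outside
    the support of [D] remain. *)
Lemma chart_closure_orbit C D z : C \in Fam -> D \subset C -> normalized D z ->
  chart_closure (laurent_of m u) (cone_of alpha C) (orbit_point beta L C D z) <-> face_zero D z.
Proof.
move=> CF DC /andP[zT _].
have xch := orbit_point_chart N_gt0 betaE L CF DC zT.
have [k0 k0C] := supp_proper CF.
have k0D : k0 \notin supp D by apply: contra k0C; apply: (fintype.subsetP (supp_mono DC)).
have xD a b : in_monoid beta C a -> in_monoid beta C b ->
    orbit_point beta L C D z (a + b) = orbit_point beta L C D z a * orbit_point beta L C D z b.
  case: xch => _ h _ /(dual_monoid_cone N_gt0 betaE _ CF) ha /(dual_monoid_cone N_gt0 betaE _ CF) hb.
  exact: h.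
have x0 : orbit_point beta L C D z 0 = 1 by case: xch.
rewrite (face_zeroE zT k0D) -(sum_orbit_point z CF DC k0C); split=> [[_ h]|/eqP h].
  pose g : laurent F d := [fsfun a in [fset (- exponent m k0)%R]%fset => 1].
  have gE a : g a = (a == - exponent m k0)%:R by rewrite fsfunE in_fset1; case: eqP.
  have gs b : b \in finsupp g -> b = - exponent m k0.
    by rewrite mem_finsupp gE; have [//|_] := eqVneq b (- exponent m k0); rewrite eqxx.
  have := h g; rewrite (chart_eval_mul hm u0 xD (fun k => supp_monoid k CF k0C)); last first.
    by move=> b /gs ->; rewrite subrr in_monoid0.
  have -> : \sum_(b <- finsupp g) g b * orbit_point beta L C D z (exponent m k0 + b) = 1.
    have sub : (finsupp g `<=` [fset (- exponent m k0)%R])%fset.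
      by apply/fsubsetP => b /gs ->; exact: fset11.
    rewrite (big_fset_incl _ sub); last by move=> b _; rewrite memNfinsupp => /eqP ->; rewrite mul0r.
    by rewrite big_seq_fset1 gE eqxx mul1r subrr.
  rewrite mulr1 => -> // a /(mem_finsupp_mul hm u0)[k /gs ea].
  apply/(dual_monoid_cone N_gt0 betaE _ CF).
  have -> : a = exponent m k - exponent m k0 by rewrite -ea addrC subrK.
  exact: supp_monoid.
split=> // g hg.
rewrite (chart_eval_mul hm u0 xD (fun k => supp_monoid k CF k0C)) ?h ?mul0r //.
move=> b bg; apply/in_monoidP => p pC; apply: (product_initial_exponent hm u0) bg => c cs.
by have /(dual_monoid_cone N_gt0 betaE _ CF)/in_monoidP := hg c cs; apply.
Qed.

End ClosureInChart.

(** * Counting the points of an orbit *)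

Section UnimodularSubstitution.
Variables (F : finFieldType) (d : nat) (L : 'M[int]_d).
Implicit Types z : {ffun 'I_d -> F}.

Definition torus_map z : {ffun 'I_d -> F} := [ffun i => torus_monomial z (L i)].

Lemma torus_map_torus z : z \in torus F d -> torus_map z \in torus F d.
Proof. by move=> zT; apply/torusP => i; rewrite ffunE torus_monomial_neq0. Qed.

Lemma torus_monomial_map z (a : 'rV[int]_d) : z \in torus F d ->
  torus_monomial (torus_map z) (a 0) = torus_monomial z ((a *m L) 0).
Proof.
move=> /torusP z0; rewrite /torus_monomial.
transitivity (\prod_i \prod_j z j ^ (a 0 i * L i j)).
  apply: eq_bigr => i _; rewrite ffunE /torus_monomial.
  have E (n : int) : (\prod_j z j ^ L i j) ^ n = \prod_j (z j ^ L i j) ^ n.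
    apply: (big_morph (fun x : F => x ^ n)) => [x y|]; last exact: exp1rz.
    exact: expfzMl.
  by rewrite E; apply: eq_bigr => j _; rewrite exprz_exp mulrC.
rewrite exchange_big; apply: eq_bigr => j _.
rewrite mxE; apply/esym; apply: (big_ind2 (fun (n : int) x => z j ^ n = x)) => [|n x n' x' <- <-|i _] //.
by rewrite expfzDr.
Qed.

End UnimodularSubstitution.

Lemma torus_map_bij (F : finFieldType) d (L : 'M[int]_d) : L \in unitmx ->
  forall z : {ffun 'I_d -> F}, z \in torus F d -> torus_map (invmx L) (torus_map L z) = z.
Proof.
move=> uL z zT; apply/ffunP => i; rewrite ffunE.
transitivity (torus_monomial (torus_map L z) ((row i (invmx L)) 0)).
  by apply: torus_monomial_eq => j; rewrite mxE.
rewrite torus_monomial_map // -row_mul mulVmx //.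
rewrite /torus_monomial (bigD1 i) //= !mxE eqxx expr1z big1 ?mulr1 // => j ji.
by rewrite !mxE eq_sym (negbTE ji) expr0z.
Qed.

(** An orbit is a quotient of the torus; this compares the number of solutions
    in the two, the equation being pulled back from the quotient. *)
Lemma card_torus_fibres (F : finFieldType) d n (P : pred {ffun 'I_d -> F}) : (n <= d)%N ->
  (forall z z' : {ffun 'I_d -> F}, (forall i : 'I_d, (n <= i)%N -> z i = z' i) -> P z = P z') ->
  #|[set z in torus F d | P z]%SET| =
  (#|[set z in torus F d | [forall i : 'I_d, (i < n)%N ==> (z i == 1%R)] && P z]%SET| * #|F|.-1 ^ n)%N.
Proof.
move=> nd Pext.
pose norm (z : {ffun 'I_d -> F}) : {ffun 'I_d -> F} := [ffun i : 'I_d => if (i < n)%N then 1 else z i].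
rewrite -sum1_card (partition_big norm
  (mem [set z in torus F d | [forall i : 'I_d, (i < n)%N ==> (z i == 1)] && P z]%SET)) /=; last first.
  move=> z; rewrite !inE => /andP[/forallP z0 Pz]; apply/and3P; split.
  - by apply/forallP => i; rewrite ffunE; case: ifP => // _; rewrite oner_neq0.
  - by apply/forallP => i; apply/implyP => hi; rewrite ffunE hi.
  by rewrite (Pext _ z) // => i hi; rewrite ffunE ltnNge hi.
rewrite -sum_nat_const; apply: eq_bigr => y; rewrite !inE => /and3P[/forallP y0 /forallP y1 Py].
pose Q (i : 'I_d) : pred F := fun x => if (i < n)%N then x != 0 else x == y i.
transitivity #|family Q|.
  rewrite sum1dep_card -[RHS]cardsE; apply: eq_card => z; rewrite !inE.
  apply/andP/familyP => [[/andP[/forallP z0 _] /eqP ez] i|hz].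
    by rewrite unfold_in /Q; case: ifP => hi //; rewrite -ez ffunE hi.
  have nz : norm z = y.
    apply/ffunP => i; rewrite ffunE; have := hz i; rewrite unfold_in /Q.
    by case: ifP => [hi _|_ /eqP //]; have := y1 i; rewrite hi /= => /eqP.
  split; last by rewrite nz.
  apply/andP; split.
    apply/forallP => i; have := hz i; rewrite unfold_in /Q.
    by case: ifP => // _ /eqP ->.
  by rewrite (Pext z y) // => i hi; rewrite -nz ffunE ltnNge hi.
rewrite card_family foldrE big_image /=.
transitivity (\prod_(i < d) (if (i < n)%N then #|F|.-1 else 1%N)).
  apply: eq_bigr => i _; rewrite /Q; case: ifP => hi; last first.
    by rewrite -(card1 (y i)); apply: eq_card.
  by rewrite -(cardC1 (0 : F)); apply: eq_card.
by rewrite -big_mkcond -(big_ord_widen d (fun=> #|F|.-1) nd) prod_nat_const card_ord.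
Qed.

Section CountNormalForms.
Variables (F : finFieldType) (d n : nat) (I : finType).
Variables (m : 'M[int]_(d, n)) (u : 'I_n -> F) (beta : I -> 'rV[int]_d).
Variables (L : {set I} -> 'M[int]_d) (supp : {set I} -> {set 'I_n}) (D : {set I}).
Hypothesis L_unit : L D \in unitmx.
Hypothesis card_D : (#|D| <= d)%N.
Hypothesis L_face : forall a,
  on_face beta D a -> (forall i : 'I_d, (i < #|D|)%N -> (a *m L D) 0 i = 0).
Variable k0 : 'I_n.
Hypothesis k0D : k0 \notin supp D.
Hypothesis supp_face : forall k, k \notin supp D -> on_face beta D (exponent m k - exponent m k0).

(** In the coordinates given by [L D] the face polynomial does not involve the
    first [#|D|] variables, up to a monomial factor. *)
Lemma card_normal_forms :
  (#|[set z : {ffun 'I_d -> F} | normalized D z && face_zero m u L supp D z]%SET| * #|F|.-1 ^ #|D|)%N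
  = #|zeros_on m u (~: supp D)|.
Proof.
have -> : [set z : {ffun 'I_d -> F} | normalized D z && face_zero m u L supp D z]%SET =
   [set z in torus F d | [forall i : 'I_d, (i < #|D|)%N ==> (z i == 1)] &&
      (face_equation m u L supp D z k0 == 0)]%SET.
  apply/setP => z; rewrite inE [RHS]inE /normalized -andbA; case: (boolP (z \in torus F d)) => //= zT.
  by rewrite (face_zeroE m u L zT k0D).
rewrite -card_torus_fibres //; last first.
  move=> z z' e; congr (_ == 0); apply: eq_bigr => k; rewrite inE => kD; congr (_ * _).
  apply: eq_bigr => i _; have [hi|hi] := ltnP i #|D|; last by rewrite e.
  by rewrite L_face ?supp_face // !expr0z.
have E z : z \in torus F d ->
   (torus_map (L D) z \in zeros_on m u (~: supp D)) = (face_equation m u L supp D z k0 == 0).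
  move=> zT; rewrite inE torus_map_torus //=.
  have m0 : torus_monomial z ((exponent m k0 *m L D) 0) != 0 by apply: torus_monomial_neq0.
  have -> : \sum_(j in ~: supp D) u j * torus_monomial (torus_map (L D) z) (m^~ j) =
     torus_monomial z ((exponent m k0 *m L D) 0) * face_equation m u L supp D z k0.
    rewrite mulr_sumr; apply: eq_bigr => j _; rewrite mulrCA; congr (_ * _).
    rewrite -torus_monomialD // (torus_monomial_eq _ (g := (exponent m j) 0)); last first.
      by move=> i; rewrite mxE.
    rewrite torus_monomial_map //; apply: torus_monomial_eq => i.
    by rewrite mulmxBl [X in _ = _ + X]mxE [X in _ = _ + (_ + X)]mxE addrC subrK.
  by rewrite mulf_eq0 (negbTE m0).
rewrite -(card_in_imset (f := torus_map (L D))).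
  apply: eq_card => t; apply/imsetP/idP => [[z + ->]|tz].
    by rewrite inE => /andP[zT ez]; rewrite E.
  have tT : t \in torus F d by move: tz; rewrite inE => /andP[].
  have tK : torus_map (L D) (torus_map (invmx (L D)) t) = t.
    by rewrite -{1}(invmxK (L D)) torus_map_bij // unitmx_inv.
  exists (torus_map (invmx (L D)) t) => //.
  by rewrite inE torus_map_torus //= -E ?torus_map_torus // tK.
move=> z z'; rewrite !inE => /andP[zT _] /andP[z'T _] e.
have inT (w : {ffun 'I_d -> F}) : [forall i, w i != 0] -> w \in torus F d by rewrite inE.
by rewrite -(torus_map_bij L_unit (inT _ zT)) e torus_map_bij // inT.
Qed.

End CountNormalForms.

(** * The refined fan *)

Section RefinedFan.
Variables (R : realType) (d r : nat) (m : 'M[int]_(d, d.+2)) (gamma : 'I_d.+2 -> int).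
Hypothesis hneg : forall j : 'I_d.+2, (j < r)%N -> gamma j < 0.
Hypothesis hpos : forall j : 'I_d.+2, (r <= j)%N -> 0 < gamma j.
Variables (alpha0 : 'I_d.+2 -> 'I_d.+2 -> R) (alpha : 'I_d.+2 -> 'I_d.+2 -> 'rV[R]_d).
Hypothesis halpha : are_inward_normals r m gamma alpha0 alpha.
Local Notation ray := ('I_d.+2 * 'I_d.+2)%type.
Implicit Types (C D : {set ray}) (p : ray) (k : 'I_d.+2).

Definition proper_chains : {set {set ray}} := [set C | proper_chain r C]%SET.
Definition ray_vector p : 'rV[R]_d := alpha p.1 p.2.

Lemma supportS C D : D \subset C -> support D \subset support C.
Proof. by move=> DC; rewrite /support finset.setUSS ?imsetS. Qed.

Lemma chainsS C D (A B : {set 'I_d.+2}) : D \subset C -> C \in chains A B -> D \in chains A B.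
Proof.
move=> DC; rewrite !inE => /andP[sC cC].
by rewrite (fintype.subset_trans DC sC) (chain_setS DC cC).
Qed.

Lemma proper_chains_sub C D : D \subset C -> C \in proper_chains -> D \in proper_chains.
Proof.
move=> DC; rewrite !inE => /andP[cC sC]; rewrite /proper_chain (chainsS DC cC) /=.
apply: contra sC => /eqP sD; rewrite -subTset -sD; exact: supportS.
Qed.

Lemma le_pair_trans : transitive (@le_pair d.+2).
Proof. by move=> p2 p1 p3; rewrite /le_pair /=; lia. Qed.

(** A sorted sequence without repetition is determined by the set of its terms. *)
Lemma refined_fanE : refined_fan r alpha = fan_cones ray_vector proper_chains.
Proof.
have key (s : seq ray) (C : {set ray}) : uniq s -> s =i C ->
    chain_cone alpha s = cone_of ray_vector C /\ chain_support s = support C.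
  move=> us sC; split.
    have E (a : ray -> R) : \sum_(p <- s) a p *: alpha p.1 p.2 = \sum_(p in C) a p *: ray_vector p.
      by rewrite big_uniq //; apply: eq_bigl => p; rewrite sC.
    by apply/predeqP => v; split=> -[a a0 ->]; exists a.
  apply/setP => k; rewrite !inE; apply/hasP/orP => [[p ps /orP[]/eqP ->]|[]/imsetP[p pC ->]].
  - by left; rewrite imset_f // -sC.
  - by right; rewrite imset_f // -sC.
  - by exists p; rewrite ?sC //= eqxx.
  - by exists p; rewrite ?sC //= eqxx orbT.
apply/predeqP => X; split=> [[s [/and3P[us /allP ps ss] sup] <-]|[C CF <-]].
  have [-> es] := key s [set p in s]%SET us (fun p => esym (in_set _ _)).
  exists [set p in s]%SET => //; rewrite /= inE /proper_chain -es sup andbT inE.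
  apply/andP; split.
    by apply/fintype.subsetP => p; rewrite !inE => /ps.
  apply/chain_setP => p p'; rewrite !inE => hp hp'.
  have h := sorted_leq_nth le_pair_trans _ p ss.
  have refl : reflexive (@le_pair d.+2) by move=> z; rewrite /le_pair /= !leqnn.
  have := h refl (index p s) (index p' s); have := h refl (index p' s) (index p s).
  rewrite !inE !index_mem hp hp' !nth_index // => /(_ isT isT) h1 /(_ isT isT) h2.
  by case: (leqP (index p s) (index p' s)) => [/h2 ->|/ltnW /h1 ->]; rewrite ?orbT.
move: CF; rewrite /= inE => /andP[cC sC].
pose s := sort (@le_pair d.+2) (enum C).
have us : uniq s by rewrite sort_uniq enum_uniq.
have sE : s =i C by move=> p; rewrite mem_sort mem_enum.
have [e1 e2] := key s C us sE.
exists s => //; split; last by rewrite e2.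
apply/and3P; split=> //.
  by apply/allP => p; rewrite sE => /(proper_chain_ray cC).
apply: (sort_sorted_in (P := mem C)); last by apply/allP => p; rewrite mem_enum.
move=> p p' pC p'C; move: cC; rewrite inE => /andP[_ /chain_setP h]; exact: h.
Qed.

Variables (fb : 'M[int]_(d, d.+2)) (c : 'M[int]_d) (b : 'cV[int]_d).
Hypothesis hc : m = c *m fb + b *m const_mx 1.
Variable rho : 'M[int]_(d, d.+2).
Hypothesis hrho : is_dual_family fb rho.

(** Cramer's rule for the equation of [ray_vector_c]; the additional factor
    [\det c] makes the proportionality factor between ray and integer vector
    positive. *)
Definition scaled_ray p : 'rV[int]_d :=
  \det c *: ((\row_l \sum_k rho l k * facet_coord gamma p k) *m \adj c).

(** Multiplication by the transpose of [rho] removes [alpha_0] from the equation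
    defining the ray, the rows of [rho] having sum [0], and replaces [m] by [c]. *)
Lemma ray_vector_c p : (p.1 < r)%N && (r <= p.2)%N ->
  ray_vector p *m map_mx intr c = map_mx intr (\row_l \sum_k rho l k * facet_coord gamma p k).
Proof.
move=> hp; apply/matrixP => i l; rewrite ord1 {i} !mxE rmorph_sum /=.
have [h1 h2] := hrho.
have mrho i : c i l = \sum_k rho l k * m i k.
  under eq_bigr => k _ do rewrite (exponent_coords hc) mulrDr.
  rewrite big_split /= -mulr_suml h1 mul0r addr0.
  under eq_bigr do rewrite mulr_sumr.
  rewrite exchange_big /= (bigD1 l) //= [X in _ + X]big1 ?addr0 => [|l' l'l].
    by under eq_bigr do rewrite mulrCA; rewrite -mulr_sumr h2 eqxx mulr1.
  by under eq_bigr do rewrite mulrCA; rewrite -mulr_sumr h2 (negbTE l'l) mulr0.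
transitivity (\sum_k (rho l k)%:~R * dot (exponent m k) (ray_vector p)).
  rewrite /dot; under [RHS]eq_bigr do rewrite mulr_sumr.
  rewrite exchange_big /=; apply: eq_bigr => i _; rewrite !mxE mrho rmorph_sum mulr_sumr /=.
  by apply: eq_bigr => k _; rewrite rmorphM !mxE /=; ring.
transitivity (\sum_k ((rho l k)%:~R * (facet_coord gamma p k)%:~R - (rho l k)%:~R * alpha0 p.1 p.2)).
  by apply: eq_bigr => k _; rewrite (dot_alpha halpha) // mulrBr.
rewrite sumrB -mulr_suml -rmorph_sum /= h1 mul0r subr0.
by apply: eq_bigr => k _; rewrite rmorphM.
Qed.

Lemma scaled_rayE p : (p.1 < r)%N && (r <= p.2)%N ->
  (\det c ^+ 2)%:~R *: ray_vector p = map_mx intr (scaled_ray p).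
Proof.
move=> hp; rewrite /scaled_ray map_mxZ map_mxM -ray_vector_c // -mulmxA -map_mxM mul_mx_adj.
by rewrite map_scalar_mx mul_mx_scalar scalerA -rmorphM.
Qed.

Hypothesis detc : \det c != 0.

Lemma proper_chains_scaled_ray C p : C \in proper_chains -> p \in C ->
  (\det c ^+ 2)%:~R *: ray_vector p = map_mx intr (scaled_ray p).
Proof.
by rewrite inE => /andP[cC _] pC; apply: scaled_rayE; apply: proper_chain_ray cC pC.
Qed.

Lemma idot_scaled_ray C p k k0 : C \in proper_chains -> p \in C -> k0 \notin support C ->
  idot (exponent m k - exponent m k0) (scaled_ray p) = \det c ^+ 2 * facet_coord gamma p k.
Proof.
move=> CF pC k0C; apply: (intr_inj (R := R)).
rewrite -(dot_beta proper_chains_scaled_ray _ CF pC) [RHS]intrM; congr (_ * _).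
have hp : (p.1 < r)%N && (r <= p.2)%N.
  by move: CF; rewrite inE => /andP[cC _]; apply: proper_chain_ray cC pC.
transitivity (dot (exponent m k) (alpha p.1 p.2) - dot (exponent m k0) (alpha p.1 p.2)).
  by rewrite /dot -sumrB; apply: eq_bigr => i _; rewrite !mxE rmorphB mulrBl.
rewrite !(dot_alpha halpha) //.
have -> : facet_coord gamma p k0 = 0; last by rewrite /=; ring.
apply/eqP; rewrite (facet_coord_eq0 hneg hpos) //; apply/andP; split; apply: contra k0C => /eqP ->.
  by rewrite inE imset_f.
by rewrite inE orbC imset_f.
Qed.

Lemma support_monoid C k k0 : C \in proper_chains -> k0 \notin support C ->
  in_monoid scaled_ray C (exponent m k - exponent m k0).
Proof.
move=> CF k0C; apply/in_monoidP => p pC; rewrite (idot_scaled_ray _ CF pC k0C).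
rewrite mulr_ge0 ?sqr_ge0 // (facet_coord_ge0 hneg hpos) //.
by move: CF; rewrite inE => /andP[cC _]; apply: proper_chain_ray cC pC.
Qed.

Lemma support_on_face C k k0 : C \in proper_chains -> k0 \notin support C ->
  on_face scaled_ray C (exponent m k - exponent m k0) = (k \notin support C).
Proof.
move=> CF k0C.
have E p : p \in C -> (idot (exponent m k - exponent m k0) (scaled_ray p) == 0) = (k != p.1) && (k != p.2).
  move=> pC; rewrite (idot_scaled_ray _ CF pC k0C) mulf_eq0 expf_eq0 /= (negbTE detc) /=.
  rewrite (facet_coord_eq0 hneg hpos) //.
  by move: CF; rewrite inE => /andP[cC _]; apply: proper_chain_ray cC pC.
apply/forall_inP/idP => [h|kC p pC].
  by rewrite inE negb_or; apply/andP; split; apply/imsetP => -[p pC kp];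
    have := h p pC; rewrite E // kp eqxx ?andbF.
rewrite E //; apply/andP; split; apply: contra kC => /eqP ->.
  by rewrite inE imset_f.
by rewrite inE orbC imset_f.
Qed.

End RefinedFan.

Lemma hermite_det_neq0 d (c A H : 'M[int]_d) : H = A *m c -> is_hermite H -> \det c != 0.
Proof.
move=> eH [h1 h2 _].
have dH : \det H != 0.
  rewrite -det_tr det_trig; last by apply/is_trig_mxP => i j ij; rewrite mxE h1.
  by apply/prodf_neq0 => i _; rewrite mxE gt_eqF.
by apply: contra dH; rewrite eH det_mulmx => /eqP ->; rewrite mulr0.
Qed.

Section CountClosure.
Variables (R : realType) (F : finFieldType) (d r : nat) (m : 'M[int]_(d, d.+2)).
Variables (u : 'I_d.+2 -> F) (gamma : 'I_d.+2 -> int).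
Hypothesis hm : injective (exponent m).
Hypothesis u0 : forall j, u j != 0.
Hypothesis hneg : forall j : 'I_d.+2, (j < r)%N -> gamma j < 0.
Hypothesis hpos : forall j : 'I_d.+2, (r <= j)%N -> 0 < gamma j.
Variables (alpha0 : 'I_d.+2 -> 'I_d.+2 -> R) (alpha : 'I_d.+2 -> 'I_d.+2 -> 'rV[R]_d).
Hypothesis halpha : are_inward_normals r m gamma alpha0 alpha.
Variables (fb : 'M[int]_(d, d.+2)) (c : 'M[int]_d) (b : 'cV[int]_d).
Hypothesis hc : m = c *m fb + b *m const_mx 1.
Variable rho : 'M[int]_(d, d.+2).
Hypothesis hrho : is_dual_family fb rho.
Hypothesis detc : \det c != 0.

(** Each orbit contributes the zeros of its face polynomial, divided by the order
    of the fibres of the torus over the orbit. *)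
Lemma card_closure_points : exists N : nat,
  (closure_points (refined_fan r alpha) (laurent_of m u) #= `I_N)%card /\
  forall K : numFieldType, N%:R =
    \sum_(D in proper_chains d r) #|zeros_on m u (~: support D)|%:R / #|F|.-1%:R ^+ #|D| :> K.
Proof.
pose beta := scaled_ray gamma c rho; pose ray := ray_vector alpha.
pose Fam := proper_chains d r.
have N0 : 0 < \det c ^+ 2 by rewrite exprn_even_gt0.
have betaE : forall (C : {set _}) p, C \in Fam -> p \in C ->
    (\det c ^+ 2)%:~R *: ray p = map_mx intr (beta p).
  by move=> C p; exact: (proper_chains_scaled_ray halpha hc hrho).
have uniq : forall (C C' : {set _}) (a a' : _ -> R), C \in Fam -> C' \in Fam ->
  (forall p, p \in C -> 0 <= a p) -> (forall p, p \in C' -> 0 <= a' p) ->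
  \sum_(p in C) a p *: ray p = \sum_(p in C') a' p *: ray p ->
  forall p, (if p \in C then a p else 0) = (if p \in C' then a' p else 0).
  by move=> C C' a a'; rewrite !inE => CF C'F; exact: (cone_coords_uniq hneg hpos halpha).
have /boolp.choice[L HL] : forall C : {set 'I_d.+2 * 'I_d.+2}, exists LC : 'M[int]_d, C \in Fam ->
    [/\ LC \in unitmx, (#|C| <= d)%N &
    (forall a, on_face beta C a <-> (forall i : 'I_d, (i < #|C|)%N -> (a *m LC) 0 i = 0))].
  move=> C; case: (boolP (C \in Fam)) => [CF|]; last by exists 0.
  by have [L [h1 h2 h3 _]] := face_basis N0 betaE uniq CF; exists L.
have L_unit C : C \in Fam -> L C \in unitmx by move=> /HL[].
have L_card C : C \in Fam -> (#|C| <= d)%N by move=> /HL[].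
have L_face C a : C \in Fam ->
    on_face beta C a <-> (forall i : 'I_d, (i < #|C|)%N -> (a *m L C) 0 i = 0).
  by move=> /HL[].
have Fam_sub (C D : {set _}) : D \subset C -> C \in Fam -> D \in Fam by exact: proper_chains_sub.
have supp_proper (C : {set _}) : C \in Fam -> exists k, k \notin support C.
  by rewrite inE => /andP[_]; rewrite -subTset => /subsetPn[k _ kC]; exists k.
have supp_mon (C : {set _}) k k0 : C \in Fam -> k0 \notin support C ->
    in_monoid beta C (exponent m k - exponent m k0).
  exact: (support_monoid hneg hpos halpha hc hrho).
have supp_face (C : {set _}) k k0 : C \in Fam -> k0 \notin support C ->
    on_face beta C (exponent m k - exponent m k0) = (k \notin support C).
  exact: (support_on_face hneg hpos halpha hc hrho detc).
have cond (C D : {set _}) z : C \in Fam -> D \subset C -> normalized D z ->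
    chart_closure (laurent_of m u) (cone_of ray C) (orbit_point beta L C D z) <->
    face_zero m u L (@support d) D z.
  have sm : forall C D : {set 'I_d.+2 * 'I_d.+2}, D \subset C -> support D \subset support C.
    exact: supportS.
  by move=> CF DC nz; exact: (chart_closure_orbit hm u0 N0 Fam_sub betaE L sm).
have := card_toric_points N0 Fam_sub betaE uniq L_unit L_face
  (Q := [set pt | chart_closure (laurent_of m u) pt.1 pt.2])
  (E := face_zero m u L (@support d)) (fun pt => @proj1 _ _) cond.
rewrite -refined_fanE; set N := #|_| => cN; exists N; split; first exact: cN.
move=> K; rewrite /N -sum1_card (partition_big fst (mem Fam)) /=; last first.
  by move=> [D z]; rewrite inE /= => /and3P[].
rewrite natr_sum; apply: eq_bigr => D DF.
have [k0 k0D] := supp_proper D DF.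
have q10 : #|F|.-1%:R != 0 :> K by rewrite pnatr_eq0 -card_pred_succ.
have suppf k : k \notin support D -> on_face beta D (exponent m k - exponent m k0).
  by move=> kD; rewrite supp_face.
rewrite -(card_normal_forms u (supp := @support d) (L_unit D DF) (L_card D DF) (fun a => proj1 (L_face D a DF)) k0D suppf).
rewrite natrM natrX mulfK ?expf_neq0 //; congr (_%:R).
have injD : injective (fun z : {ffun 'I_d -> F} => (D, z)) by move=> z z' [].
rewrite sum1dep_card -[RHS](card_imset _ injD).
apply: eq_card => -[D' z]; rewrite !inE /=; apply/andP/imsetP => [[/and3P[_ nz ez] /eqP eD]|].
  by subst D'; exists z; rewrite // inE nz.
move=> [z' + [-> ->]]; rewrite inE => /andP[nz ez].
by move: DF; rewrite inE => ->; rewrite nz ez eqxx.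
Qed.

End CountClosure.

(** * Summing over the orbits *)

Lemma card_neg_idx d r : (r <= d.+2)%N -> #|neg_idx d r| = r.
Proof.
move=> le_r; rewrite -sum1_card (eq_bigl (fun k : 'I_d.+2 => (k < r)%N)) => [|k].
  by rewrite -(big_ord_widen d.+2 (fun=> 1%N) le_r) sum1_card card_ord.
by rewrite inE.
Qed.

Lemma card_pos_idx d r : (r <= d.+2)%N -> #|pos_idx d r| = (d.+2 - r)%N.
Proof.
move=> le_r; have := cardsC (neg_idx d r); rewrite card_neg_idx // card_ord => e.
have -> : pos_idx d r = (~: neg_idx d r)%SET by apply/setP => k; rewrite !inE leqNgt.
by move: e; move: #|_| => N; lia.
Qed.

Section ChainsInZeroSet.
Variables (d r : nat).
Implicit Types (D : {set 'I_d.+2 * 'I_d.+2}) (Z : {set 'I_d.+2}).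

Lemma neg_posI : (neg_idx d r :&: pos_idx d r)%SET = finset.set0.
Proof. by apply/setP => k; rewrite !inE; lia. Qed.

Lemma card_support D : D \in chains (neg_idx d r) (pos_idx d r) ->
  #|support D| = (#|(fst @: D)%SET| + #|(snd @: D)%SET|)%N.
Proof.
move=> /chain_imset/andP[h1 h2]; rewrite cardsU.
suff -> : (fst @: D :&: snd @: D)%SET = finset.set0 by rewrite cards0 subn0.
by apply/eqP; rewrite -finset.subset0 -neg_posI finset.setISS.
Qed.

Lemma chains_zero_set D Z :
  (D \in chains (neg_idx d r :&: Z)%SET (pos_idx d r :&: Z)%SET) =
  (D \in chains (neg_idx d r) (pos_idx d r)) && (support D \subset Z).
Proof.
rewrite !inE andbAC; congr (_ && _); apply/idP/andP => [sD|[sD SZ]].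
  split; first by apply: fintype.subset_trans sD (finset.setXS _ _); apply: subsetIl.
  apply/fintype.subsetP => k; rewrite inE => /orP[]/imsetP[p pD ->].
    by have := fintype.subsetP sD p pD; rewrite !inE => /andP[/andP[_ ->]].
  by have := fintype.subsetP sD p pD; rewrite !inE => /andP[_ /andP[_ ->]].
apply/fintype.subsetP => p pD; have := fintype.subsetP sD p pD; rewrite !inE => /andP[-> ->] /=.
have -> : p.1 \in Z by apply: (fintype.subsetP SZ); rewrite inE imset_f.
by apply: (fintype.subsetP SZ); rewrite inE orbC imset_f.
Qed.

Lemma full_support D : D \in chains (neg_idx d r) (pos_idx d r) ->
  (support D == [set: 'I_d.+2]%SET) = (D \in full_chains (neg_idx d r) (pos_idx d r)).
Proof.
move=> cD; rewrite inE cD /=; have /andP[s1 s2] := chain_imset cD.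
have NP : (neg_idx d r :|: pos_idx d r = [set: 'I_d.+2])%SET by apply/setP => k; rewrite !inE; lia.
apply/eqP/andP => [e|[/eqP e1 /eqP e2]]; last by rewrite /support e1 e2.
have e' k : (k \in (fst @: D)%SET) || (k \in (snd @: D)%SET).
  have : k \in support D by rewrite e finset.in_setT.
  by rewrite /support inE.
split; rewrite finset.eqEsubset ?s1 ?s2 /=; apply/fintype.subsetP => k kA.
  case/orP: (e' k) => // /(fintype.subsetP s2) kB.
  by move: kA kB; rewrite !inE; lia.
case/orP: (e' k) => // /(fintype.subsetP s1) kB.
by move: kA kB; rewrite !inE; lia.
Qed.

End ChainsInZeroSet.

Section FinalSum.
Variables (R : realType) (F : finFieldType) (psi chi : F -> R[i]).
Hypothesis psi_char : is_nontrivial_additive_character psi.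
Hypothesis chi_char : is_multiplicative_character chi.
Hypothesis chi_order : has_character_order chi #|F|.-1.
Variables (d r s : nat) (m : 'M[int]_(d, d.+2)) (u : 'I_d.+2 -> F).
Hypothesis u0 : forall j, u j != 0.
Hypothesis hrs : (r + s)%N = d.+2.

Local Notation q := (#|F|%:R : R[i]).
Local Notation x := (#|F|.-1%:R : R[i]).
Local Notation neg := (neg_idx d r).
Local Notation pos := (pos_idx d r).
Local Notation tg := (twisted_gauss psi chi u).
Implicit Types (v : {ffun 'I_d.+2 -> Zq F}) (D : {set 'I_d.+2 * 'I_d.+2}).

Let card_neg : #|neg| = r. Proof. by apply: card_neg_idx; rewrite -hrs leq_addr. Qed.
Let card_pos : #|pos| = s.
Proof. by rewrite card_pos_idx -hrs ?leq_addr // addKn. Qed.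

Definition zero_set v : {set 'I_d.+2} := [set j | v j == 0]%SET.

Let Full : R[i] := \sum_(D in full_chains neg pos) x^-1 ^+ #|D|.

Lemma unit_count_neq0 : x != 0.
Proof. by rewrite pnatr_eq0 -card_pred_succ. Qed.

Lemma unit_count_succ : x + 1 = q.
Proof. by rewrite natr1 prednK // (ltn_trans _ (card_finNzRing_gt1 F)). Qed.

Lemma field_card_neq0 : q != 0.
Proof. by rewrite pnatr_eq0 -lt0n (ltn_trans _ (card_finNzRing_gt1 F)). Qed.

Lemma sum_proper_chains (h : {set 'I_d.+2 * 'I_d.+2} -> R[i]) (P : pred {set 'I_d.+2 * 'I_d.+2}) :
  \sum_(D in proper_chains d r | P D) h D =
  \sum_(D in chains neg pos | P D) h D - \sum_(D in full_chains neg pos | P D) h D.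
Proof.
rewrite [X in _ = X - _](bigID (fun D => support D == [set: 'I_d.+2]%SET)) /= [RHS]addrC addrA.
rewrite [X in _ = - X + _ + _](eq_bigl (fun D => ((D \in chains neg pos) && P D) && (support D == [set: 'I_d.+2]%SET))).
  rewrite addNr add0r; apply: eq_bigl => D.
  by rewrite inE /proper_chain andbAC.
move=> D; rewrite [in LHS]inE andbAC; case cD: (D \in chains neg pos) => //=.
by rewrite (full_support cD) inE cD.
Qed.

(** The chains with support in the zero set of [v] are all the chains of a product
    of two index sets, so that [signed_chain_sum] applies. For [v = 0] this includes
    the chains of full support, which are not in the fan. *)
Lemma stratum_weight v : v \in relations F m ->
  tg v * (\sum_(D in proper_chains d r | support D \subset zero_set v) (- x) ^+ #|support D| * x^-1 ^+ #|D|)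
  = tg v * q ^+ minn #|neg :&: zero_set v| #|pos :&: zero_set v|
    - (if v == 0 then x ^+ d.+2 * Full else 0).
Proof.
move=> vr; rewrite sum_proper_chains mulrBr; congr (_ - _).
  rewrite -unit_count_succ -(signed_chain_sum unit_count_neq0); congr (_ * _).
  rewrite /chain_sum; apply: eq_big => D; first by rewrite chains_zero_set.
  by move=> /andP[cD _]; rewrite /chain_weight (card_support cD).
case: eqP => [->|v0]; last first.
  rewrite big1 ?mulr0 // => D /andP[fD SZ]; case: v0; apply/ffunP => j; rewrite ffunE.
  have cD : D \in chains neg pos by move: fD; rewrite inE => /andP[].
  move: fD; rewrite -full_support // => /eqP eS.
  by have := fintype.subsetP SZ j; rewrite eS !inE => /(_ isT) /eqP.
have tg0 : tg 0 = (-1) ^+ d.+2.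
  rewrite /twisted_gauss big1 ?mul1r => [|j _]; last by rewrite ffunE expr0 invr1.
  rewrite /gauss_vec (eq_bigr (fun=> -1)) => [|j _]; last by rewrite ffunE (gauss0 chi psi_char).
  by rewrite prodr_const card_ord.
rewrite tg0 (eq_bigl (fun D => D \in full_chains neg pos)); last first.
  move=> D; case: (D \in full_chains _ _) => //=.
  by apply/fintype.subsetP => j _; rewrite inE ffunE.
rewrite /Full !mulr_sumr; apply: eq_bigr => D fD.
have cD : D \in chains neg pos by move: fD; rewrite inE => /andP[].
move: fD; rewrite -full_support // => /eqP ->; rewrite cardsT card_ord mulrA -exprMn.
by rewrite mulN1r opprK.
Qed.

Lemma sum_strata :
  \sum_(D in proper_chains d r) #|zeros_on m u (~: support D)|%:R / x ^+ #|D| =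
  q^-1 * (x ^+ d * (plain_sum x r s - Full) + x^-1 * (
    \sum_(v in relations F m) tg v * q ^+ minn #|neg :&: zero_set v| #|pos :&: zero_set v|
    - x ^+ d.+2 * Full)).
Proof.
have x0 := unit_count_neq0; have q0 := field_card_neq0.
transitivity (\sum_(D in proper_chains d r) q^-1 * (x ^+ d * x^-1 ^+ #|D| +
    x^-1 * \sum_(v in relations F m | support D \subset zero_set v)
      tg v * ((- x) ^+ #|support D| * x^-1 ^+ #|D|))).
  apply: eq_bigr => D _; apply: (mulfI q0); rewrite mulVKf // mulrA.
  have E : x ^+ d.+1 * x^-1 ^+ #|~: support D| = x^-1 * x ^+ #|support D|.
    have := cardsC (support D); rewrite card_ord.
    move: #|support D| #|~: support D| => i j e.
    apply: (mulfI x0); rewrite mulVKf // mulrA -exprS -e exprD exprVn mulfK // expf_neq0 //.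
  rewrite (hypersurface_count psi_char chi_char chi_order m u0) E finset.setCK mulrDl.
  congr (_ + _); first by rewrite exprVn.
  rewrite -!mulrA; congr (_ * _); rewrite mulrA mulr_suml mulr_sumr.
  apply: eq_big => [v|v _]; last by rewrite [(- x) ^+ _]exprNn exprVn; ring.
  congr (_ && _); apply/forall_inP/fintype.subsetP => h j jD; first by rewrite inE h.
  by have := h j jD; rewrite inE.
rewrite -mulr_sumr big_split /=; congr (_ * (_ + _)).
  rewrite -mulr_sumr; congr (_ * _).
  have -> : plain_sum x r s = chain_sum 1 x^-1 neg pos.
    by rewrite (plain_chain_sum x0) ?unit_count_succ // card_neg card_pos.
  transitivity (\sum_(D in proper_chains d r | xpredT D) x^-1 ^+ #|D|).
    by apply: eq_bigl => D /=; rewrite andbT.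
  rewrite sum_proper_chains; congr (_ - _); last by apply: eq_bigl => D /=; rewrite andbT.
  apply: eq_big => [D|D _] /=; first by rewrite andbT.
  by rewrite /chain_weight expr1n mul1r.
rewrite -mulr_sumr; congr (_ * _).
rewrite (exchange_big_dep (mem (relations F m))) /=; last by move=> D v _ /andP[].
transitivity (\sum_(v in relations F m) (tg v * q ^+ minn #|neg :&: zero_set v| #|pos :&: zero_set v|
    - (if v == 0 then x ^+ d.+2 * Full else 0))).
  apply: eq_bigr => v vr; rewrite -stratum_weight // mulr_sumr.
  by apply: eq_bigl => D; rewrite vr.
rewrite sumrB; congr (_ - _); rewrite (bigD1 (0 : {ffun 'I_d.+2 -> Zq F})) /=.
  by rewrite eqxx big1 ?addr0 // => v /andP[_ /negbTE ->].
rewrite inE; apply/andP; split; first by rewrite big1 // => j _; rewrite ffunE.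
by apply/forallP => i; rewrite big1 // => j _; rewrite ffunE mul0rz.
Qed.

(** The two chain sums are the h-polynomial of the same triangulation at [1 / q]
    and at [q]. *)
Lemma plain_minus_full a b : r = a.+1 -> s = b.+1 ->
  q^-1 * (x ^+ d * (plain_sum x r s - Full) + x^-1 * - (x ^+ d.+2 * Full)) =
  \sum_(k < minn r s) ('C(r.-1, k) * 'C(s.-1, k))%:R * ((q ^+ (d - k) - q ^+ k) / (q - 1)).
Proof.
move=> er es; have x0 := unit_count_neq0; have q0 := field_card_neq0.
have dab : d = (a + b)%N by move: hrs; rewrite er es; lia.
have -> : Full = x^-1 ^+ d.+1 * binom_sum a b q.
  rewrite /Full (full_chain_sum x0 (a := a) (b := b)) ?card_neg ?card_pos // unit_count_succ.
  by rewrite dab.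
have -> : plain_sum x r s = (q / x) ^+ d.+1 * binom_sum a b q^-1.
  by rewrite er es /plain_sum unit_count_succ dab.
have -> : \sum_(k < minn r s) ('C(r.-1, k) * 'C(s.-1, k))%:R * ((q ^+ (d - k) - q ^+ k) / (q - 1))
   = x^-1 * (q ^+ d * binom_sum a b q^-1 - binom_sum a b q).
  rewrite /binom_sum er es minnSS mulr_sumr -sumrB mulr_sumr; apply: eq_bigr => k _ /=.
  have kd : (k <= d)%N by rewrite dab; have := ltn_ord k; lia.
  have -> : q ^+ (d - k) = q ^+ d * q^-1 ^+ k.
    by rewrite -{2}(subnK kd) exprD -mulrA -exprMn divff // expr1n mulr1.
  have -> : q - 1 = x by rewrite -unit_count_succ addrK.
  by ring.
move: (binom_sum a b q^-1) (binom_sum a b q) => h1 h2.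
rewrite -unit_count_succ in q0 *; move: q0 x0; move: (x) => y q0 x0.
rewrite !exprS expr_div_n !exprVn.
have yd : y ^+ d != 0 by rewrite expf_neq0.
by move: (y ^+ d) ((y + 1) ^+ d) yd => Y Q Y0; field; rewrite x0 Y0 q0.
Qed.

End FinalSum.

(** * The point count *)

(** The components of [gamma] are nonzero with sum [0], so both signs occur. *)
Lemma gale_dual_signs d (m : 'M[int]_(d, d.+2)) (gamma : 'I_d.+2 -> int) r s :
  is_gale_dual m gamma -> (r + s)%N = d.+2 ->
  (forall j : 'I_d.+2, (j < r)%N -> gamma j < 0) ->
  (forall j : 'I_d.+2, (r <= j)%N -> 0 < gamma j) -> (0 < r)%N && (0 < s)%N.
Proof.
move=> [sum0 _ _] hrs hneg hpos; rewrite !lt0n; apply/andP; split; apply/eqP => e.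
  have : 0 < \sum_j gamma j.
    rewrite (bigD1 ord0) //= ltr_pwDl ?hpos ?e // sumr_ge0 // => j _.
    by rewrite ltW // hpos // e.
  by rewrite sum0 ltxx.
have lt_r (j : 'I_d.+2) : (j < r)%N by rewrite (leq_trans (ltn_ord j)) // -hrs e addn0.
have : 0 < - \sum_j gamma j.
  rewrite -sumrN (bigD1 ord0) //= ltr_pwDl ?oppr_gt0 ?hneg // sumr_ge0 // => j _.
  by rewrite oppr_ge0 ltW // hneg.
by rewrite sum0 oppr0 ltxx.
Qed.

Theorem theorem1p8 (R : realType) (F : finFieldType) (psi chi : F -> R[i])
    (hpsi : is_nontrivial_additive_character psi)
    (hchi : is_multiplicative_character chi)
    (hchi_order : has_character_order chi #|F|.-1)
    (d : nat) (m : 'M[int]_(d, d.+2)) (u : 'I_d.+2 -> F)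
    (hu : forall j, u j != 0)
    (hm : injective (exponent m))
    (hdim : has_affine_dim (newton_polytope R (laurent_of m u)) d)
    (gamma : 'I_d.+2 -> int) (hgamma : is_gale_dual m gamma)
    (hgamma_neq0 : forall j, gamma j != 0)
    (r s : nat) (hrs : (r + s)%N = d.+2)
    (hneg : forall j : 'I_d.+2, (j < r)%N -> gamma j < 0)
    (hpos : forall j : 'I_d.+2, (r <= j)%N -> 0 < gamma j)
    (fb : 'M[int]_(d, d.+2)) (hfb : is_kernel_basis gamma fb)
    (c : 'M[int]_d) (b : 'cV[int]_d)
    (hc : m = c *m fb + b *m const_mx 1)
    (A H : 'M[int]_d) (hA : A \in unitmx) (hHA : H = A *m c)
    (hH : is_hermite H)
    (rho : 'M[int]_(d, d.+2)) (hrho : is_dual_family fb rho)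
    (alpha0 : 'I_d.+2 -> 'I_d.+2 -> R)
    (alpha : 'I_d.+2 -> 'I_d.+2 -> 'rV[R]_d)
    (halpha : are_inward_normals r m gamma alpha0 alpha)
    (hq : coprime #|F| (absz (\prod_j gamma j))) :
  let q : R[i] := #|F|%:R in
  let N : 'M[int]_d := H^T in
  let t : F := \prod_j u j ^ gamma j in
  let sigma (k : 'I_d) : F := \prod_j u j ^ rho k j in
  exists n : nat,
    (closure_points (refined_fan r alpha) (laurent_of m u) #= `I_n)%card /\
    n%:R =
      \sum_(k < minn r s)
        ('C(r.-1, k) * 'C(s.-1, k))%:R * ((q ^+ (d - k) - q ^+ k) / (q - 1))
      - \sum_(lambda in Lambda F N)
          (\prod_k chi (sigma k) ^- lambda k)
          * q ^ ((hyp_mult R gamma (delta_of rho lambda) 0)%:Z - 1)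
          * gauss_vec psi chi (delta_of rho lambda)
          * hyp_sum gamma psi chi (delta_of rho lambda)
              (t / gamma_gamma F gamma).
Proof.
move=> q N t sigma.
have detc := hermite_det_neq0 hHA hH.
have /andP[r0 s0] := gale_dual_signs hgamma hrs hneg hpos.
have [n [cn en]] :=
  @card_closure_points R F d r m u gamma hm hu hneg hpos alpha0 alpha halpha fb c b hc rho hrho detc.
exists n; split; first exact: cn.
rewrite en (sum_strata hpsi hchi hchi_order m hu hrs).
rewrite (hypergeometric_side hpsi hchi hchi_order hu hgamma hgamma_neq0 hfb hc hA hHA hrho hq).
have <- : \sum_(v in relations F m) twisted_gauss psi chi u v *
      #|F|%:R ^+ minn #|neg_idx d r :&: zero_set v|%SET #|pos_idx d r :&: zero_set v|%SET
    = \sum_(v in relations F m) twisted_gauss psi chi u v *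
      #|F|%:R ^+ minn #|zeros_neg gamma v| #|zeros_pos gamma v| :> R[i].
  apply: eq_bigr => v _; congr (_ * _ ^+ minn _ _); apply: eq_card => j; rewrite !inE.
    congr (_ && _); case: (ltnP j r) => hj; first by rewrite hneg.
    by apply/esym/negbTE; rewrite -leNgt ltW // hpos.
  congr (_ && _); case: (leqP r j) => hj; first by rewrite hpos.
  by apply/esym/negbTE; rewrite -leNgt ltW // hneg.
rewrite -(@plain_minus_full R F d r s hrs r.-1 s.-1) ?prednK //.
rewrite mulNr opprK -/q.
set G := \sum_(v in relations F m) _.
have -> : (q * (q - 1))^-1 * G = q^-1 * (#|F|.-1%:R^-1 * G).
  by rewrite /q -(unit_count_succ R F) addrK invfM mulrA.
rewrite -mulrDr -addrA; congr (_ * (_ + _)).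
by rewrite -mulrDr addrC.
Qed.
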